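(* Let $\alpha,\beta,\sigma\in\mathbb{R}$ and $\mu>0$ be such that $\alpha_0:=\alpha+\sigma>0$ and $\beta_0:=\beta+2\mu\sigma>0$. For every $\lambda>0$, with $I$, $M_\lambda$ and $\mathcal{S}_\lambda$ as defined in the context, the following hold. (i) $0<M_\lambda<\infty$. (ii) For every sequence $\{(f_n,g_n)\}$ in $H^1(\mathbb{R})\times H^1(\mathbb{R})$ such that $$\lim_{n\to\infty}\int_{\mathbb{R}}f_n^2g_n\,dx=\lambda\quad\text{and}\quad \lim_{n\to\infty}I(f_n,g_n)=M_\lambda,$$ there exist a subsequence $\{(f_{n_k},g_{n_k})\}$ and a sequence of real numbers $\{y_k\}$ such that $\{(f_{n_k}(\cdot+y_k),g_{n_k}(\cdot+y_k))\}$ converges strongly in $H^1(\mathbb{R})\times H^1(\mathbb{R})$ to some $(\phi,\psi)\in\mathcal{S}_\lambda$. In particular, $\mathcal{S}_\lambda$ is non-empty. (iii) For each $(\phi,\psi)\in\mathcal{S}_\lambda$ there is a nonzero real constant $c$ such that $(\Phi,\Psi)=(c\phi,c\psi)$ is a solution of $$\Phi''-\alpha_0\Phi+\Phi\Psi=0,\qquad \Psi''-\beta_0\Psi+\tfrac12\Phi^2=0 \quad\text{on }\mathbb{R},$$ and hence $(W(x,t),V(x,t))=(e^{i\sigma t}\Phi(x),e^{2i\sigma t}\Psi(x))$ is a travelling-wave solution of $$i\frac{\partial W}{\partial t}+\frac{\partial^2W}{\partial x^2}-\alpha W+\overline{W}V=0,\qquad i\mu\frac{\partial V}{\partial t}+\frac{\partial^2V}{\partial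 x^2}-\beta V+\tfrac12W^2=0$$ (so that, with $\sigma$ as parameter, one obtains a one-parameter family of such solutions). (iv) If $(\phi,\psi)\in\mathcal{S}_\lambda$, then $\phi,\psi\in H^\infty(\mathbb{R})$, and $\phi,\psi$ decay exponentially at infinity, i.e. there exist $\delta>0$ and $C>0$ with $|\phi(x)|+|\psi(x)|\le Ce^{-\delta|x|}$ for all $x\in\mathbb{R}$.
   Context: $H^s(\mathbb{R})$ denotes the $L^2$-based Sobolev space of order $s$ of real-valued functions on $\mathbb{R}$, and $H^\infty(\mathbb{R})=\bigcap_{s\ge0}H^s(\mathbb{R})$. For $(f,g)\in H^1(\mathbb{R})\times H^1(\mathbb{R})$ define $$I(f,g)=\int_{\mathbb{R}}\left((f')^2+(g')^2+\alpha_0f^2+\beta_0g^2\right)dx .$$ For $\lambda>0$ define $$M_\lambda=\inf\left\{I(f,g):(f,g)\in H^1(\mathbb{R})\times H^1(\mathbb{R}),\ \int_{\mathbb{R}}f^2g\,dx=\lambda\right\},$$ $$\mathcal{S}_\lambda=\left\{(f,g)\in H^1(\mathbb{R})\times H^1(\mathbb{R}): I(f,g)=M_\lambda,\ \int_{\mathbb{R}}f^2g\,dx=\lambda\right\}.$$ *)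

(* Defs.v *)
From HB Require Import structures.
From mathcomp Require Import all_boot all_order all_algebra.
From mathcomp Require Import all_classical all_reals all_analysis.
From mathcomp Require Import complex.

Set Implicit Arguments.
Unset Strict Implicit.
Unset Printing Implicit Defensive.

Import Order.TTheory GRing.Theory Num.Theory.
Import numFieldNormedType.Exports.

Local Open Scope classical_set_scope.
Local Open Scope ring_scope.

Section Sobolev.
Variable R : realType.
Implicit Types (f g F phi : R -> R) (s theta : R) (k : nat).

Local Notation leb := (@lebesgue_measure R).

(** Elements of L^2 and of the Sobolev spaces are represented by (Borel)
    measurable functions [R -> R]; every notion below is invariant under
    modification of such a function on a null set. *)

(* The test functions C_c^infty(R). *)
Definition test_function phi : Prop :=
  (forall n x, derivable (derive1n n phi) x 1) /\
  compact (closure [set x | phi x != 0]).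

Definition is_weak_deriv k f g : Prop :=
  [/\ locally_integrable setT f, locally_integrable setT g &
   forall phi, test_function phi ->
     \int[leb]_x (f x * derive1n k phi x) = (-1) ^+ k * \int[leb]_x (g x * phi x)].

(* Some k-th weak derivative of f; it is determined up to a null set by f, and
   is the junk value 0 when f has no k-th weak derivative. *)
Definition weak_deriv k f : R -> R := xget (cst 0) [set g | is_weak_deriv k f g].

Definition has_weak_deriv_L2 k f : Prop :=
  is_weak_deriv k f (weak_deriv k f) /\ weak_deriv k f \in Lfun leb 2%:E.

(* The square of the Sobolev-Slobodeckij seminorm of order theta. *)
Definition gagliardo theta f : \bar R :=
  (\int[leb]_x \int[leb]_y
     ((f x - f y) ^+ 2 / `|x - y| `^ (1 + 2 * theta))%:E)%E.

(* H^s(R) for a real order s >= 0: with m the integer part of s, f and its weak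
   derivatives up to order m are in L^2 and, when s is not an integer, the m-th
   one has a finite Slobodeckij seminorm of order s - m.  For an integer s this
   is the usual space of functions with s weak derivatives in L^2. *)
Definition Hs s f : Prop :=
  [/\ f \in Lfun leb 2%:E,
      forall k, (k <= Num.truncn s)%N -> has_weak_deriv_L2 k f &
      let theta := s - (Num.truncn s)%:R in
      0 < theta -> (gagliardo theta (weak_deriv (Num.truncn s) f) < +oo)%E].

Definition H1 f : Prop := Hs 1 f.

Definition Hinfty f : Prop := forall s, 0 <= s -> Hs s f.

Definition H1norm f : \bar R :=
  ((\int[leb]_x (f x ^+ 2 + weak_deriv 1 f x ^+ 2)%:E) `^ 2^-1)%E.

(* F is the continuous representative of the class of f modulo null sets;
   pointwise assertions about elements of H^1 refer to it. *)
Definition continuous_rep f F : Prop :=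
  continuous F /\ {ae leb, forall x, F x = f x}.

End Sobolev.

Section Minimization.
Variables (R : realType) (alpha0 beta0 : R).
Implicit Types (f g : R -> R) (lambda : R).

Local Notation leb := (@lebesgue_measure R).

(* The integrand is nonnegative for alpha0, beta0 > 0, and the integral is
   finite on H^1 x H^1. *)
Definition energy f g : \bar R :=
  (\int[leb]_x (weak_deriv 1 f x ^+ 2 + weak_deriv 1 g x ^+ 2
                + alpha0 * f x ^+ 2 + beta0 * g x ^+ 2)%:E)%E.

Definition constr f g : \bar R := (\int[leb]_x (f x ^+ 2 * g x)%:E)%E.

Definition admissible lambda : set ((R -> R) * (R -> R)) :=
  [set fg | [/\ H1 fg.1, H1 fg.2 & constr fg.1 fg.2 = lambda%:E]].

Definition Mmin lambda : \bar R :=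
  ereal_inf [set energy fg.1 fg.2 | fg in admissible lambda].

Definition Smin lambda : set ((R -> R) * (R -> R)) :=
  [set fg | admissible lambda fg /\ energy fg.1 fg.2 = Mmin lambda].

End Minimization.

Section Equations.
Variable R : realType.
Local Open Scope complex_scope.

Definition ode_solution (alpha0 beta0 : R) (Phi Psi : R -> R) : Prop :=
  forall x : R,
    [/\ derivable Phi x 1, derivable (derive1 Phi) x 1,
        derivable Psi x 1 & derivable (derive1 Psi) x 1] /\
    derive1n 2 Phi x - alpha0 * Phi x + Phi x * Psi x = 0 /\
    derive1n 2 Psi x - beta0 * Psi x + 2^-1 * Phi x ^+ 2 = 0.

(* Differentiation of complex-valued functions of a real variable. *)
Definition cderivable (z : R -> R[i]) (x : R) : Prop :=
  derivable (fun y => complex.Re (z y)) x 1 /\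
  derivable (fun y => complex.Im (z y)) x 1.

Definition cderive (z : R -> R[i]) (x : R) : R[i] :=
  derive1 (fun y => complex.Re (z y)) x +i* derive1 (fun y => complex.Im (z y)) x.

(* W and V are functions of x and t, in this order. *)
Definition nls_solution (alpha beta mu : R) (W V : R -> R -> R[i]) : Prop :=
  forall x t : R,
    [/\ cderivable (W x) t, cderivable (W ^~ t) x &
        cderivable (cderive (W ^~ t)) x] /\
    [/\ cderivable (V x) t, cderivable (V ^~ t) x &
        cderivable (cderive (V ^~ t)) x] /\
    'i * cderive (W x) t + cderive (cderive (W ^~ t)) x
      - alpha%:C * W x t + (W x t)^* * V x t = 0 /\
    'i * mu%:C * cderive (V x) t + cderive (cderive (V ^~ t)) x
      - beta%:C * V x t + 2^-1 * W x t ^+ 2 = 0.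

(* e^{i theta} *)
Definition expi (theta : R) : R[i] := cos theta +i* sin theta.

End Equations.

(* Main.v *)
(* The functionals are homogeneous, of degrees 2 and 3, so every pair satisfies
   lambda^2 I^3 >= M^3 J^2 where J is the integral of f^2 g.  Existence: if two
   pieces of an almost minimizer both carried a fixed part of the constraint,
   cutting it at points where it is small and regluing would, by strict concavity
   of t^(2/3), beat M; hence, after translating a point where g is not small to
   the origin, almost minimizers are uniformly small far out.  With the Hoelder
   estimate this gives a uniform cluster point (Tychonoff), and two uniformly
   close almost minimizers are close in H^1 by the parallelogram law, because
   their midpoint almost satisfies the constraint; completeness of L^2 yields the
   limit.

   Regularity: minimality of t |-> lambda^2 I^3 - M^3 J^2 along lines gives the
   weak Euler-Lagrange system, whose solutions are C^2 by du Bois-Reymond's lemma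
   and become solutions of the equations after multiplication by
   kappa = 2 M / (3 lambda).  As f and g vanish at infinity, u = f^2 + g^2
   satisfies u'' >= d^2 u far out and therefore decays like e^(-d |x|).  The
   algebra generated by f, g, f', g' is stable under differentiation and consists
   of exponentially decaying functions, which lie in every H^s. *)
Require Import Defs.
From HB Require Import structures.
From mathcomp Require Import all_boot all_order all_algebra.
From mathcomp Require Import all_classical all_reals all_analysis.
From mathcomp Require Import complex ring lra measurable_realfun.

Set Implicit Arguments.
Unset Strict Implicit.
Unset Printing Implicit Defensive.

Import Order.TTheory GRing.Theory Num.Theory.
Import numFieldNormedType.Exports.

Local Open Scope classical_set_scope.
Local Open Scope ring_scope.

(** The calculus runs on pairs [(F, p)] with [F y - F x] equal to the integral of [p] over [x, y];
    the spaces of the statement, with their null sets and weak derivatives, enter only through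
    [h1_rep]. The obstacle is translation invariance: a minimizing sequence may flatten out or
    split. Flattening is excluded by |J| <= sup |g| int f^2. Against splitting, it matters that the
    inequality between I and J is free of the constraint: it applies to pieces with any value of J,
    even a negative one. The cut trades the part of the pair over [a, b] for a pair of tent
    functions with the same values at a and b, so that both results stay in H^1. Compactness is
    sought in the sup norm because at bounded energy J is Lipschitz for it. The number kappa is read
    off at t = 0: with B the bilinear form of I and J' the first variation of J, the vanishing
    derivative says 3 lambda B = M J', that is B = (kappa / 2) J'. Orders s that are not integers
    are reached by splitting the Slobodeckij integral at |x - y| = 1, with a Lipschitz bound inside
    and decay outside. *)

Section real_integrals.
Variable R : realType.
Local Notation mu := (@lebesgue_measure R).
Implicit Types (f g : R -> R) (A D : set R) (c : R).

(** * Real-valued integrals, square integrability and translations *)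

Definition Ig D f : Prop := mu.-integrable D (EFin \o f).
Definition Rint f : R := \int[mu]_x f x.
Definition L2 f : Prop := measurable_fun setT f /\ Ig setT (fun x => f x ^+ 2).

Lemma Ig_meas D f : Ig D f -> measurable_fun D f.
Proof. by move=> /measurable_int /measurable_EFinP. Qed.

Lemma Ig_le D f g : measurable D -> measurable_fun D f ->
  (forall x, D x -> `|f x| <= g x) -> Ig D g -> Ig D f.
Proof.
move=> mD mf fg; apply: le_integrable => //; first exact/measurable_EFinP.
by move=> x Dx /=; rewrite lee_fin (le_trans (fg _ Dx))// ler_norm.
Qed.

Lemma IgD D f g : measurable D -> Ig D f -> Ig D g -> Ig D (fun x => f x + g x).
Proof. by move=> mD; apply: integrableD. Qed.

Lemma IgZ D c f : measurable D -> Ig D f -> Ig D (fun x => c * f x).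
Proof. by move=> mD; apply: integrableZl. Qed.

Lemma IgN D f : measurable D -> Ig D f -> Ig D (fun x => - f x).
Proof.
by move=> mD; apply: integrableN.
Qed.

Lemma IgB D f g : measurable D -> Ig D f -> Ig D g -> Ig D (fun x => f x - g x).
Proof. by move=> mD If Ig'; apply: IgD => //; exact: IgN. Qed.

Lemma IgS A D f : measurable A -> measurable D -> D `<=` A -> Ig A f -> Ig D f.
Proof. by move=> mA mD DA; exact: integrableS. Qed.

Lemma IgT D f : measurable D -> Ig setT f -> Ig D f.
Proof. by move=> mD; exact: integrableS. Qed.

Lemma Ig_abs D f : measurable D -> Ig D f -> Ig D (fun x => `|f x|).
Proof. by move=> mD; apply: integrable_norm. Qed.

Lemma EFin_Rint f : Ig setT f -> (\int[mu]_x (f x)%:E)%E = (Rint f)%:E.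
Proof. by move=> If; rewrite /Rint /Rintegral fineK//; exact: integrable_fin_num. Qed.

Lemma eq_Rint f g : f =1 g -> Rint f = Rint g.
Proof. by move=> fg; apply: eq_Rintegral => x _; exact: fg. Qed.

Lemma RintD f g : Ig setT f -> Ig setT g ->
  Rint (fun x => f x + g x) = Rint f + Rint g.
Proof. exact: RintegralD. Qed.

Lemma RintB f g : Ig setT f -> Ig setT g ->
  Rint (fun x => f x - g x) = Rint f - Rint g.
Proof. exact: RintegralB. Qed.

Lemma RintZ c f : Ig setT f -> Rint (fun x => c * f x) = c * Rint f.
Proof. exact: RintegralZl. Qed.

Lemma le_Rint f g : Ig setT f -> Ig setT g -> (forall x, f x <= g x) ->
  Rint f <= Rint g.
Proof. by move=> If Ig' fg; apply: le_Rintegral. Qed.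

Lemma Rint_ge0 f : (forall x, 0 <= f x) -> 0 <= Rint f.
Proof. by move=> f0; exact: Rintegral_ge0. Qed.

Lemma Rint_norm f : Ig setT f -> `|Rint f| <= Rint (fun x => `|f x|).
Proof. exact: le_normr_Rintegral. Qed.

Lemma ae_imp (P Q : R -> Prop) : (forall x, P x -> Q x) ->
  {ae mu, forall x, P x} -> {ae mu, forall x, Q x}.
Proof.
by move=> PQ; apply: filterS => //; exact: (ae_filter_ringOfSetsType mu).
Qed.

(** Measurability of [g] is assumed because measurable sets are Borel: a function equal a.e. to a
    measurable one may fail to be measurable. *)
Lemma Ig_ae f g : measurable_fun setT g -> {ae mu, forall x, f x = g x} ->
  Ig setT f -> Ig setT g.
Proof.
move=> mg fg If; have mf := Ig_meas If; have /integrableP[_ foo] := If.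
apply/integrableP; split; first exact/measurable_EFinP.
have mnf : measurable_fun setT (EFin \o (fun x => `|f x|)).
  by apply/measurable_EFinP; exact: measurableT_comp.
have mng : measurable_fun setT (EFin \o (fun x => `|g x|)).
  by apply/measurable_EFinP; exact: measurableT_comp.
suff <- : (\int[mu]_x `|(f x)%:E| = \int[mu]_x `|(g x)%:E|)%E by [].
apply: (@ae_eq_integral _ _ _ mu setT _ _ measurableT mnf mng).
by apply: ae_imp fg => x + _ /= => ->.
Qed.

Lemma Rint_ae f g : measurable_fun setT f -> measurable_fun setT g ->
  {ae mu, forall x, f x = g x} -> Rint f = Rint g.
Proof.
move=> /measurable_EFinP mf /measurable_EFinP mg fg.
rewrite /Rint /Rintegral; congr fine.
apply: (@ae_eq_integral _ _ _ mu setT _ _ measurableT mf mg).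
by apply: ae_imp fg => x + _ /= => ->.
Qed.

Lemma L2P f : f \in Lfun mu 2%:E <-> L2 f.
Proof.
split=> [Lf|[mf If]].
  split; last exact: Lfun2_integrable_sqr.
  by move: Lf; rewrite inE => /andP[]; rewrite inE.
rewrite inE; apply/andP; split; first by rewrite inE.
rewrite inE /finite_norm unlock /= ?gt_eqF//.
apply: poweR_lty.
have /integrableP[_] := If; apply: le_lt_trans.
rewrite le_eqVlt; apply/orP; left; apply/eqP; apply: eq_integral => x _ /=.
by rewrite powR_mulrn// normrX.
Qed.

Lemma L2M f g : L2 f -> L2 g -> Ig setT (fun x => f x * g x).
Proof.
move=> [mf If] [mg Ig']; apply: (@Ig_le _ _ (fun x => f x ^+ 2 + g x ^+ 2)) => //.
- exact: measurable_funM.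
- move=> x _; rewrite ler_norml; apply/andP; split; nra.
- exact: IgD.
Qed.

Lemma L2D f g : L2 f -> L2 g -> L2 (fun x => f x + g x).
Proof.
move=> Lf Lg; have [mf If] := Lf; have [mg Ig'] := Lg; split.
  exact: measurable_funD.
rewrite (_ : (fun _ => _) = fun x => (f x ^+ 2 + g x ^+ 2) + 2 * (f x * g x)).
  by apply: IgD => //; [exact: IgD|apply: IgZ => //; exact: L2M].
by apply/funext => x; ring.
Qed.

Lemma L2Z c f : L2 f -> L2 (fun x => c * f x).
Proof.
move=> [mf If]; split; first exact: measurable_funM.
rewrite (_ : (fun _ => _) = fun x => c ^+ 2 * f x ^+ 2); first exact: IgZ.
by apply/funext => x; ring.
Qed.

Lemma L2B f g : L2 f -> L2 g -> L2 (fun x => f x - g x).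
Proof.
move=> Lf Lg; rewrite (_ : (fun _ => _) = fun x => f x + (-1) * g x).
  by apply: L2D => //; exact: L2Z.
by apply/funext => x; ring.
Qed.

Lemma L2_le f g : measurable_fun setT f -> (forall x, `|f x| <= `|g x|) ->
  L2 g -> L2 f.
Proof.
move=> mf fg [mg Ig']; split => //; apply: Ig_le Ig' => //.
  exact: measurable_funX.
move=> x _; rewrite normrX -(real_normK (num_real (g x))).
by rewrite lerXn2r// nnegrE.
Qed.

Lemma L2_ae f g : measurable_fun setT g -> {ae mu, forall x, f x = g x} ->
  L2 f -> L2 g.
Proof.
move=> mg fg [mf If]; split => //; apply: Ig_ae If.
  exact: measurable_funX.
by apply: ae_imp fg => x ->.
Qed.

(** The integral of (f - t g)^2 is a quadratic polynomial in t without negative values; t = C / B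
    gives the inequality when B > 0. *)
Lemma L2_cauchy_schwarz f g : L2 f -> L2 g ->
  Rint (fun x => f x * g x) ^+ 2
    <= Rint (fun x => f x ^+ 2) * Rint (fun x => g x ^+ 2).
Proof.
move=> Lf Lg.
set A := Rint (fun x => f x ^+ 2); set B := Rint (fun x => g x ^+ 2).
set C := Rint _.
have H t : 0 <= A - 2 * t * C + t ^+ 2 * B.
  rewrite /A /B /C -RintZ; last exact: L2M.
  rewrite -RintB; [|exact: Lf.2|by apply: IgZ => //; exact: L2M].
  rewrite -RintZ; last exact: Lg.2.
  rewrite -RintD; last 2 first.
    - by apply: IgB; [|exact: Lf.2|apply: IgZ => //; exact: L2M].
    - by apply: IgZ => //; exact: Lg.2.
  apply: Rint_ge0 => x.
  by rewrite (_ : _ + _ = (f x - t * g x) ^+ 2) ?sqr_ge0//; ring.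
have B0 : 0 <= B by apply: Rint_ge0 => x; exact: sqr_ge0.
have A0 : 0 <= A by apply: Rint_ge0 => x; exact: sqr_ge0.
have [B00|BN0] := eqVneq B 0.
  have [->|CN0] := eqVneq C 0; first by rewrite expr0n/= mulr_ge0.
  (* For B = 0 the polynomial is affine; at this t it equals - A - 2 < 0. *)
  have := H ((A + 1) / C); rewrite B00 mulr0 addr0.
  rewrite -mulrA divfK//; lra.
have := H (C / B).
have Bp : 0 < B by rewrite lt_def BN0.
rewrite (_ : _ + _ = (A * B - C ^+ 2) / B); last by field.
by rewrite pmulr_lge0 ?invr_gt0// subr_ge0.
Qed.

(** Lebesgue measure is determined by its values on half-open intervals, whose preimages under
    translation are intervals of the same length. *)
Lemma lebesgue_measure_shift (h : R) A : measurable A ->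
  pushforward mu ((fun x => x + h) : _ -> measurableTypeR R) A = mu A.
Proof.
move=> mA; apply/esym/lebesgue_measure_unique => //=.
  exact: measurable_funD.
move=> _ _ [[a b]] _ <-.
rewrite /pushforward /=.
rewrite (_ : _ @^-1` _ = `](a - h), (b - h)]%classic); last first.
  by apply/seteqP; split => x /=; rewrite !in_itv/= ltrBlDr lerBrDr.
rewrite !lebesgue_measure_itv/= !lte_fin ltrD2r.
by case: ifP => // _; rewrite !EFinB; congr (_%:E); ring.
Qed.

Lemma measurable_shift (h : R) : measurable_fun (setT : set R) ((fun x => x + h) : R -> R).
Proof. exact: measurable_funD. Qed.

Lemma measurable_funShift (h : R) f : measurable_fun setT f ->
  measurable_fun (setT : set R) (fun x => f (x + h)).
Proof. by move=> mf; exact: (measurableT_comp mf (measurable_shift h)). Qed.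

Lemma integral_shift_ge0 (h : R) f : measurable_fun setT f ->
  (forall x, 0 <= f x) ->
  (\int[mu]_x (f (x + h))%:E = \int[mu]_x (f x)%:E)%E.
Proof.
move=> mf f0.
pose sh : measurableTypeR R -> measurableTypeR R := fun x => (x + h)%R.
have ms : measurable_fun setT sh by exact: measurable_shift.
transitivity (\int[pushforward mu sh]_x (f x)%:E)%E.
  rewrite (ge0_integral_pushforward ms)//=.
  - exact/measurable_EFinP.
  - by move=> y _; rewrite lee_fin.
by apply: eq_measure_integral => // A mA _; exact: lebesgue_measure_shift.
Qed.

Lemma Ig_shift (h : R) f : Ig setT f -> Ig setT (fun x => f (x + h)).
Proof.
move=> If; have mf := Ig_meas If; have /integrableP[_ foo] := If.
apply/integrableP; split.
  by apply/measurable_EFinP; exact: measurable_funShift.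
move: foo => /=; rewrite -(@integral_shift_ge0 h (fun x => `|f x|))//.
exact: measurableT_comp.
Qed.

Lemma Rint_shift (h : R) f : Ig setT f -> Rint (fun x => f (x + h)) = Rint f.
Proof.
move=> If; have mf := Ig_meas If.
have If' := Ig_abs measurableT If.
(* Both terms of this difference are nonnegative, so that [integral_shift_ge0] applies to each. *)
have E : f = fun x => (f x + `|f x|) - `|f x|.
  by apply/funext => x; rewrite addrK.
have I1 : Ig setT (fun x => f x + `|f x|) by apply: IgD.
rewrite [in RHS]E [in LHS]E RintB//; last 2 first.
- exact: (Ig_shift h I1).
- exact: (Ig_shift h If').
rewrite RintB//; congr (_ - _); rewrite /Rint /Rintegral; congr fine.
- rewrite (@integral_shift_ge0 h (fun x => f x + `|f x|))//.
  + exact: Ig_meas I1.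
  + by move=> x; have := ler_norm (- f x); rewrite normrN; lra.
- rewrite (@integral_shift_ge0 h (fun x => `|f x|))//.
  exact: measurableT_comp.
Qed.

Lemma L2_shift (h : R) f : L2 f -> L2 (fun x => f (x + h)).
Proof.
move=> [mf If]; split; first exact: measurable_funShift.
exact: (Ig_shift h If).
Qed.

End real_integrals.

(** * Absolutely continuous functions, gluing, sup bounds and tent functions *)

Section absolutely_continuous.
Variable R : realType.
Local Notation mu := (@lebesgue_measure R).
Implicit Types (f g F G p q : R -> R) (a b c r x y z : R).

Lemma Ig_itv_cst x y c : Ig `[x, y]%classic (cst c : R -> R).
Proof.
apply: measurable_bounded_integrable => //.
  by rewrite /= lebesgue_measure_itv/=; case: ifP => _; rewrite ?ltry.
by exists `|c|; split => // M cM z _ /=; exact: ltW.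
Qed.

(** On a bounded interval, |p| <= 1 + p^2 is enough. *)
Lemma L2_Ig_itv x y p : L2 p -> Ig `[x, y]%classic p.
Proof.
move=> [mp Ip]; apply: (@Ig_le _ _ _ (fun t => 1 + p t ^+ 2)) => //.
- exact: measurable_funTS.
- move=> t _; rewrite ler_norml; apply/andP; split; nra.
- apply: IgD => //; [exact: Ig_itv_cst|exact: IgT].
Qed.

Lemma int_Chasles x y z p : x <= y -> y <= z -> Ig `[x, z]%classic p ->
  \int[mu]_(t in `[x, z]) p t
  = \int[mu]_(t in `[x, y]) p t + \int[mu]_(t in `[y, z]) p t.
Proof.
move=> xy yz Ip.
have := @Rintegral_itvB _ p (BLeft x) (BRight z) y Ip.
rewrite !bnd_simp => /(_ xy yz).
rewrite Rintegral_itv_obnd_cbnd; first by move=> <-; rewrite addrC subrK.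
apply: IgS Ip => // t /=; rewrite !in_itv/= => /andP[yt ->].
by rewrite andbT (le_trans xy)// ltW.
Qed.

Lemma int_itvxx x p : \int[mu]_(t in `[x, x]) p t = 0.
Proof. by rewrite set_itv1 Rintegral_set1. Qed.

Lemma int_itv_cst x y c : x <= y -> \int[mu]_(_ in `[x, y]) c = c * (y - x).
Proof.
move=> xy; rewrite Rintegral_cst//= lebesgue_measure_itv/= lte_fin.
move: xy; rewrite le_eqVlt => /predU1P[->|xy]; first by rewrite ltxx subrr.
by rewrite xy.
Qed.

Lemma mulr_indic f (A : set R) x : f x * \1_A x = (f \_ A) x.
Proof.
by rewrite indicE patchE; case: (x \in A); rewrite ?mulr1 ?mulr0.
Qed.

Lemma Rint_indic f (A : set R) :
  Rint (fun x => f x * \1_A x) = \int[mu]_(x in A) f x.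
Proof.
by rewrite Rintegral_mkcond; apply: eq_Rint => x; exact: mulr_indic.
Qed.

Lemma Ig_indicP f (A : set R) : measurable A ->
  Ig A f <-> Ig setT (fun x => f x * \1_A x).
Proof.
move=> mA; rewrite (_ : (fun _ => _) = f \_ A).
  by have := @integrable_mkcond _ _ _ mu A (EFin \o f) mA; rewrite restrict_EFin.
by apply/funext => x; exact: mulr_indic.
Qed.

Lemma Ig_indic f (A : set R) : measurable A -> Ig A f ->
  Ig setT (fun x => f x * \1_A x).
Proof. by move=> mA /(Ig_indicP f mA). Qed.

Lemma L2_indic f (A : set R) : measurable A -> L2 f ->
  L2 (fun x => f x * \1_A x).
Proof.
move=> mA Lf; apply: L2_le (Lf).
  by apply: measurable_funM; [exact: Lf.1|exact: measurable_indic].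
move=> x; rewrite normrM indicE; case: (x \in A); rewrite ?normr1 ?mulr1//.
by rewrite normr0 mulr0.
Qed.

Lemma L2_indic_itv x y : L2 (fun t : R => \1_(`[x, y]%classic) t : R).
Proof.
split; first exact: measurable_indic.
have := @Ig_indic (cst 1) `[x, y]%classic (measurable_itv _) (Ig_itv_cst _ _ _).
congr (Ig _ _); apply/funext => t; rewrite mul1r indicE.
by case: (t \in _); rewrite ?expr1n ?expr0n.
Qed.

Lemma cauchy_schwarz_itv x y p : x <= y -> L2 p ->
  (\int[mu]_(t in `[x, y]) p t) ^+ 2
    <= (y - x) * \int[mu]_(t in `[x, y]) (p t ^+ 2).
Proof.
move=> xy Lp.
have L1 := L2_indic_itv x y.
have Lp1 := @L2_indic p _ (measurable_itv `[x, y]) Lp.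
have := L2_cauchy_schwarz Lp1 L1.
set I1 := Rint _; set I2 := Rint _; set I3 := Rint _.
have -> : I1 = \int[mu]_(t in `[x, y]) p t.
  rewrite -Rint_indic; apply: eq_Rint => t; rewrite -mulrA.
  by rewrite indicE; case: (t \in _); rewrite ?mulr1 ?mulr0.
have -> : I2 = \int[mu]_(t in `[x, y]) (p t ^+ 2).
  rewrite -Rint_indic; apply: eq_Rint => t; rewrite exprMn.
  by rewrite indicE; case: (t \in _); rewrite ?expr1n ?expr0n.
have -> : I3 = y - x.
  rewrite -[RHS]mul1r -(int_itv_cst 1 xy) -Rint_indic; apply: eq_Rint => t.
  by rewrite mul1r indicE; case: (t \in _); rewrite ?expr1n ?expr0n.
by rewrite mulrC.
Qed.

Lemma le_int_itv x y f : Ig setT f -> (forall t, 0 <= f t) ->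
  \int[mu]_(t in `[x, y]) f t <= Rint f.
Proof.
move=> If f0; rewrite -Rint_indic; apply: le_Rint => //.
  by apply: Ig_indic => //; exact: IgT.
by move=> t; rewrite indicE; case: (t \in _); rewrite ?mulr1 ?mulr0.
Qed.

(** Local integrability tested on segments only; [locally_integrableP] shows that this is the usual
    notion. *)
Definition loc1 p : Prop :=
  measurable_fun setT p /\ forall x y, Ig `[x, y]%classic p.

(** Absolute continuity is encoded by the integral identity rather than by a.e. differentiability:
    the identity passes to sums, translates, gluings and L^2 limits without any statement about
    individual points. *)
Definition AC F p : Prop :=
  loc1 p /\ forall x y, x <= y -> F y - F x = \int[mu]_(t in `[x, y]) p t.

Definition h1 F p : Prop := [/\ L2 F, L2 p & AC F p].

Lemma L2_loc1 p : L2 p -> loc1 p.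
Proof. by move=> Lp; split; [exact: Lp.1|move=> x y; exact: L2_Ig_itv]. Qed.

Lemma AC_D F p G q : AC F p -> AC G q ->
  AC (fun x => F x + G x) (fun x => p x + q x).
Proof.
move=> [[mp lp] Fp] [[mq lq] Gq]; split; first split.
- exact: measurable_funD.
- by move=> x y; exact: IgD.
- move=> x y xy; rewrite RintegralD//; last 2 first.
    exact: lp. exact: lq.
  by rewrite -Fp// -Gq//; ring.
Qed.

Lemma AC_Z c F p : AC F p -> AC (fun x => c * F x) (fun x => c * p x).
Proof.
move=> [[mp lp] Fp]; split; first split.
- exact: measurable_funM.
- by move=> x y; exact: IgZ.
- move=> x y xy; rewrite RintegralZl//; last exact: lp.
  by rewrite -Fp//; ring.
Qed.

Lemma AC_affine c d : AC (fun x => c * x + d) (cst c).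
Proof.
split; first split.
- exact: measurable_cst.
- by move=> x y; exact: Ig_itv_cst.
- by move=> x y xy; rewrite int_itv_cst//; ring.
Qed.

(** Across the junction the two increments add up because [F r = G r]. This is the step that keeps
    cut and reglued functions in H^1. *)
Lemma AC_glue r F p G q : AC F p -> AC G q -> F r = G r ->
  AC (fun x => if x <= r then F x else G x)
     (fun x => if x <= r then p x else q x).
Proof.
move=> [[mp lp] Fp] [[mq lq] Gq] FGr.
set s := fun x => if x <= r then p x else q x.
have ms : measurable_fun setT s.
  apply: measurable_fun_ifT => //.
  exact: measurable_fun_ler.
have ls x y : Ig `[x, y]%classic s.
  apply: (@Ig_le _ _ _ (fun t => `|p t| + `|q t|)) => //.
  - exact: measurable_funTS.
  - by move=> t _; rewrite /s; case: ifP => _; rewrite ?lerDl ?lerDr.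
  - by apply: IgD => //; exact: Ig_abs.
have sl x y : x <= y -> y <= r -> F y - F x = \int[mu]_(t in `[x, y]) s t.
  move=> xy yr; rewrite Fp//; apply: eq_Rintegral => t.
  by rewrite inE/= in_itv/= /s => /andP[_ ty]; rewrite (le_trans ty yr).
have sr x y : x <= y -> r <= x -> G y - G x = \int[mu]_(t in `[x, y]) s t.
  move=> xy rx; rewrite Gq//.
  (* At t = r the glued derivative takes the left branch, so the comparison with [q] is made on ]x,
     y], which has the same integral. *)
  have Io : Ig `]x, y]%classic s by apply: IgS (ls x y) => //; exact: subset_itv_oc_cc.
  have Ioq : Ig `]x, y]%classic q by apply: IgS (lq x y) => //; exact: subset_itv_oc_cc.
  rewrite -Rintegral_itv_obnd_cbnd// -[RHS]Rintegral_itv_obnd_cbnd//.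
  apply: eq_Rintegral => t.
  rewrite inE/= in_itv/= /s => /andP[xt _].
  by rewrite leNgt (le_lt_trans rx xt).
split; first by split.
move=> x y xy; have [yr|ry] := leP y r.
  by rewrite (le_trans xy yr) sl.
have [xr|rx] := leP x r.
  by rewrite (int_Chasles xr (ltW ry))// -sl// -sr// ?(ltW ry)// FGr; ring.
by rewrite sr// ltW.
Qed.

Lemma AC_shift c F p : AC F p -> AC (fun x => F (x + c)) (fun x => p (x + c)).
Proof.
move=> [[mp lp] Fp].
have E x y t : p (t + c) * \1_(`[x, y]%classic) t
    = (fun u => p u * \1_(`[x + c, y + c]%classic) u) (t + c).
  rewrite /= !indicE; congr (_ * (nat_of_bool _)%:R).
  by apply/idP/idP; rewrite !inE/= !in_itv/= !lerD2r.
have I2 x y : Ig setT (fun u => p u * \1_(`[x + c, y + c]%classic) u).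
  by apply: Ig_indic.
have I1 x y : Ig setT (fun t => p (t + c) * \1_(`[x, y]%classic) t).
  rewrite (_ : (fun _ => _) = fun t => (fun u => p u * \1_(`[x + c, y + c]%classic) u) (t + c)).
    exact: (Ig_shift c (I2 x y)).
  by apply/funext => t; exact: E.
split; first split.
- exact: measurable_funShift.
- by move=> x y; apply/Ig_indicP => //; exact: I1.
- move=> x y xy; rewrite Fp ?lerD2r// -!Rint_indic.
  by rewrite (eq_Rint (E x y)) (Rint_shift c (I2 x y)).
Qed.

Lemma h1D F p G q : h1 F p -> h1 G q ->
  h1 (fun x => F x + G x) (fun x => p x + q x).
Proof. by move=> [? ? ?] [? ? ?]; split; [exact: L2D|exact: L2D|exact: AC_D]. Qed.

Lemma h1Z c F p : h1 F p -> h1 (fun x => c * F x) (fun x => c * p x).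
Proof. by move=> [? ? ?]; split; [exact: L2Z|exact: L2Z|exact: AC_Z]. Qed.

Lemma h1B F p G q : h1 F p -> h1 G q ->
  h1 (fun x => F x - G x) (fun x => p x - q x).
Proof.
move=> hF hG; have := h1D hF (h1Z (-1) hG).
by congr h1; apply/funext => x; rewrite mulN1r.
Qed.

Lemma h1_shift c F p : h1 F p -> h1 (fun x => F (x + c)) (fun x => p (x + c)).
Proof.
by move=> [? ? ?]; split; [exact: L2_shift|exact: L2_shift|exact: AC_shift].
Qed.

Lemma AC_holder F p x y : L2 p -> AC F p -> x <= y ->
  (F y - F x) ^+ 2 <= (y - x) * \int[mu]_(t in `[x, y]) (p t ^+ 2).
Proof. by move=> Lp [_ Fp] xy; rewrite Fp//; exact: cauchy_schwarz_itv. Qed.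

Lemma AC_holder_global F p x y : L2 p -> AC F p ->
  (F y - F x) ^+ 2 <= `|y - x| * Rint (fun t => p t ^+ 2).
Proof.
move=> Lp AF; wlog xy : x y / x <= y.
  move=> H; have [xy|/ltW yx] := leP x y; first exact: H.
  by rewrite distrC -sqrrN opprB; exact: H.
rewrite ger0_norm ?subr_ge0//; apply: (le_trans (AC_holder Lp AF xy)).
rewrite ler_wpM2l ?subr_ge0//; apply: le_int_itv; first exact: Lp.2.
by move=> t; exact: sqr_ge0.
Qed.

Lemma continuous_eps_delta F :
  (forall x e, 0 < e -> exists2 d : R, 0 < d &
     forall y, `|x - y| < d -> `|F x - F y| < e) -> continuous F.
Proof.
move=> H x; apply/cvgrPdist_lt => e e0; have [d d0 Hd] := H x e e0.
by exists d => // y; exact: Hd.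
Qed.

Lemma AC_continuous F p : L2 p -> AC F p -> continuous F.
Proof.
move=> Lp AF; apply: continuous_eps_delta => x e e0.
set P := Rint (fun t => p t ^+ 2).
have P0 : 0 <= P by apply: Rint_ge0 => t; exact: sqr_ge0.
(* From (F y - F x)^2 <= |y - x| P; the added 1 covers P = 0. *)
exists (e ^+ 2 / (P + 1)); first by rewrite divr_gt0 ?exprn_gt0// ltr_wpDl.
move=> y; rewrite ltr_pdivlMr ?ltr_wpDl// => H.
have H' := AC_holder_global y x Lp AF.
rewrite -(ltr_pXn2r (_ : 0 < 2)%N)// ?nnegrE ?(ltW e0)//.
rewrite real_normK ?num_real//; apply: le_lt_trans H' _; rewrite -/P.
by apply: le_lt_trans H; rewrite ler_wpM2l// lerDl.
Qed.

Lemma h1_continuous F p : h1 F p -> continuous F.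
Proof. by move=> [_ Lp AF]; exact: AC_continuous AF. Qed.

Definition primitive p x : R :=
  if 0 <= x then \int[mu]_(t in `[0, x]) p t else - \int[mu]_(t in `[x, 0]) p t.

Lemma AC_primitive p : loc1 p -> AC (primitive p) p.
Proof.
move=> lp; split => // x y xy; rewrite /primitive.
have [x0|x0] := leP 0 x; have [y0|y0] := leP 0 y.
- by rewrite (int_Chasles x0 xy); [ring|exact: lp.2].
- by have := le_lt_trans xy y0; rewrite ltNge x0.
- by rewrite (@int_Chasles x 0 y) ?(ltW x0)//; [ring|exact: lp.2].
- by rewrite (int_Chasles xy (ltW y0)); [ring|exact: lp.2].
Qed.

(* Averaging [F x ^+ 2 <= 2 (F y ^+ 2 + (F x - F y) ^+ 2)] over [y] in
   [x, x + 1]. *)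
Lemma h1_sup_local F p x : h1 F p ->
  F x ^+ 2 <= 2 * (\int[mu]_(t in `[x, x + 1]) (F t ^+ 2)
                   + \int[mu]_(t in `[x, x + 1]) (p t ^+ 2)).
Proof.
move=> hF; have [LF Lp AF] := hF.
set B := \int[mu]_(t in _) (p t ^+ 2).
have x1 : x <= x + 1 by rewrite lerDl.
have B0 : 0 <= B by apply: Rintegral_ge0 => t _; exact: sqr_ge0.
have I0 : Ig `[x, x + 1]%classic (fun t => F t ^+ 2) by apply: IgT => //; exact: LF.2.
have I1 : Ig `[x, x + 1]%classic (fun t => 2 * F t ^+ 2) by exact: IgZ.
have -> : F x ^+ 2 = \int[mu]_(t in `[x, x + 1]) (F x ^+ 2).
  by rewrite int_itv_cst//; ring.
apply: (@le_trans _ _ (\int[mu]_(t in `[x, x + 1]) (2 * F t ^+ 2 + 2 * B))).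
  apply: le_Rintegral => //.
  - exact: Ig_itv_cst.
  - by apply: IgD => //; exact: Ig_itv_cst.
  - move=> t /=; rewrite in_itv/= => /andP[xt tx1].
    have H : (F t - F x) ^+ 2 <= B.
      apply: (le_trans (AC_holder Lp AF xt)).
      apply: (@le_trans _ _ (\int[mu]_(t in `[x, t]) (p t ^+ 2))).
        rewrite ler_piMl//; first by apply: Rintegral_ge0 => s _; exact: sqr_ge0.
        lra.
      rewrite /B (@int_Chasles x t (x + 1))//.
        by rewrite lerDl; apply: Rintegral_ge0 => s _; exact: sqr_ge0.
      by apply: IgT => //; exact: Lp.2.
    (* The identity behind it is 2 u^2 + 2 (u - v)^2 - v^2 = (2 u - v)^2. *)
    move: H (sqr_ge0 (F t + (F t - F x))); move: (F t) (F x) => u v; nra.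
rewrite RintegralD//; last exact: Ig_itv_cst.
by rewrite RintegralZl// int_itv_cst//; nra.
Qed.

Lemma h1_sup F p x : h1 F p ->
  F x ^+ 2 <= 2 * (Rint (fun t => F t ^+ 2) + Rint (fun t => p t ^+ 2)).
Proof.
move=> hF; have [LF Lp _] := hF.
apply: (le_trans (h1_sup_local x hF)); rewrite ler_wpM2l// lerD//;
  apply: le_int_itv; (try by move=> t; exact: sqr_ge0).
- exact: LF.2.
- exact: Lp.2.
Qed.

Definition swap a b F G : R -> R :=
  fun x => if x <= a then G x else if x <= b then F x else G x.

Lemma h1_swap a b F p G q : a < b -> h1 F p -> h1 G q ->
  F a = G a -> F b = G b -> h1 (swap a b F G) (swap a b p q).
Proof.
move=> ab [LF Lp AF] [LG Lq AG] Fa Fb.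
have mswap (f g : R -> R) : measurable_fun setT f -> measurable_fun setT g ->
    measurable_fun setT (swap a b f g).
  move=> mf mg; apply: measurable_fun_ifT => //; first exact: measurable_fun_ler.
  by apply: measurable_fun_ifT => //; exact: measurable_fun_ler.
have Lswap (f g : R -> R) : L2 f -> L2 g -> L2 (swap a b f g).
  move=> Lf Lg; have [mf If] := Lf; have [mg Ig'] := Lg.
  split; first exact: mswap.
  apply: (@Ig_le _ _ _ (fun x => f x ^+ 2 + g x ^+ 2)) => //.
  - by apply: measurable_funX; exact: mswap.
  - move=> x _; rewrite ger0_norm ?sqr_ge0// /swap.
    by case: ifP => _; [|case: ifP => _]; rewrite ?lerDl ?lerDr sqr_ge0.
  - exact: IgD.
split; [exact: Lswap|exact: Lswap|].
apply: AC_glue => //; first exact: AC_glue.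
by rewrite ltW.
Qed.

(** The hat function of height 1 and half-width 1 centred at [r]. Two of them with centres at
    distance at least 1 interpolate arbitrary values at the centres. *)
Definition tent r x : R := if x <= r - 1 then 0 else
  if x <= r then x - (r - 1) else if x <= r + 1 then r + 1 - x else 0.
Definition dtent r x : R := if x <= r - 1 then 0 else
  if x <= r then 1 else if x <= r + 1 then -1 else 0.

Lemma AC_tent r : AC (tent r) (dtent r).
Proof.
have A0 : AC (fun=> 0) (cst 0).
  by have := AC_affine 0 0; congr AC; apply/funext => x /=; ring.
have A1 : AC (fun x => x - (r - 1)) (cst 1).
  by have := AC_affine 1 (- (r - 1)); congr AC; apply/funext => x /=; ring.
have A2 : AC (fun x => r + 1 - x) (cst (-1)).
  by have := AC_affine (-1) (r + 1); congr AC; apply/funext => x /=; ring.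
apply: AC_glue => //; last first.
  by rewrite (_ : r - 1 <= r) ?subrr//; lra.
apply: AC_glue => //; last first.
  by rewrite (_ : r <= r + 1); [ring|lra].
by apply: AC_glue => //; ring.
Qed.

Lemma tent_bound r x : 0 <= tent r x <= \1_(`[r - 1, r + 1]%classic) x.
Proof.
rewrite indicE /tent; have [/=|H1] := leP x (r - 1); first by rewrite lexx ler0n.
have [H2|H2] := leP x r.
  by rewrite mem_set /= ?in_itv/=; [lra|apply/andP; lra].
have [H3|H3] := leP x (r + 1); last by rewrite lexx ler0n.
by rewrite mem_set /= ?in_itv/=; [lra|apply/andP; lra].
Qed.

Lemma dtent_bound r x : `|dtent r x| <= \1_(`[r - 1, r + 1]%classic) x.
Proof.
rewrite indicE /dtent; have [/=|H1] := leP x (r - 1); first by rewrite normr0 ler0n.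
have [H2|H2] := leP x r.
  by rewrite mem_set /= ?in_itv/= ?normr1//; apply/andP; lra.
have [H3|H3] := leP x (r + 1); last by rewrite normr0 ler0n.
by rewrite mem_set /= ?in_itv/= ?normrN ?normr1//; apply/andP; lra.
Qed.

Lemma h1_tent r : h1 (tent r) (dtent r).
Proof.
have [[mp _] _] := AC_tent r.
have L1 := L2_indic_itv (r - 1) (r + 1).
have mt : measurable_fun setT (tent r).
  apply: measurable_fun_ifT => //; first exact: measurable_fun_ler.
  apply: measurable_fun_ifT => //; first exact: measurable_fun_ler.
    exact: measurable_funB.
  apply: measurable_fun_ifT => //; first exact: measurable_fun_ler.
  exact: measurable_funB.
split; last exact: AC_tent.
- apply: L2_le L1 => // x; have /andP[t0 t1] := tent_bound r x.
  by rewrite !ger0_norm// (le_trans t0).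
- apply: L2_le L1 => // x; rewrite (le_trans (dtent_bound r x))//.
  exact: ler_norm.
Qed.

Lemma Rint_indic2 r : Rint (fun x => (\1_(`[r - 1, r + 1]%classic) x : R) ^+ 2) = 2.
Proof.
transitivity (\int[mu]_(x in `[r - 1, r + 1]) (1 : R)).
  rewrite -Rint_indic; apply: eq_Rint => x; rewrite mul1r indicE.
  by case: (_ \in _); rewrite ?expr1n ?expr0n.
by rewrite int_itv_cst; [ring|lra].
Qed.

Lemma Rint_tent2 r : Rint (fun x => tent r x ^+ 2) <= 2.
Proof.
rewrite -(Rint_indic2 r); apply: le_Rint.
- by case: (h1_tent r) => -[].
- exact: (L2_indic_itv _ _).2.
- move=> x; have /andP[t0 t1] := tent_bound r x.
  by rewrite lerXn2r// nnegrE (le_trans t0).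
Qed.

Lemma Rint_dtent2 r : Rint (fun x => dtent r x ^+ 2) <= 2.
Proof.
rewrite -(Rint_indic2 r); apply: le_Rint.
- by case: (h1_tent r) => _ [].
- exact: (L2_indic_itv _ _).2.
- move=> x; have H := dtent_bound r x.
  rewrite -(real_normK (num_real (dtent r x))).
  by rewrite lerXn2r// nnegrE (le_trans _ H).
Qed.

Lemma tent_center r : tent r r = 1.
Proof. by rewrite /tent (_ : (r <= r - 1) = false) ?lexx; [ring|apply/negbTE; rewrite -ltNge; lra]. Qed.

Lemma tent_far r x : 1 <= `|x - r| -> tent r x = 0.
Proof.
rewrite ler_normr /tent => H.
have [//|H1] := leP x (r - 1).
have [H2|H2] := leP x r; first by move/orP: H => [] ?; lra.
by have [H3|H3] := leP x (r + 1) => //; move/orP: H => [] ?; lra.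
Qed.

End absolutely_continuous.

(** * Classical derivatives and the fundamental theorem of calculus *)

Section derivatives.
Variable R : realType.
Local Notation mu := (@lebesgue_measure R).
Implicit Types (f g : R -> R) (a b c x y z l m e : R) (n : nat).

Definition dv f x l := is_derive x 1 f l.

(** The epsilon-delta form serves where no rule of differentiation applies: locality, flatness at 0,
    and the minimum principle [dv_min0]. *)
Lemma dvP f x l : dv f x l <->
  forall e, 0 < e -> exists2 d : R, 0 < d & forall h : R, h != 0 -> `|h| < d ->
    `|h^-1 * (f (x + h) - f x) - l| < e.
Proof.
have E : (fun h : R => h^-1 *: (f (h *: 1 + x) - f x))
       = fun h => h^-1 * (f (x + h) - f x).
  by apply/funext => h; rewrite /= [h%:A]mulr1 [h + x]addrC.
split.
- case=> df <-; move: df => /cvg_ex[m]; rewrite /= E => Hm.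
  have -> : 'D_1 f x = m by apply/cvg_lim => //; rewrite E.
  move=> e e0; move/cvgrPdist_lt : Hm => /(_ e e0)[d d0 Hd].
  exists d => // h h0 hd; rewrite distrC; apply: Hd => //=.
  by rewrite sub0r normrN.
- move=> H; have Hc : h^-1 * (f (x + h) - f x) @[h --> 0^'] --> l.
    apply/cvgrPdist_lt => e e0; have [d d0 Hd] := H e e0.
    exists d => // h /=; rewrite sub0r normrN => hd h0.
    by rewrite distrC; exact: Hd.
  apply: DeriveDef.
    by apply/cvg_ex; exists l; rewrite /= E.
  by apply/cvg_lim => //; rewrite E.
Qed.

Lemma dv_near f g x l d : 0 < d -> (forall y, `|y - x| < d -> f y = g y) ->
  dv f x l -> dv g x l.
Proof.
move=> d0 fg /dvP H; apply/dvP => e e0; have [d' d'0 Hd] := H e e0.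
exists (Num.min d d') => [|h h0]; first by rewrite lt_min d0.
rewrite lt_min => /andP[hd hd'].
rewrite -fg; last by rewrite (addrC x) addrK.
by rewrite -(fg x) ?subrr ?normr0//; exact: Hd.
Qed.

Lemma dv_eq f x l m : dv f x l -> l = m -> dv f x m.
Proof. by move=> + <-. Qed.

Lemma dv_derive1 f x l : dv f x l -> derive1 f x = l.
Proof. by case=> _ <-; rewrite derive1E. Qed.

Lemma dv_derivable f x l : dv f x l -> derivable f x 1.
Proof. by case. Qed.

Lemma derivable_dv f x : derivable f x 1 -> dv f x (derive1 f x).
Proof. by move=> df; rewrite derive1E; exact: DeriveDef. Qed.

Lemma dv_continuous f x l : dv f x l -> {for x, continuous f}.
Proof.
move=> [df _]; apply: differentiable_continuous; exact/derivable1_diffP.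
Qed.

Lemma dv_cst c x : dv (fun=> c) x 0.
Proof. exact: is_derive_cst. Qed.

Lemma dv_id x : dv (fun y => y) x 1.
Proof. exact: is_derive_id. Qed.

Lemma dvD f g x l m : dv f x l -> dv g x m -> dv (fun y => f y + g y) x (l + m).
Proof. exact: is_deriveD. Qed.

Lemma dvN f x l : dv f x l -> dv (fun y => - f y) x (- l).
Proof. exact: is_deriveN. Qed.

Lemma dvB f g x l m : dv f x l -> dv g x m -> dv (fun y => f y - g y) x (l - m).
Proof. exact: is_deriveB. Qed.

Lemma dvM f g x l m : dv f x l -> dv g x m ->
  dv (fun y => f y * g y) x (l * g x + f x * m).
Proof.
move=> df dg; apply: dv_eq (is_deriveM df dg) _.
by rewrite /GRing.scale/=; ring.
Qed.

Lemma dvZ c f x l : dv f x l -> dv (fun y => c * f y) x (c * l).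
Proof. by move=> df; apply: dv_eq (dvM (dv_cst c x) df) _; rewrite mul0r add0r. Qed.

Lemma dvX2 f x l : dv f x l -> dv (fun y => f y ^+ 2) x (2 * f x * l).
Proof.
move=> df; apply: dv_eq (dvM df df) _; ring.
Qed.

Lemma dv_comp f g x l m : dv f (g x) l -> dv g x m ->
  dv (fun y => f (g y)) x (l * m).
Proof. exact: is_derive1_comp. Qed.

Lemma dv_affine c b x : dv (fun y => c * y + b) x c.
Proof.
by apply: dv_eq (dvD (dvZ c (dv_id x)) (dv_cst b x)) _; rewrite mulr1 addr0.
Qed.

Lemma dv_expR c x : dv (fun y => expR (c * y)) x (c * expR (c * x)).
Proof.
have H : dv (fun y => c * y) x c by apply: dv_eq (dvZ c (dv_id x)) _; rewrite mulr1.
by apply: dv_eq (dv_comp (is_derive_expR (c * x)) H) _; rewrite mulrC.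
Qed.

Lemma dv_inv x : x != 0 -> dv (fun y => y^-1) x (- x ^- 2).
Proof.
move=> x0; have := @is_deriveV R id x 1 1 x0 (is_derive_id _ _).
by move/dv_eq; apply; rewrite [LHS]mulr1.
Qed.

Lemma derive1_funext f g : (forall x, dv f x (g x)) -> derive1 f = g.
Proof. by move=> H; apply/funext => x; exact: dv_derive1. Qed.

Lemma dv_le f g a b : a <= b -> (forall x, a <= x <= b -> dv f x (g x)) ->
  (forall x, a <= x <= b -> 0 <= g x) -> f a <= f b.
Proof.
move=> ab H g0.
have [||z] := @MVT_segment R f g a b ab.
- by move=> x; rewrite in_itv/= => /andP[/ltW ? /ltW ?]; apply: H; apply/andP.
- apply: derivable_within_continuous => x; rewrite in_itv/= => /H; exact: dv_derivable.
- rewrite in_itv/= => zab E; rewrite -subr_ge0 E mulr_ge0 ?subr_ge0//; exact: g0.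
Qed.

(** Smoothness is always obtained this way: the function is placed in a class stable under
    differentiation, so that no iterated derivative is ever computed. *)
Lemma smooth_closed (C : (R -> R) -> Prop) :
  (forall h, C h -> (forall x, derivable h x 1) /\ C (derive1 h)) ->
  forall n h, C h -> C (derive1n n h).
Proof. by move=> HC; elim=> [//|n IH] h Ch; rewrite derive1nS; exact: (HC _ (IH _ Ch)).2. Qed.

Lemma continuous_meas f : continuous f -> measurable_fun setT f.
Proof. exact: continuous_measurable_fun. Qed.

Lemma continuous_Ig f a b : continuous f -> Ig `[a, b]%classic f.
Proof.
move=> cf; apply: continuous_compact_integrable; first exact: segment_compact.
exact: continuous_subspaceT.
Qed.

Lemma continuous_loc1 f : continuous f -> loc1 f.
Proof.
by move=> cf; split; [exact: continuous_meas|move=> x y; exact: continuous_Ig].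
Qed.

(** The hypotheses are local to [a, b] because real powers of x are differentiated only on intervals
    away from 0. *)
Lemma FTC2_itv f g a b : a <= b -> (forall x, a <= x <= b -> dv f x (g x)) ->
  (forall x, a <= x <= b -> {for x, continuous g}) ->
  Ig `[a, b]%classic g /\ \int[mu]_(t in `[a, b]) g t = f b - f a.
Proof.
move=> ab H cg.
have cw : {within `[a, b]%classic, continuous g}.
  by apply: continuous_in_subspaceT => x /set_mem /=; rewrite in_itv/= => /cg.
split; first by apply: continuous_compact_integrable => //; exact: segment_compact.
move: ab H cw {cg}; rewrite le_eqVlt => /predU1P[->|ab] H cw; first by rewrite int_itvxx subrr.
have aab : a <= a <= b by rewrite lexx ltW.
have bab : a <= b <= b by rewrite lexx ltW.
have inab x : x \in `]a, b[ -> a <= x <= b.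
  by rewrite in_itv/= => /andP[/ltW-> /ltW->].
rewrite /Rintegral (@continuous_FTC2 R g f a b)//.
- split.
  + by move=> x /inab xab; exact: dv_derivable (H x xab).
  + by apply: cvg_at_right_filter; exact: dv_continuous (H a aab).
  + by apply: cvg_at_left_filter; exact: dv_continuous (H b bab).
- by move=> x /inab xab; exact: dv_derive1 (H x xab).
Qed.

Lemma FTC2 f g a b : a <= b -> (forall x, dv f x (g x)) -> continuous g ->
  \int[mu]_(t in `[a, b]) g t = f b - f a.
Proof. by move=> ab H cg; exact: (FTC2_itv ab (fun x _ => H x) (fun x _ => cg x)).2. Qed.

Lemma AC_dv f g : (forall x, dv f x (g x)) -> continuous g -> AC f g.
Proof.
move=> H cg; split; first exact: continuous_loc1.
by move=> x y xy; rewrite (FTC2 xy H cg).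
Qed.

Lemma dv_AC f g : AC f g -> continuous g -> forall x, dv f x (g x).
Proof.
move=> [lg Hf] cg x.
have x1 : x < x + 1 by rewrite ltrDl.
have x2 : (BLeft (x - 1)%R < BRight x)%E by rewrite lte_fin; lra.
have [D1 D2] := @continuous_FTC1 R g _ x (x + 1) x1
  (continuous_Ig (x - 1) (x + 1) cg) x2 (cg x).
(* A primitive based at x - 1 has x in the interior of its interval of integration, and it coincides
   with [f] near x. *)
pose F y := f (x - 1) + \int[mu]_(t in `[x - 1, y]) g t.
have : dv F x (g x).
  have := derivable_dv D1; rewrite D2 => D3.
  by apply: dv_eq (dvD (dv_cst (f (x - 1)) x) D3) _; rewrite add0r.
apply: (@dv_near _ _ _ _ 1) => // y; rewrite ltr_norml => /andP[xy _].
by rewrite /F -Hf; [ring|lra].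
Qed.

End derivatives.

(** * Construction of test functions; a locally integrable function is determined by testing *)

Section test_functions.
Variable R : realType.
Local Notation mu := (@lebesgue_measure R).
Implicit Types (f g h p phi : R -> R) (a b c x y z l m e A M : R) (n : nat).

(** For [n = 0] this is the standard flat function e^(-1/x). Differentiating it produces powers of
    1/x, so the whole family is needed for stability. *)
Definition flat n x : R := if 0 < x then x^-1 ^+ n * expR (- x^-1) else 0.

Lemma dvXn f x l n : dv f x l -> dv (fun y => f y ^+ n) x (n%:R * f x ^+ n.-1 * l).
Proof.
move=> df; elim: n => [|n IH].
  by apply: dv_eq (dv_cst 1 x) _; rewrite !mul0r.
under eq_fun do rewrite exprS.
apply: dv_eq (dvM df IH) _; case: n {IH} => [|n].
  by rewrite /= expr0; ring.
by rewrite /= -[in RHS]addn1 natrD exprS; ring.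
Qed.

(** With u = 1/x this is e^u >= u^(n+2) / (n+2)!. A bound quadratic in x makes the derivative at 0
    vanish. *)
Lemma flat_le n x : 0 < x -> flat n x <= (n.+2)`!%:R * x ^+ 2.
Proof.
move=> x0; rewrite /flat x0; set u := x^-1.
have u0 : 0 < u by rewrite invr_gt0.
have -> : x ^+ 2 = u ^- 2 by rewrite /u exprVn invrK.
rewrite expRN ler_pdivrMr ?expR_gt0// mulrAC ler_pdivlMr ?exprn_gt0//.
rewrite -exprD addn2.
have := @expR_ge1Dxn R u n.+1 (ltW u0).
have F0 : 0 < n.+2`!%:R :> R by rewrite ltr0n fact_gt0.
rewrite -(ler_pM2l F0) mulrDr mulr1 mulrCA divff ?gt_eqF// mulr1.
by apply: le_trans; rewrite lerDr ltW.
Qed.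

Lemma flat_ge0 n x : 0 <= flat n x.
Proof.
rewrite /flat; case: ifP => // x0.
by rewrite mulr_ge0 ?exprn_ge0 ?expR_ge0// invr_ge0 ltW.
Qed.

Lemma dv_flat n x : dv (flat n) x (- n%:R * flat n.+1 x + flat n.+2 x).
Proof.
have [x0|x0|<-] := ltgtP 0 x.
- rewrite {2 3}/flat x0.
  have xn0 : x != 0 by rewrite gt_eqF.
  apply: (@dv_near _ (fun y => y^-1 ^+ n * expR (- y^-1)) _ _ _ x) => //.
    by move=> y; rewrite ltr_norml /flat => /andP[Hy _]; rewrite ifT//; lra.
  have d1 := dv_inv xn0.
  have d2 : dv (fun y => expR (- y^-1)) x (expR (- x^-1) * - (- x ^- 2)).
    apply: (@dv_comp _ expR (fun y => - y^-1)); last exact: dvN.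
    exact: is_derive_expR.
  apply: dv_eq (dvM (dvXn n d1) d2) _.
  rewrite -!exprVn; set u := x^-1; set E := expR _.
  case: n => [|n]; first by rewrite !mul0r mulNr !mul0r; ring.
  by rewrite -[n.+1.-1]/n; set N := n.+1%:R; rewrite !exprS; ring.
- have -> : - n%:R * flat n.+1 x + flat n.+2 x = 0.
    by rewrite /flat ltNge (ltW x0)/= mulr0 addr0.
  apply: (@dv_near _ (fun=> 0) _ _ _ (- x)); [lra| |exact: dv_cst].
  by move=> y; rewrite ltr_norml /flat => /andP[_ Hy]; rewrite ifF//; apply/negbTE; rewrite -leNgt; lra.
- have -> : - n%:R * flat n.+1 0 + flat n.+2 0 = 0.
    by rewrite /flat ltxx mulr0 addr0.
  (* By [flat_le] the difference quotient at h > 0 is at most C h, and it is 0 for h < 0; hence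
     delta = e / C. *)
  apply/dvP => e e0; set C : R := (n.+2)`!%:R.
  have C0 : 0 < C by rewrite ltr0n fact_gt0.
  exists (e / C); first by rewrite divr_gt0.
  move=> h h0; rewrite ltr_pdivlMr// => hC.
  rewrite add0r {2}/flat ltxx !subr0.
  have [hp|hn] := ltP 0 h; last first.
    by rewrite /flat (ltNge 0 h) hn/= mulr0 normr0.
  apply: le_lt_trans hC.
  rewrite ger0_norm; last by rewrite mulr_ge0 ?flat_ge0 ?invr_ge0 ?(ltW hp).
  rewrite gtr0_norm//.
  rewrite ler_pdivrMl//; apply: le_trans (flat_le n hp) _.
  by rewrite le_eqVlt; apply/orP; left; apply/eqP; rewrite /C; ring.
Qed.

Lemma flat0_gt0 x : 0 < x -> 0 < flat 0 x.
Proof. by move=> x0; rewrite /flat x0 expr0 mul1r expR_gt0. Qed.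

Lemma flat0_lt1 x : flat 0 x < 1.
Proof.
rewrite /flat; case: ifP => // x0.
by rewrite expr0 mul1r expR_lt1 oppr_lt0 invr_gt0.
Qed.

(** Stable under differentiation, hence made of smooth functions by [smooth_closed]; the affine
    arguments provide flat functions vanishing on either side of any point. *)
Inductive flat_algebra : (R -> R) -> Prop :=
| flat_algebra_flat n a b : flat_algebra (fun x => flat n (a * x + b))
| flat_algebra_cst c : flat_algebra (fun=> c)
| flat_algebraD f g : flat_algebra f -> flat_algebra g ->
    flat_algebra (fun x => f x + g x)
| flat_algebraM f g : flat_algebra f -> flat_algebra g ->
    flat_algebra (fun x => f x * g x).

Lemma flat_algebra_derive f : flat_algebra f ->
  exists2 f', flat_algebra f' & forall x, dv f x (f' x).
Proof.
elim=> [n a b|c|f0 g0 _ [f1 Hf Df] _ [g1 Hg Dg]|f0 g0 Hf0 [f1 Hf Df] Hg0 [g1 Hg Dg]].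
- exists (fun x => a * (- n%:R * flat n.+1 (a * x + b) + flat n.+2 (a * x + b))).
    apply: (flat_algebraM (flat_algebra_cst a)); apply: flat_algebraD.
      by apply: (flat_algebraM (flat_algebra_cst _)); exact: flat_algebra_flat.
    exact: flat_algebra_flat.
  move=> x; rewrite mulrC.
  by apply: (@dv_comp _ (flat n) (fun x => a * x + b)); [exact: dv_flat|exact: dv_affine].
- by exists (fun=> 0); [exact: flat_algebra_cst|move=> x; exact: dv_cst].
- by exists (fun x => f1 x + g1 x); [exact: flat_algebraD|move=> x; exact: dvD].
- exists (fun x => f1 x * g0 x + f0 x * g1 x); last by move=> x; exact: dvM.
  by apply: flat_algebraD; exact: flat_algebraM.
Qed.

Lemma flat_algebra_smooth n f x : flat_algebra f -> derivable (derive1n n f) x 1.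
Proof.
have H : forall h, flat_algebra h ->
    (forall x, derivable h x 1) /\ flat_algebra (derive1 h).
  move=> h /flat_algebra_derive[h' Hh' Dh].
  split; first by move=> y; exact: dv_derivable (Dh y).
  by rewrite (derive1_funext Dh).
by move=> Hf; have [] := H _ (smooth_closed H n Hf).
Qed.

Lemma flat_algebraX f n : flat_algebra f -> flat_algebra (fun x => f x ^+ n).
Proof.
move=> Hf; elim: n => [|n IH]; first exact: flat_algebra_cst.
by under eq_fun do rewrite exprS; exact: flat_algebraM.
Qed.

(* As [n] grows, [bump a b n] increases to the indicator function of ]a, b[. *)
Definition bump a b n x : R := 1 - (1 - flat 0 (x - a) * flat 0 (b - x)) ^+ n.

Lemma bump_flat_in a b x : 0 <= flat 0 (x - a) * flat 0 (b - x) <= 1.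
Proof.
apply/andP; split; first by rewrite mulr_ge0 ?flat_ge0.
by rewrite mulr_ile1 ?flat_ge0// ltW ?flat0_lt1.
Qed.

Lemma bump_ge0_le1 a b n x : 0 <= bump a b n x <= 1.
Proof.
have /andP[H0 H1] := bump_flat_in a b x; rewrite /bump.
have : 0 <= (1 - flat 0 (x - a) * flat 0 (b - x)) ^+ n <= 1.
  by apply/andP; split; [apply: exprn_ge0; lra|apply: exprn_ile1; lra].
lra.
Qed.

Lemma bump_out a b n x : x \notin `]a, b[ -> bump a b n x = 0.
Proof.
rewrite in_itv/= negb_and -!leNgt /bump => H.
suff -> : flat 0 (x - a) * flat 0 (b - x) = 0 by rewrite subr0 expr1n subrr.
apply/eqP; rewrite mulf_eq0; case/orP : H => H; apply/orP; [left|right];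
  by rewrite /flat ltNge subr_le0 H.
Qed.

Lemma bump_cvg a b x : x \in `]a, b[ -> bump a b n x @[n --> \oo] --> (1 : R).
Proof.
rewrite in_itv/= => /andP[ax xb].
rewrite -[X in _ --> X]subr0; apply: cvgB; first exact: cvg_cst.
apply: cvg_expr.
have F1 : 0 < flat 0 (x - a) by apply: flat0_gt0; rewrite subr_gt0.
have F2 : 0 < flat 0 (b - x) by apply: flat0_gt0; rewrite subr_gt0.
have := mulr_gt0 F1 F2; have /andP[_ ] := bump_flat_in a b x.
by move=> ? ?; rewrite ger0_norm; lra.
Qed.

Lemma bump_flat_algebra a b n : flat_algebra (bump a b n).
Proof.
have E1 : flat_algebra (fun x => flat 0 (x - a)).
  rewrite (_ : (fun _ => _) = fun x => flat 0 (1 * x + (- a))).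
    exact: flat_algebra_flat.
  by apply/funext => x; rewrite mul1r.
have E2 : flat_algebra (fun x => flat 0 (b - x)).
  rewrite (_ : (fun _ => _) = fun x => flat 0 ((-1) * x + b)).
    exact: flat_algebra_flat.
  by apply/funext => x; rewrite mulN1r addrC.
rewrite (_ : bump a b n = fun x => 1 + (-1) * (1 + (-1) * (flat 0 (x - a) * flat 0 (b - x))) ^+ n).
  apply: (flat_algebraD (flat_algebra_cst 1)).
  apply: (flat_algebraM (flat_algebra_cst (-1))).
  apply: flat_algebraX.
  apply: (flat_algebraD (flat_algebra_cst 1)).
  apply: (flat_algebraM (flat_algebra_cst (-1))).
  exact: flat_algebraM.
by apply/funext => x; rewrite /bump !mulN1r.
Qed.

Lemma supp_test phi A : (forall n x, derivable (derive1n n phi) x 1) ->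
  (forall x, A <= `|x| -> phi x = 0) -> test_function phi.
Proof.
move=> sphi phi0; split => //.
apply: (@subclosed_compact _ _ `[- A, A]%classic).
- exact: closed_closure.
- exact: segment_compact.
- have cA : closed `[- A, A]%classic by exact: itv_closed.
  rewrite [X in _ `<=` X](closure_id _).1//; apply: closureS => x /= phix.
  rewrite in_itv/= -ler_norml leNgt; apply/negP => /ltW /phi0 phi0x.
  by rewrite phi0x eqxx in phix.
Qed.

Lemma test_bump a b n : test_function (bump a b n).
Proof.
apply: (@supp_test _ (`|a| + `|b|)).
  by move=> m x; apply: flat_algebra_smooth; exact: bump_flat_algebra.
move=> x H; apply: bump_out; rewrite in_itv/=; apply/negP => /andP[ax xb].
suff : `|x| < `|a| + `|b| by rewrite ltNge H.
have := ler_norm b; have := ler_norm (- a); rewrite normrN => h1 h2.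
have h3 := normr_ge0 a; have h4 := normr_ge0 b.
by rewrite ltr_norml; apply/andP; split; lra.
Qed.

Lemma test_supp phi : test_function phi ->
  exists2 A : R, 0 < A & forall x, A <= `|x| -> phi x = 0.
Proof.
move=> [_ /compact_bounded[M [_ HM]]].
exists (`|M| + 2) => [|x Hx]; first by rewrite ltr_wpDl.
apply/eqP; apply: contraT => phix.
have : `|x| <= `|M| + 1.
  apply: (HM (`|M| + 1)); last exact: subset_closure.
  by rewrite (le_lt_trans (ler_norm M))// ltrDl.
by move=> ?; lra.
Qed.

Lemma test_dv phi x : test_function phi -> dv phi x (derive1 phi x).
Proof. by case=> sphi _; exact: derivable_dv (sphi 0%N x). Qed.

Lemma test_derive phi : test_function phi -> test_function (derive1 phi).
Proof.
move=> tphi; have [A A0 HA] := test_supp tphi.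
(* For |x| >= A + 1 all points within distance 1 of x lie where [phi] vanishes, so the derivative at
   x does too. *)
apply: (@supp_test _ (A + 1)).
  by move=> n x; rewrite -derive1Sn; exact: tphi.1.
move=> x Hx; apply: dv_derive1.
apply: (@dv_near _ (fun=> 0) _ _ _ 1) => //; last exact: dv_cst.
move=> y yx; rewrite HA//.
have := ler_normD y (x - y); rewrite addrC subrK (distrC x y); lra.
Qed.

Lemma test_continuous phi : test_function phi -> continuous phi.
Proof. by move=> tphi x; exact: dv_continuous (test_dv x tphi). Qed.

Lemma test_derive1n phi n : test_function phi -> test_function (derive1n n phi).
Proof. by move=> tphi; elim: n => //= n IH; exact: test_derive. Qed.

Lemma test_bounded phi : test_function phi ->
  exists2 M : R, 0 < M & forall x, `|phi x| <= M.
Proof.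
move=> tphi; have [A A0 HA] := test_supp tphi.
have cphi : {within `[- A, A], continuous (fun x => `|phi x|)}.
  apply: continuous_subspaceT => x.
  by apply: continuous_comp; [exact: test_continuous|exact: norm_continuous].
have AA : - A <= A by lra.
have [c _ Hc] := EVT_max AA cphi.
exists (`|phi c| + 1) => [|x]; first by rewrite ltr_wpDl.
have [xA|/HA ->] := ltP `|x| A; last by rewrite normr0 addr_ge0.
rewrite (le_trans (Hc x _)) ?lerDl//.
by rewrite in_itv/= -ler_norml ltW.
Qed.

Lemma Ig_mul_test p phi : loc1 p -> test_function phi ->
  Ig setT (fun x => p x * phi x).
Proof.
move=> [mp lp] tphi; have [A A0 HA] := test_supp tphi.
have [M M0 HM] := test_bounded tphi.
apply: (@Ig_le _ _ _ (fun x => (M * `|p x|) * \1_(`[- A, A]%classic) x)) => //.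
- by apply: measurable_funM => //; exact: continuous_meas (test_continuous tphi).
- move=> x _; rewrite indicE; case: (boolP (x \in _)) => xA.
    by rewrite mulr1 normrM mulrC ler_wpM2r.
  rewrite mulr0 HA ?mulr0 ?normr0//.
  rewrite leNgt; apply: contra xA => xA; rewrite inE/= in_itv/= -ler_norml.
  exact: ltW.
- by apply: Ig_indic => //; apply: IgZ => //; apply: Ig_abs.
Qed.

Lemma locally_integrableP f : locally_integrable setT f <-> loc1 f.
Proof.
split=> [[mf _ H]|[mf lf]].
  split => // x y; apply/integrableP; split; last first.
    by apply: H => //; exact: segment_compact.
  by apply/measurable_EFinP; exact: measurable_funTS.
split => //; first exact: openT.
move=> K _ cK; have /compact_bounded[M [_ HM]] := cK.
have KI : K `<=` `[- (`|M| + 1), `|M| + 1]%classic.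
  move=> x Kx /=; rewrite in_itv/= -ler_norml; apply: (HM (`|M| + 1)) => //.
  by rewrite (le_lt_trans (ler_norm M))// ltrDl.
have mK : measurable K by exact: compact_measurable.
by have /integrableP[] := IgS (measurable_itv _) mK KI (lf _ _).
Qed.

Lemma Rint_dominated (f_ : nat -> R -> R) f g :
  (forall n, measurable_fun setT (f_ n)) -> measurable_fun setT f ->
  (forall x, f_ n x @[n --> \oo] --> f x) -> Ig setT g ->
  (forall n x, `|f_ n x| <= g x) ->
  Rint (f_ n) @[n --> \oo] --> Rint f.
Proof.
move=> mf_ mf ff Ig' fg.
have mEf_ n : measurable_fun setT (EFin \o f_ n) by exact/measurable_EFinP.
have mEf : measurable_fun setT (EFin \o f) by exact/measurable_EFinP.
have [] := @dominated_convergence _ _ _ mu setT measurableT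
  (fun n => EFin \o f_ n) (EFin \o f) (EFin \o g).
- exact: mEf_.
- exact: mEf.
- by apply: aeW => x _; apply: cvg_EFin => //; [exact: nearW|exact: ff].
- exact: Ig'.
- by apply: aeW => x n _ /=; rewrite lee_fin.
move=> If _ H.
rewrite /Rint /Rintegral; apply: fine_cvg.
by rewrite fineK; [exact: H|exact: integrable_fin_num].
Qed.

(** The bumps on ]a, b[ are test functions converging to its indicator and bounded by it, so
    dominated convergence applies. *)
Lemma Rint_itv_test0 g : loc1 g ->
  (forall phi, test_function phi -> Rint (fun x => g x * phi x) = 0) ->
  forall a b, \int[mu]_(t in `[a, b]) g t = 0.
Proof.
move=> lg H a b.
have -> : \int[mu]_(t in `[a, b]) g t = Rint (fun x => g x * \1_(`]a, b[%classic) x).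
  rewrite Rint_indic.
  have Io : Ig `]a, b[%classic g by apply: IgS (lg.2 a b) => //; exact: subset_itv_oo_cc.
  have Ioc : Ig `]a, b]%classic g by apply: IgS (lg.2 a b) => //; exact: subset_itv_oc_cc.
  by rewrite Rintegral_itv_bndo_bndc// Rintegral_itv_obnd_cbnd.
have : Rint (fun x => g x * bump a b n x) @[n --> \oo] -->
    Rint (fun x => g x * \1_(`]a, b[%classic) x).
  apply: (@Rint_dominated _ _ (fun x => `|g x| * \1_(`[a, b]%classic) x)).
  - move=> n; apply: measurable_funM; first exact: lg.1.
    exact: continuous_meas (test_continuous (test_bump _ _ _)).
  - by apply: measurable_funM; [exact: lg.1|exact: measurable_indic].
  - move=> x; apply: cvgMr.
    rewrite indicE; case: (boolP (x \in _)) => xab.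
      by apply: bump_cvg; move: xab; rewrite inE.
    rewrite (_ : (fun n => bump a b n x) = fun=> 0); first exact: cvg_cst.
    apply/funext => n; rewrite bump_out//; apply: contra xab => xab.
    by rewrite inE.
  - by apply: Ig_indic => //; apply: Ig_abs => //; exact: lg.2.
  - move=> n x; rewrite normrM ler_wpM2l// indicE.
    have /andP[b0 b1] := bump_ge0_le1 a b n x.
    rewrite ger0_norm//; case: (boolP (x \in _)) => //= xab.
    rewrite bump_out//; apply: contra xab => xab.
    by rewrite inE; apply: subset_itv_oo_cc.
rewrite (_ : (fun n => _) = fun=> 0); last first.
  by apply/funext => n; apply: H; exact: test_bump.
by move=> /cvg_unique /(_ (cvg_cst _)) => ->.
Qed.

(* Lebesgue differentiation of the vanishing primitive of [g]. *)
Lemma ae_eq0_itv g : loc1 g ->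
  (forall a b, \int[mu]_(t in `[a, b]) g t = 0) -> {ae mu, forall x, g x = 0}.
Proof.
move=> lg H.
(* Differentiation concerns primitives with a fixed left endpoint; letting it be - n for every n,
   countably many null sets cover the line. *)
have K (n : nat) : {ae mu, forall x, - n%:R < x -> g x = 0}.
  have := @FTC1 R g (BLeft (- n%:R)) (lg.2 _) ((locally_integrableP g).2 lg).
  apply: ae_imp => x + nx; rewrite lte_fin => /(_ nx)[_ <-].
  by apply: dv_derive1; under eq_fun do rewrite H; exact: dv_cst.
apply: ae_imp (ae_foralln K) => x /(_ (Num.truncn `|x|).+1); apply.
by rewrite ltrNl (le_lt_trans (ler_norm _))// normrN truncnS_gt.
Qed.

Lemma ae_eq0_test g : loc1 g ->
  (forall phi, test_function phi -> Rint (fun x => g x * phi x) = 0) ->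
  {ae mu, forall x, g x = 0}.
Proof. by move=> lg H; apply: ae_eq0_itv => //; exact: Rint_itv_test0. Qed.

(** A normalized bump on ]0, 1[. If all the bumps had integral 0, then so would their limit, the
    indicator of ]0, 1[. *)
Lemma exists_test_Rint1 : exists2 rho : R -> R, test_function rho & Rint rho = 1.
Proof.
suff [n Hn] : exists n, Rint (bump 0 1 n) != 0.
  have It : Ig setT (bump 0 1 n).
    have c1 : continuous ((fun=> 1) : R -> R) by move=> x; exact: cvg_cst.
    have := Ig_mul_test (continuous_loc1 c1) (test_bump 0 1 n).
    by congr Ig; apply/funext => x; rewrite mul1r.
  exists (fun x => (Rint (bump 0 1 n))^-1 * bump 0 1 n x).
    apply: (@supp_test _ 1).
      move=> m x; apply: flat_algebra_smooth.
      by apply: (flat_algebraM (flat_algebra_cst _)); exact: bump_flat_algebra.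
    move=> x x1; rewrite bump_out ?mulr0//; rewrite in_itv/=; apply/negP => /andP[x0 x1'].
    by move: x1; rewrite ger0_norm ?(ltW x0)// leNgt x1'.
  by rewrite RintZ// mulVf.
apply: contrapT => /forallNP H.
have : Rint (fun x => 1 * bump 0 1 n x) @[n --> \oo] -->
    Rint (fun x => 1 * \1_(`]0, 1[%classic) x).
  apply: (@Rint_dominated _ _ (fun x => 1 * \1_(`[0, 1]%classic) x)).
  - move=> n; apply: measurable_funM => //.
    exact: continuous_meas (test_continuous (test_bump _ _ _)).
  - by apply: measurable_funM => //; exact: measurable_indic.
  - move=> x; rewrite mul1r; under eq_fun do rewrite mul1r.
    rewrite indicE; case: (boolP (x \in _)) => xab.
      by apply: bump_cvg; move: xab; rewrite inE.
    rewrite (_ : (fun n => bump 0 1 n x) = fun=> 0); first exact: cvg_cst.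
    apply/funext => n; rewrite bump_out//; apply: contra xab => xab.
    by rewrite inE.
  - by apply: Ig_indic => //; exact: Ig_itv_cst.
  - move=> n x; rewrite !mul1r indicE.
    have /andP[b0 b1] := bump_ge0_le1 0 1 n x.
    rewrite ger0_norm//; case: (boolP (x \in _)) => //= xab.
    rewrite bump_out//; apply: contra xab => xab.
    by rewrite inE; apply: subset_itv_oo_cc.
rewrite (_ : (fun n => _) = fun=> 0); last first.
  apply/funext => n; under eq_Rint do rewrite mul1r.
  by apply/eqP; apply/negPn/negP; exact: H.
move=> /cvg_unique /(_ (cvg_cst _)) E; move: (E (@Rhausdorff R)).
have Io : Ig `]0, 1[%classic (cst 1 : R -> R).
  by apply: IgS (Ig_itv_cst 0 1 1) => //; exact: subset_itv_oo_cc.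
have Ioc : Ig `]0, 1]%classic (cst 1 : R -> R).
  by apply: IgS (Ig_itv_cst 0 1 1) => //; exact: subset_itv_oc_cc.
rewrite Rint_indic Rintegral_itv_bndo_bndc ?Rintegral_itv_obnd_cbnd ?int_itv_cst//.
by rewrite subr0 mulr1 => /eqP; rewrite oner_eq0.
Qed.

End test_functions.

(** * Integration by parts, du Bois-Reymond's lemma and the structure of H^1 *)

Section weak_derivatives.
Variable R : realType.
Local Notation mu := (@lebesgue_measure R).
Implicit Types (f g h p q F G phi w : R -> R) (a b c x y z t : R) (n k : nat).

Lemma Rint_test_derive phi : test_function phi -> Rint (derive1 phi) = 0.
Proof.
move=> tphi; have tpsi := test_derive tphi.
have [A1 A10 HA1] := test_supp tphi; have [A2 A20 HA2] := test_supp tpsi.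
pose A := A1 + A2.
have AA : - A <= A by rewrite /A; lra.
transitivity (\int[mu]_(t in `[- A, A]) derive1 phi t).
  rewrite -Rint_indic; apply: eq_Rint => x; rewrite indicE.
  case: (boolP (x \in _)) => xA; first by rewrite mulr1.
  rewrite HA2 ?mul0r// leNgt; apply: contra xA => xA.
  by rewrite inE/= in_itv/= -ler_norml ltW//; rewrite (lt_le_trans xA)// /A; lra.
rewrite (FTC2 AA (fun x => test_dv x tphi) (test_continuous tpsi)).
by rewrite !HA1 ?subrr// ?normrN ger0_norm /A; lra.
Qed.

Section AC_by_parts.
Variables (F p phi : R -> R).
Hypotheses (lp : loc1 p) (tphi : test_function phi).
Variable A : R.
Hypotheses (A0 : 0 < A) (HA : forall x, A <= `|x| -> phi x = 0)
  (HA' : forall x, A <= `|x| -> derive1 phi x = 0).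

Let psi : R -> R := derive1 phi.
Let p1 t := p t * \1_(`[- A, A]%classic) t.
(** Integration by parts is Fubini's theorem for this kernel: integrating in t gives (F x - F (- A))
    psi x, integrating in x gives - p t phi t. The truncation [p1] makes the kernel integrable on
    the plane, [p] being only locally integrable. *)
Let ker (z : R * R) := p1 z.2 * psi z.1 * (z.2 <= z.1)%R%:R.

Let tpsi : test_function psi. Proof. exact: test_derive. Qed.
Let mpsi : measurable_fun setT psi.
Proof. exact: continuous_meas (test_continuous tpsi). Qed.
Let Ip1 : Ig setT p1. Proof. by apply: Ig_indic => //; exact: lp.2. Qed.
Let mp1 : measurable_fun setT p1. Proof. exact: Ig_meas Ip1. Qed.
Let Ipsi : Ig setT psi.
Proof.
have c1 : continuous ((fun=> 1) : R -> R) by move=> x; exact: cvg_cst.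
by have := Ig_mul_test (continuous_loc1 c1) tpsi; congr Ig; apply/funext => x; rewrite mul1r.
Qed.

Let mker : measurable_fun setT ker.
Proof.
have m1 : measurable_fun setT (fun z : R * R => p1 z.2).
  exact: (measurableT_comp mp1 measurable_snd).
have m2 : measurable_fun setT (fun z : R * R => psi z.1).
  exact: (measurableT_comp mpsi measurable_fst).
rewrite (_ : ker = fun z : R * R => if z.2 <= z.1 then p1 z.2 * psi z.1 else 0).
  apply: measurable_fun_ifT => //; last exact: measurable_funM.
  by apply: measurable_fun_ler; [exact: measurable_snd|exact: measurable_fst].
by apply/funext => z; rewrite /ker; case: ifP => _; rewrite ?mulr1 ?mulr0.
Qed.

Let ker_le x t : `|ker (x, t)| <= `|psi x| * `|p1 t|.
Proof.
rewrite /ker/= normrM normrM mulrC (mulrC `|p1 t|).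
by case: (t <= x); rewrite ?normr1 ?mul1r// normr0 mul0r mulr_ge0.
Qed.

Let mkerx x : measurable_fun setT (fun t => ker (x, t)).
Proof. exact: (measurableT_comp mker (pair1_measurable x)). Qed.

Let mkert t : measurable_fun setT (fun x => ker (x, t)).
Proof. exact: (measurableT_comp mker (pair2_measurable t)). Qed.

Let Ikerx x : Ig setT (fun t => ker (x, t)).
Proof.
apply: (@Ig_le _ _ _ (fun t => `|psi x| * `|p1 t|)) => //.
by apply: IgZ => //; exact: Ig_abs.
Qed.

Let Ikert t : Ig setT (fun x => ker (x, t)).
Proof.
apply: (@Ig_le _ _ _ (fun x => `|p1 t| * `|psi x|)) => //.
  by move=> x _; rewrite mulrC; exact: ker_le.
by apply: IgZ => //; exact: Ig_abs.
Qed.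

Let Iker : (mu \x mu)%E.-integrable setT (EFin \o ker).
Proof.
have mE : measurable_fun setT (EFin \o ker) by exact/measurable_EFinP.
apply/integrable12ltyP => //.
have I2 : Ig setT (fun x => Rint (fun t => `|p1 t|) * `|psi x|).
  by apply: IgZ => //; exact: Ig_abs.
apply: (@le_lt_trans _ _ (\int[mu]_x (Rint (fun t => `|p1 t|) * `|psi x|)%:E)%E).
  apply: ge0_le_integral => //.
  - by move=> x _; exact: integral_ge0.
  - have mabs : measurable_fun setT (fun z : R * R => `|(EFin \o ker) z|%E).
      exact: measurableT_comp.
    apply: (@measurable_fun_fubini_tonelli_F _ _ _ _ _ mu _ mabs) => z.
    exact: abse_ge0.
  - by apply/measurable_EFinP; exact: Ig_meas I2.
  - move=> x _.
    have I3 : Ig setT (fun t => `|ker (x, t)|) by exact: Ig_abs.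
    have := EFin_Rint I3; rewrite /= => ->; rewrite lee_fin.
    rewrite mulrC -RintZ; last exact: Ig_abs.
    apply: le_Rint => //; first by apply: IgZ => //; exact: Ig_abs.
by rewrite EFin_Rint// ltry.
Qed.

Let Rint_kerx x : AC F p -> Rint (fun t => ker (x, t)) = (F x - F (- A)) * psi x.
Proof.
move=> [_ HF]; have [xA|xA] := leP A `|x|.
  rewrite /psi HA' ?mulr0//; under eq_Rint do rewrite /ker/= /psi HA' ?mulr0 ?mul0r//.
  by rewrite /Rint Rintegral_cst// mul0r.
have [x1 x2] : - A <= x /\ x <= A.
  by move: xA; rewrite ltr_norml => /andP[]; split; exact: ltW.
rewrite HF// -Rint_indic mulrC -RintZ; last by apply: Ig_indic => //; exact: lp.2.
apply: eq_Rint => t; rewrite /ker/= /p1 !indicE !mem_setE !in_itv/=.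
have [tx|tx] := leP t x; last by rewrite !andbF !mulr0.
by rewrite (le_trans tx x2) !andbT mulr1; ring.
Qed.

Let Rint_kert t : Rint (fun x => ker (x, t)) = - (p t * phi t).
Proof.
have [tA|tA] := leP A `|t|.
  rewrite HA ?mulr0 ?oppr0//.
  (* The indicator in [p1] does not vanish at the endpoints. At t = A, [psi] is 0 on the domain x >=
     A; at t = - A, the integral is that of [psi] over the whole line, which is 0. *)
  have [tA'|tA'] := eqVneq t A.
    rewrite -(_ : Rint (fun x => 0) = 0); last by rewrite /Rint Rintegral_cst// mul0r.
    apply: eq_Rint => x; rewrite /ker/= tA'; have [Ax|] := leP A x.
      by rewrite /psi HA' ?mulr0 ?mul0r// (le_trans Ax)// ler_norm.
    by rewrite mulr0.
  have [tA2|tA2] := eqVneq t (- A).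
    transitivity (Rint (fun x => p1 t * psi x)).
      apply: eq_Rint => x; rewrite /ker/= tA2; have [Ax|Ax] := leP (- A) x.
        by rewrite mulr1.
      rewrite /psi HA' ?mulr0 ?mul0r// ler_normr; apply/orP; right; lra.
    by rewrite RintZ// Rint_test_derive// mulr0.
  rewrite -(_ : Rint (fun x => 0) = 0); last by rewrite /Rint Rintegral_cst// mul0r.
  apply: eq_Rint => x; rewrite /ker/= /p1 indicE mem_setE in_itv/=.
  suff -> : (- A <= t) && (t <= A) = false by rewrite mulr0 !mul0r.
  rewrite -ler_norml; apply/negbTE; rewrite -ltNge lt_neqAle tA andbT.
  apply/eqP => tA3; have := lexx `|t|; rewrite {1}/Num.norm.
  move: tA3; have [t0|t0] := ger0P t => tA3.
    by move: tA'; rewrite -tA3 eqxx.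
  by move: tA2; rewrite tA3 opprK eqxx.
have [t1 t2] : - A <= t /\ t <= A.
  by move: tA; rewrite ltr_norml => /andP[]; split; exact: ltW.
have -> : - (p t * phi t) = p t * (phi A - phi t).
  by rewrite (@HA A) ?ger0_norm ?(ltW A0)//; ring.
rewrite -(FTC2 t2 (fun x => test_dv x tphi) (test_continuous tpsi)).
rewrite -Rint_indic -RintZ; last by apply: Ig_indic => //; exact: IgT.
apply: eq_Rint => x; rewrite /ker/= /p1 !indicE !mem_setE !in_itv/= t1 t2 mulr1.
have [tx|tx] := leP t x; last by rewrite !mulr0.
have [xA|xA] := leP x A; first by rewrite !mulr1.
by rewrite /psi HA' ?mulr0 ?mul0r// (le_trans (ltW xA))// ler_norm.
Qed.

Lemma AC_by_parts_supp : AC F p -> loc1 F ->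
  Rint (fun x => F x * psi x) = - Rint (fun x => p x * phi x).
Proof.
move=> AF lF.
have I1 := Ig_mul_test lF tpsi; have I2 := Ig_mul_test lp tphi.
(* Subtracting the constant F (- A) is free because [psi] has integral 0. *)
have -> : Rint (fun x => F x * psi x) = Rint (fun x => (F x - F (- A)) * psi x).
  under [RHS]eq_Rint do rewrite mulrBl.
  by rewrite RintB//; [rewrite RintZ// Rint_test_derive// mulr0 subr0|exact: IgZ].
have -> : - Rint (fun x => p x * phi x) = Rint (fun t => - (p t * phi t)).
  rewrite -mulN1r -RintZ//; apply: eq_Rint => t; ring.
have := Fubini Iker; rewrite /=.
under eq_integral do rewrite EFin_Rint// Rint_kerx//.
under [X in _ = X -> _]eq_integral do rewrite EFin_Rint// Rint_kert.
by move=> H; rewrite /Rint /Rintegral H.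
Qed.

End AC_by_parts.

Lemma AC_by_parts F p phi : AC F p -> loc1 F -> test_function phi ->
  Rint (fun x => F x * derive1 phi x) = - Rint (fun x => p x * phi x).
Proof.
move=> AF lF tphi; have tpsi := test_derive tphi.
have [A1 A10 HA1] := test_supp tphi; have [A2 A20 HA2] := test_supp tpsi.
apply: (@AC_by_parts_supp F p phi AF.1 tphi (A1 + A2)) => //; first lra.
- by move=> x Hx; apply: HA1; lra.
- by move=> x Hx; apply: HA2; lra.
Qed.

Definition smooth h : Prop := forall n x, derivable (derive1n n h) x 1.

Lemma smoothDZ c w g : smooth w -> smooth g -> smooth (fun x => w x + c * g x).
Proof.
pose C h := exists w g, [/\ smooth w, smooth g & h = fun x => w x + c * g x].
have smooth' h : smooth h -> smooth (derive1 h).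
  by move=> sh n x; rewrite -derive1Sn.
have CC : forall h, C h -> (forall x, derivable h x 1) /\ C (derive1 h).
  move=> _ [w' [g' [sw sg ->]]].
  have D x : dv (fun x => w' x + c * g' x) x (derive1 w' x + c * derive1 g' x).
    by apply: dvD; [|apply: dvZ]; apply: derivable_dv; [exact: (sw 0%N)|exact: (sg 0%N)].
  split; first by move=> x; exact: dv_derivable (D x).
  by exists (derive1 w'), (derive1 g'); split; [exact: smooth'|exact: smooth'|exact: derive1_funext].
move=> sw sg n x; have : C (derive1n n (fun x => w x + c * g x)).
  by apply: smooth_closed => //; exists w, g.
by move=> /CC[].
Qed.

Lemma testDZ c w g : test_function w -> test_function g ->
  test_function (fun x => w x + c * g x).
Proof.
move=> tw tg.
have [A1 A10 HA1] := test_supp tw; have [A2 A20 HA2] := test_supp tg.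
apply: (@supp_test _ _ (A1 + A2)); first by apply: smoothDZ; [exact: tw.1|exact: tg.1].
by move=> x Hx; rewrite HA1 ?HA2 ?mulr0 ?addr0//; lra.
Qed.

Lemma Ig_test phi : test_function phi -> Ig setT phi.
Proof.
have c1 : continuous ((fun=> 1) : R -> R) by move=> x; exact: cvg_cst.
move=> /(Ig_mul_test (continuous_loc1 c1)).
by congr Ig; apply/funext => x; rewrite mul1r.
Qed.

(** The primitive based at - A vanishes to the left of the support by construction, and to the right
    because the total integral is 0. *)
Lemma test_primitive w : test_function w -> Rint w = 0 ->
  exists2 phi, test_function phi & derive1 phi = w.
Proof.
move=> tw w0; have [A A0 HA] := test_supp tw.
have cw := test_continuous tw.
pose V x := primitive w x - primitive w (- A).
have AV : AC V w.
  have [lw H] := AC_primitive (continuous_loc1 cw).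
  by split => // x y xy; rewrite /V -H//; ring.
have DV := dv_AC AV cw.
have VA : V (- A) = 0 by rewrite /V subrr.
have w0itv x y : x <= y -> (forall t, x <= t <= y -> w t = 0) ->
    \int[mu]_(t in `[x, y]) w t = 0.
  move=> xy H; rewrite (@eq_Rintegral _ _ _ mu _ (cst 0)).
    by rewrite int_itv_cst// mul0r.
  by move=> t; rewrite inE/= in_itv/= => /H.
have V0 x : A <= `|x| -> V x = 0.
  rewrite ler_normr => /orP[Ax|Ax].
    have -> : V x = V x - V (- A) by rewrite VA subr0.
    have Ax' : - A <= x by lra.
    rewrite AV.2// -[RHS]w0 -Rint_indic; apply: eq_Rint => t.
    rewrite indicE mem_setE in_itv/=.
    case: (boolP (- A <= t <= x)) => [_|H]; first by rewrite mulr1.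
    rewrite HA ?mul0r// leNgt; apply: contra H; rewrite ltr_norml => /andP[H1 H2].
    by apply/andP; split; lra.
  have xA : x <= - A by lra.
  have : V (- A) - V x = 0.
    rewrite AV.2// w0itv// => t /andP[_ tA]; apply: HA.
    by rewrite ler_normr; apply/orP; right; lra.
  by rewrite VA sub0r => /eqP; rewrite oppr_eq0 => /eqP.
exists V; last exact: derive1_funext.
apply: (@supp_test _ _ A) => // -[|n] x; first exact: dv_derivable (DV x).
by rewrite derive1Sn (derive1_funext DV); exact: tw.1.
Qed.

(* du Bois-Reymond's lemma: any test function [w] differs from a multiple of
   [rho] by the derivative of a test function. *)
Lemma ae_cst_test g : loc1 g ->
  (forall phi, test_function phi -> Rint (fun x => g x * derive1 phi x) = 0) ->
  exists c, {ae mu, forall x, g x = c}.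
Proof.
move=> lg H; have [rho trho rho1] := exists_test_Rint1 R.
exists (Rint (fun x => g x * rho x)); set c := Rint _.
have c1 : continuous ((fun=> c) : R -> R) by move=> x; exact: cvg_cst.
have lc := continuous_loc1 c1.
have lgc : loc1 (fun x => g x - c).
  by split; [exact: measurable_funB lg.1 lc.1|move=> x y; apply: IgB => //; [exact: lg.2|exact: lc.2]].
suff : {ae mu, forall x, g x - c = 0}.
  by apply: ae_imp => x /eqP; rewrite subr_eq0 => /eqP.
apply: ae_eq0_test => // w tw.
pose v x := w x + (- Rint w) * rho x.
have tv : test_function v by exact: testDZ.
have Iw := Ig_test tw; have Irho := Ig_test trho.
have Rv : Rint v = 0.
  by rewrite /v RintD//; [rewrite RintZ// rho1; ring|exact: IgZ].
have [phi tphi phiv] := test_primitive tv Rv.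
have := H _ tphi; rewrite phiv.
have I1 := Ig_mul_test lg tw; have I2 := Ig_mul_test lg trho.
have E1 : (fun x => g x * v x) = fun x => g x * w x + (- Rint w) * (g x * rho x).
  by apply/funext => x; rewrite /v; ring.
rewrite E1 RintD//; last exact: IgZ.
rewrite RintZ// -/c => <-.
under eq_Rint do rewrite mulrBl.
by rewrite RintB//; [rewrite RintZ//; ring|exact: IgZ].
Qed.

Lemma weak_deriv_loc1 k f g : is_weak_deriv k f g -> loc1 f /\ loc1 g.
Proof. by case=> /locally_integrableP ? /locally_integrableP ? _. Qed.

Lemma weak_deriv_uniq k f g h : is_weak_deriv k f g -> is_weak_deriv k f h ->
  {ae mu, forall x, g x = h x}.
Proof.
move=> Hg Hh; have [_ lg] := weak_deriv_loc1 Hg; have [_ lh] := weak_deriv_loc1 Hh.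
suff : {ae mu, forall x, g x - h x = 0}.
  by apply: ae_imp => x /eqP; rewrite subr_eq0 => /eqP.
apply: ae_eq0_test.
  by split; [exact: measurable_funB lg.1 lh.1|move=> x y; apply: IgB => //; [exact: lg.2|exact: lh.2]].
move=> phi tphi; under eq_Rint do rewrite mulrBl.
rewrite RintB; [|exact: Ig_mul_test|exact: Ig_mul_test].
case: Hg => _ _ /(_ _ tphi) Hg; case: Hh => _ _ /(_ _ tphi); rewrite Hg.
move=> /(congr1 (fun x => (-1) ^+ k * x)).
by rewrite !mulrA -exprMn mulrNN mulr1 expr1n !mul1r /Rint => ->; rewrite subrr.
Qed.

Lemma is_weak_deriv_ae k f f' g g' : is_weak_deriv k f g -> loc1 f' -> loc1 g' ->
  {ae mu, forall x, f x = f' x} -> {ae mu, forall x, g x = g' x} ->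
  is_weak_deriv k f' g'.
Proof.
move=> H lf' lg' ff' gg'; have [lf lg] := weak_deriv_loc1 H.
split; [exact/locally_integrableP|exact/locally_integrableP|] => phi tphi.
have tpk := test_derive1n k tphi.
have mp := continuous_meas (test_continuous tphi).
have mpk := continuous_meas (test_continuous tpk).
case: H => _ _ /(_ _ tphi).
have E1 : Rint (fun x => f x * derive1n k phi x)
        = Rint (fun x => f' x * derive1n k phi x).
  apply: Rint_ae; last by apply: ae_imp ff' => x ->.
  - by apply: measurable_funM; [exact: lf.1|exact: mpk].
  - by apply: measurable_funM; [exact: lf'.1|exact: mpk].
have E2 : Rint (fun x => g x * phi x) = Rint (fun x => g' x * phi x).
  apply: Rint_ae; last by apply: ae_imp gg' => x ->.
  - by apply: measurable_funM; [exact: lg.1|exact: mp].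
  - by apply: measurable_funM; [exact: lg'.1|exact: mp].
by move: E1 E2; rewrite /Rint => -> ->.
Qed.

Lemma weak_derivE k f g : is_weak_deriv k f g ->
  is_weak_deriv k f (weak_deriv k f) /\ {ae mu, forall x, weak_deriv k f x = g x}.
Proof.
move=> H; have H' : is_weak_deriv k f (weak_deriv k f).
  exact: (xgetPex (cst 0) (ex_intro [set g | is_weak_deriv k f g] g H)).
by split => //; exact: weak_deriv_uniq H' H.
Qed.

Lemma has_weak_derivP k f g : is_weak_deriv k f g -> L2 g -> has_weak_deriv_L2 k f.
Proof.
move=> H Lg; have [H1 E] := weak_derivE H; split => //; apply/L2P.
apply: L2_ae (Lg); first exact: (weak_deriv_loc1 H1).2.1.
by apply: ae_imp E => x ->.
Qed.

Lemma is_weak_deriv0 f : loc1 f -> is_weak_deriv 0 f f.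
Proof.
move=> /locally_integrableP lf; split => // phi _.
by rewrite derive1n0 expr0 mul1r.
Qed.

Lemma is_weak_deriv1_AC F p : AC F p -> loc1 F -> is_weak_deriv 1 F p.
Proof.
move=> AF lF; split; [exact/locally_integrableP| |].
  by apply/locally_integrableP; exact: AF.1.
by move=> phi tphi; rewrite derive1n1 expr1 mulN1r; exact: AC_by_parts.
Qed.

(** The interface between the statement, where [f] matters only up to null sets and has a weak
    derivative, and the calculus on the continuous representative [F] with the explicit derivative
    [p]. *)
Definition h1_rep f F p : Prop :=
  [/\ h1 F p, measurable_fun setT f & {ae mu, forall x, F x = f x}].

Lemma h1_rep_weak_deriv f F p : h1_rep f F p -> is_weak_deriv 1 f p.
Proof.
move=> [[LF Lp AF] mf Ff].
have Lf : L2 f := L2_ae mf Ff LF.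
apply: (is_weak_deriv_ae (is_weak_deriv1_AC AF (L2_loc1 LF)) (L2_loc1 Lf) (L2_loc1 Lp)) => //.
exact: aeW.
Qed.

Lemma h1_rep_weak_derivE f F p : h1_rep f F p ->
  {ae mu, forall x, weak_deriv 1 f x = p x}.
Proof. by move=> /h1_rep_weak_deriv /weak_derivE[]. Qed.

Lemma truncn1 : Num.truncn (1 : R) = 1%N.
Proof. exact: (@natrK R 1). Qed.

Lemma h1_rep_H1 f F p : h1_rep f F p -> H1 f.
Proof.
move=> H; have [[LF Lp AF] mf Ff] := H.
have Lf : L2 f := L2_ae mf Ff LF.
rewrite /H1 /Hs truncn1; split.
- exact/L2P.
- move=> [|[|k]]// _; first exact: has_weak_derivP (is_weak_deriv0 (L2_loc1 Lf)) Lf.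
  exact: has_weak_derivP (h1_rep_weak_deriv H) Lp.
- by rewrite /= subrr ltxx.
Qed.

(** Integration by parts shows that [f] minus a primitive of its weak derivative is orthogonal to
    all derivatives of test functions, hence a.e. constant. *)
Lemma H1_h1_rep f : H1 f -> exists F p, h1_rep f F p.
Proof.
rewrite /H1 /Hs truncn1 => -[/L2P Lf /(_ 1%N (leqnn _))[Hw /L2P Lp] _].
set p := weak_deriv 1 f in Hw Lp.
have AP := AC_primitive (L2_loc1 Lp).
have cP := AC_continuous Lp AP; have lP := continuous_loc1 cP.
have lf := L2_loc1 Lf.
have [c Hc] : exists c, {ae mu, forall x, f x - primitive p x = c}.
  apply: ae_cst_test.
    by split; [exact: measurable_funB lf.1 lP.1|move=> x y; apply: IgB => //; [exact: lf.2|exact: lP.2]].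
  move=> phi tphi; have tpsi := test_derive tphi.
  under eq_Rint do rewrite mulrBl.
  rewrite RintB; [|exact: Ig_mul_test|exact: Ig_mul_test].
  rewrite (AC_by_parts AP lP tphi).
  case: Hw => _ _ /(_ _ tphi); rewrite derive1n1 expr1 mulN1r /Rint => ->.
  by rewrite subrr.
exists (fun x => primitive p x + c), p.
have fE : {ae mu, forall x, primitive p x + c = f x}.
  by apply: ae_imp Hc => x <-; rewrite addrC subrK.
split => //; last exact: Lf.1.
split => //.
- apply: L2_ae (Lf).
    by apply: measurable_funD; [exact: lP.1|exact: measurable_cst].
  by apply: ae_imp fE => x ->.
- by split; [exact: AP.1|move=> x y xy; rewrite -AP.2//; ring].
Qed.

End weak_derivatives.

(** * Energy and constraint on states: bounds, exchange and homogeneity *)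

Section energy.
Variable R : realType.
Local Notation mu := (@lebesgue_measure R).
Variables a0 b0 : R.
Hypotheses (a0_gt0 : 0 < a0) (b0_gt0 : 0 < b0).

(* [dF] and [dG] stand for weak derivatives of [sF] and [sG]. *)
Record state := State { sF : R -> R; dF : R -> R; sG : R -> R; dG : R -> R }.

Implicit Types (u v w z : state) (s t x y e : R).

Definition h2 u : Prop := h1 (sF u) (dF u) /\ h1 (sG u) (dG u).

Definition sq (f : R -> R) : R := Rint (fun x => f x ^+ 2).

Definition En u : R := sq (dF u) + sq (dG u) + a0 * sq (sF u) + b0 * sq (sG u).

Definition Jn u : R := Rint (fun x => sF u x ^+ 2 * sG u x).

Definition comb s u t v : state :=
  State (fun x => s * sF u x + t * sF v x) (fun x => s * dF u x + t * dF v x)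
        (fun x => s * sG u x + t * sG v x) (fun x => s * dG u x + t * dG v x).

Definition sshift y u : state :=
  State (fun x => sF u (x + y)) (fun x => dF u (x + y))
        (fun x => sG u (x + y)) (fun x => dG u (x + y)).

Definition sswap a b u v : state :=
  State (swap a b (sF u) (sF v)) (swap a b (dF u) (dF v))
        (swap a b (sG u) (sG v)) (swap a b (dG u) (dG v)).

Lemma sq_ge0 f : 0 <= sq f.
Proof. by apply: Rint_ge0 => x; exact: sqr_ge0. Qed.

Lemma EnE u : En u = sq (dF u) + sq (dG u) + a0 * sq (sF u) + b0 * sq (sG u).
Proof. by []. Qed.

Lemma En_ge0 u : 0 <= En u.
Proof. by rewrite /En !addr_ge0 ?sq_ge0// mulr_ge0 ?sq_ge0// ltW. Qed.

Lemma h2_comb s u t v : h2 u -> h2 v -> h2 (comb s u t v).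
Proof. by move=> [? ?] [? ?]; split; apply: h1D; exact: h1Z. Qed.

Lemma h2_shift y u : h2 u -> h2 (sshift y u).
Proof. by move=> [? ?]; split; exact: h1_shift. Qed.

Lemma h2_L2 u : h2 u -> [/\ L2 (sF u), L2 (dF u), L2 (sG u) & L2 (dG u)].
Proof. by move=> [[? ? _] [? ? _]]. Qed.

Lemma sq_shift y f : L2 f -> sq (fun x => f (x + y)) = sq f.
Proof. by move=> [_ If]; exact: (Rint_shift y If). Qed.

Lemma sq_comb s f t g : L2 f -> L2 g ->
  sq (fun x => s * f x + t * g x)
  = s ^+ 2 * sq f + 2 * s * t * Rint (fun x => f x * g x) + t ^+ 2 * sq g.
Proof.
move=> Lf Lg; have I1 := L2M Lf Lg.
rewrite /sq -!RintZ//; [|exact: Lg.2|exact: Lf.2].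
rewrite -RintD; [|by apply: IgZ => //; exact: Lf.2|exact: IgZ].
rewrite -RintD; [|by apply: IgD => //; apply: IgZ => //; exact: Lf.2|by apply: IgZ => //; exact: Lg.2].
by apply: eq_Rint => x; ring.
Qed.

(** The symmetric bilinear form that polarizes [En]. *)
Definition Bn u v : R := Rint (fun x => dF u x * dF v x) + Rint (fun x => dG u x * dG v x)
  + a0 * Rint (fun x => sF u x * sF v x) + b0 * Rint (fun x => sG u x * sG v x).

Lemma En_comb s u t v : h2 u -> h2 v ->
  En (comb s u t v) = s ^+ 2 * En u + 2 * s * t * Bn u v + t ^+ 2 * En v.
Proof.
move=> /h2_L2[? ? ? ?] /h2_L2[? ? ? ?].
by rewrite /En /Bn /= !sq_comb//; ring.
Qed.

Lemma En_parallelogram u v : h2 u -> h2 v ->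
  En (comb 1 u (-1) v) + 4 * En (comb 2^-1 u 2^-1 v) = 2 * En u + 2 * En v.
Proof. by move=> hu hv; rewrite !En_comb//; field. Qed.

(** The right side minus the left side is [En] of (1 + t) u - v, divided by t. *)
Lemma En_triangle u v t : 0 < t -> h2 u -> h2 v ->
  En v <= (1 + t) * En u + (1 + t^-1) * En (comb 1 u (-1) v).
Proof.
move=> t0 hu hv.
have := En_ge0 (comb (1 + t) u (-1) v); rewrite !En_comb//.
have -> : 1 ^+ 2 * En u + 2 * 1 * -1 * Bn u v + (-1) ^+ 2 * En v
  = En u - 2 * Bn u v + En v by ring.
rewrite (_ : _ + _ + _ = (1 + t) ^+ 2 * En u - 2 * (1 + t) * Bn u v + En v); last by ring.
move=> H; rewrite -subr_ge0.
rewrite (_ : _ - _ = t^-1 * ((1 + t) ^+ 2 * En u - 2 * (1 + t) * Bn u v + En v)).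
  by rewrite mulr_ge0// invr_ge0 ltW.
by field; rewrite gt_eqF.
Qed.

Lemma En_scale s u : h2 u -> En (comb s u 0 u) = s ^+ 2 * En u.
Proof. by move=> hu; rewrite En_comb//; ring. Qed.

Lemma En_shift y u : h2 u -> En (sshift y u) = En u.
Proof. by move=> /h2_L2[? ? ? ?]; rewrite /En /= !sq_shift. Qed.

(** By [h1_sup], sup F^2 is at most twice the sum of the squared norms of F and of its derivative,
    and these are at most [En / a0] and [En]; likewise for G with [b0]. *)
Definition ksup : R := 2 * (1 + a0^-1 + b0^-1).

Lemma ksup_gt0 : 0 < ksup.
Proof. by rewrite /ksup mulr_gt0// !addr_gt0// invr_gt0. Qed.

Lemma sq_le u : [/\ sq (dF u) <= En u, sq (dG u) <= En u,
  sq (sF u) <= a0^-1 * En u & sq (sG u) <= b0^-1 * En u].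
Proof.
have H1 := sq_ge0 (dF u); have H2 := sq_ge0 (dG u).
have H3 : 0 <= a0 * sq (sF u) by rewrite mulr_ge0 ?sq_ge0// ltW.
have H4 : 0 <= b0 * sq (sG u) by rewrite mulr_ge0 ?sq_ge0// ltW.
by split; rewrite ?ler_pdivlMl// /En; lra.
Qed.

Lemma h2_sup u x : h2 u -> sF u x ^+ 2 <= ksup * En u /\ sG u x ^+ 2 <= ksup * En u.
Proof.
move=> [hF hG]; have [H1 H2 H3 H4] := sq_le u.
have E0 := En_ge0 u.
have E1 : 0 <= a0^-1 * En u by rewrite mulr_ge0// invr_ge0 ltW.
have E2 : 0 <= b0^-1 * En u by rewrite mulr_ge0// invr_ge0 ltW.
have := h1_sup x hF; have := h1_sup x hG; rewrite -!/(sq _) /ksup.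
by rewrite -[2 * (1 + _ + _) * _]mulrA !mulrDl mul1r => ? ?; split; lra.
Qed.

Lemma h2_meas u : h2 u -> [/\ measurable_fun setT (sF u), measurable_fun setT (sG u),
  measurable_fun setT (dF u) & measurable_fun setT (dG u)].
Proof. by move=> /h2_L2[[? _] [? _] [? _] [? _]]. Qed.

Lemma Ig_bounded_mul (f g : R -> R) M : measurable_fun setT g ->
  (forall x, `|g x| <= M) -> L2 f -> Ig setT (fun x => f x ^+ 2 * g x).
Proof.
move=> mg gM [mf If]; apply: (@Ig_le _ _ _ (fun x => M * f x ^+ 2)) => //.
- by apply: measurable_funM => //; exact: measurable_funX.
- move=> x _; rewrite normrM ger0_norm ?sqr_ge0// mulrC ler_wpM2r// sqr_ge0//.
- exact: IgZ.
Qed.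

Lemma norm_le_sqrt x y : x ^+ 2 <= y -> `|x| <= Num.sqrt y.
Proof. by move=> H; rewrite -sqrtr_sqr ler_wsqrtr. Qed.

Lemma h2_supG u x : h2 u -> `|sG u x| <= Num.sqrt (ksup * En u).
Proof. by move=> hu; apply: norm_le_sqrt; have [] := h2_sup x hu. Qed.

Lemma Ig_J u : h2 u -> Ig setT (fun x => sF u x ^+ 2 * sG u x).
Proof.
move=> hu; have [mF mG _ _] := h2_meas hu; have [LF _ _ _] := h2_L2 hu.
exact: (Ig_bounded_mul mG (fun x => h2_supG x hu) LF).
Qed.

(** This is what excludes vanishing: a uniformly small second component forces a small
    constraint. *)
Lemma Jn_le u M : h2 u -> (forall x, `|sG u x| <= M) -> `|Jn u| <= M * sq (sF u).
Proof.
move=> hu HM; have [LF _ _ _] := h2_L2 hu.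
rewrite /sq -RintZ; last exact: LF.2.
apply: (le_trans (Rint_norm (Ig_J hu))); apply: le_Rint.
- by apply: Ig_abs => //; exact: Ig_J.
- by apply: IgZ => //; exact: LF.2.
- by move=> x; rewrite normrM ger0_norm ?sqr_ge0// mulrC ler_wpM2r// sqr_ge0.
Qed.

(** The square of |J| <= sup |g| int f^2 <= sqrt (ksup En) En / a0. *)
Definition kJ : R := ksup * a0^-1 ^+ 2.

Lemma kJ_gt0 : 0 < kJ.
Proof. by rewrite mulr_gt0 ?ksup_gt0// exprn_gt0// invr_gt0. Qed.

Lemma Jn_sq_le u : h2 u -> Jn u ^+ 2 <= kJ * En u ^+ 3.
Proof.
move=> hu; have H := Jn_le hu (fun x => h2_supG x hu).
have [_ _ H3 _] := sq_le u; have E0 := En_ge0 u.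
set s := Num.sqrt _ in H; have s0 : 0 <= s by exact: sqrtr_ge0.
have s2 : s ^+ 2 = ksup * En u.
  by rewrite sqr_sqrtr// mulr_ge0// ltW// ksup_gt0.
have : `|Jn u| ^+ 2 <= (s * (a0^-1 * En u)) ^+ 2.
  rewrite lerXn2r// ?nnegrE//.
    by rewrite !mulr_ge0// invr_ge0 ltW.
  by rewrite (le_trans H)// ler_wpM2l.
by rewrite real_normK ?num_real// !exprMn s2 /kJ => H'; apply: le_trans H' _; rewrite le_eqVlt; apply/orP; left; apply/eqP; ring.
Qed.

Lemma Jn_scale s u : h2 u -> Jn (comb s u 0 u) = s ^+ 3 * Jn u.
Proof.
move=> hu; rewrite /Jn -RintZ; last exact: Ig_J.
by apply: eq_Rint => x /=; ring.
Qed.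

Lemma Jn_shift y u : h2 u -> Jn (sshift y u) = Jn u.
Proof. by move=> hu; exact: (Rint_shift y (Ig_J hu)). Qed.

(** Based on f^2 g - f'^2 g' = (f - f') (f + f') g + f'^2 (g - g'). It carries the constraint over
    to midpoints and to uniform limits. *)
Lemma Jn_dist u v e : h2 u -> h2 v ->
  (forall x, `|sF u x - sF v x| <= e) -> (forall x, `|sG u x - sG v x| <= e) ->
  `|Jn u - Jn v| <= 2 * e * (a0^-1 + b0^-1) * (En u + En v).
Proof.
move=> hu hv HF HG; have [LF _ LG _] := h2_L2 hu; have [LF' _ _ _] := h2_L2 hv.
have e0 : 0 <= e := le_trans (normr_ge0 _) (HF 0).
have Iu := Ig_J hu; have Iv := Ig_J hv.
have IB : Ig setT (fun x => sF u x ^+ 2 + sG u x ^+ 2 + sF v x ^+ 2).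
  by apply: IgD => //; [apply: IgD => //; [exact: LF.2|exact: LG.2]|exact: LF'.2].
rewrite /Jn -RintB//; apply: (le_trans (Rint_norm (IgB measurableT Iu Iv))).
apply: (@le_trans _ _ (Rint (fun x => 2 * e * (sF u x ^+ 2 + sG u x ^+ 2 + sF v x ^+ 2)))).
  apply: le_Rint.
  - by apply: Ig_abs => //; exact: IgB.
  - exact: IgZ.
  - move=> x; move: (HF x) (HG x).
    move: (sF u x) (sG u x) (sF v x) (sG v x) => f g f' g' Hf Hg.
    have -> : f ^+ 2 * g - f' ^+ 2 * g' = (f - f') * ((f + f') * g) + f' ^+ 2 * (g - g').
      by ring.
    apply: (le_trans (ler_normD _ _)); rewrite !normrM.
    have H1 : `|f + f'| * `|g| <= f ^+ 2 + f' ^+ 2 + g ^+ 2.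
      rewrite -normrM ler_norml; apply/andP; split;
        move: (sqr_ge0 (f + f' + g)) (sqr_ge0 (f + f' - g)) (sqr_ge0 (f - f')) (sqr_ge0 g); nra.
    apply: (@le_trans _ _ (e * (f ^+ 2 + f' ^+ 2 + g ^+ 2) + f' ^+ 2 * e)).
      apply: lerD; first exact: ler_pM.
      by rewrite -expr2 real_normK ?num_real// ler_wpM2l// sqr_ge0.
    have := mulr_ge0 e0 (sqr_ge0 f); have := mulr_ge0 e0 (sqr_ge0 g).
    have := mulr_ge0 e0 (sqr_ge0 f'); lra.
rewrite RintZ// -[leRHS]mulrA ler_wpM2l ?mulr_ge0//.
rewrite !RintD//; [|exact: LF.2|exact: LG.2|by apply: IgD => //; [exact: LF.2|exact: LG.2]|exact: LF'.2].
have [_ _ H3 H4] := sq_le u; have [_ _ H5 _] := sq_le v.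
rewrite -!/(sq _).
have : 0 <= b0^-1 * En v by rewrite mulr_ge0 ?En_ge0// invr_ge0 ltW.
by move: H3 H4 H5; move: (En u) (En v) => Eu Ev; rewrite mulrDl !mulrDr; lra.
Qed.

Lemma h2_swap a b u v : a < b -> h2 u -> h2 v -> sF u a = sF v a ->
  sF u b = sF v b -> sG u a = sG v a -> sG u b = sG v b -> h2 (sswap a b u v).
Proof. by move=> ab [? ?] [? ?] ? ? ? ?; split; exact: h1_swap. Qed.

(* Cutting and regluing two pairs at the points [a] and [b], where they agree,
   leaves the total energy and the total constraint unchanged. *)
Lemma Rint_swap a b (P : R -> R -> R -> R) (f g h f' g' h' : R -> R) :
  let S x := P (swap a b f f' x) (swap a b g g' x) (swap a b h h' x) in
  let S' x := P (swap a b f' f x) (swap a b g' g x) (swap a b h' h x) in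
  Ig setT S -> Ig setT S' ->
  Ig setT (fun x => P (f x) (g x) (h x)) -> Ig setT (fun x => P (f' x) (g' x) (h' x)) ->
  Rint S + Rint S' = Rint (fun x => P (f x) (g x) (h x)) + Rint (fun x => P (f' x) (g' x) (h' x)).
Proof.
move=> S S' IS IS' I1 I2; rewrite -!RintD//; apply: eq_Rint => x.
rewrite /S /S' /swap; case: ifP => _; first by rewrite addrC.
by case: ifP => _ //; rewrite addrC.
Qed.

Lemma sq_swap a b f g : L2 f -> L2 g -> L2 (swap a b f g) -> L2 (swap a b g f) ->
  sq (swap a b f g) + sq (swap a b g f) = sq f + sq g.
Proof.
move=> [_ If] [_ Ig'] [_ I1] [_ I2].
exact: (@Rint_swap a b (fun x _ _ => x ^+ 2) f f f g g g).
Qed.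

Lemma En_swap a b u v : h2 u -> h2 v -> h2 (sswap a b u v) -> h2 (sswap a b v u) ->
  En (sswap a b u v) + En (sswap a b v u) = En u + En v.
Proof.
move=> /h2_L2[? ? ? ?] /h2_L2[? ? ? ?] /h2_L2[? ? ? ?] /h2_L2[? ? ? ?].
have E1 := @sq_swap a b (sF u) (sF v); have E2 := @sq_swap a b (sG u) (sG v).
have E3 := @sq_swap a b (dF u) (dF v); have E4 := @sq_swap a b (dG u) (dG v).
rewrite /En /=.
rewrite (_ : forall p1 p2 p3 p4 q1 q2 q3 q4 : R,
  p1 + p2 + a0 * p3 + b0 * p4 + (q1 + q2 + a0 * q3 + b0 * q4)
  = (p1 + q1) + (p2 + q2) + a0 * (p3 + q3) + b0 * (p4 + q4)); last by move=> *; ring.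
by rewrite E1// E2// E3// E4//; ring.
Qed.

Lemma Jn_swap a b u v : h2 u -> h2 v -> h2 (sswap a b u v) -> h2 (sswap a b v u) ->
  Jn (sswap a b u v) + Jn (sswap a b v u) = Jn u + Jn v.
Proof.
move=> hu hv /Ig_J I1 /Ig_J I2.
have := @Rint_swap a b (fun x y _ => x ^+ 2 * y) (sF u) (sG u) (sG u) (sF v) (sG v) (sG v).
by apply => //; exact: Ig_J.
Qed.

Section homogeneity.
Variables lam M : R.
Hypotheses (lam_gt0 : 0 < lam) (M_gt0 : 0 < M).
Hypothesis HM : forall u, h2 u -> Jn u = lam -> M <= En u.

Lemma cbrt_ex t : 0 < t -> exists2 s : R, 0 < s & s ^+ 3 = t.
Proof.
move=> t0; exists (expR (ln t / 3)); first exact: expR_gt0.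
by rewrite -expRM_natl mulrC divfK ?lnK.
Qed.

(** Changing the sign of the second component reduces to [Jn u > 0]. Then s u satisfies the
    constraint for s^3 = lam / Jn u, and cubing M <= s^2 En u eliminates s. *)
Lemma En_homogeneous u : h2 u -> M ^+ 3 * Jn u ^+ 2 <= lam ^+ 2 * En u ^+ 3.
Proof.
wlog J0 : u / 0 < Jn u.
  move=> H hu; have [J0|J0|J0] := ltgtP 0 (Jn u); first exact: H.
    pose v := State (sF u) (dF u) (fun x => (-1) * sG u x) (fun x => (-1) * dG u x).
    have hv : h2 v by split; [exact: hu.1|exact: h1Z hu.2].
    have Jv : Jn v = - Jn u.
      rewrite /Jn -mulN1r -RintZ; last exact: Ig_J.
      by apply: eq_Rint => x /=; ring.
    have Ev : En v = En u.
      rewrite /En /=; congr (_ + _ + _ + _ * _);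
        by apply: eq_Rint => x; ring.
    by have := H v; rewrite Jv Ev sqrrN oppr_gt0; apply.
  by rewrite -J0 expr0n/= mulr0 mulr_ge0 ?exprn_ge0 ?En_ge0// ltW.
move=> hu; have [s s0 s3] := cbrt_ex (divr_gt0 lam_gt0 J0).
have := HM (h2_comb s 0 hu hu); rewrite Jn_scale// s3 divfK ?gt_eqF// => /(_ erefl).
rewrite En_scale// => H.
have H3 : M ^+ 3 <= (s ^+ 2 * En u) ^+ 3.
  by rewrite lerXn2r// nnegrE ?mulr_ge0 ?sqr_ge0 ?En_ge0// ltW.
have -> : lam = s ^+ 3 * Jn u by rewrite s3 divfK ?gt_eqF.
apply: (@le_trans _ _ ((s ^+ 2 * En u) ^+ 3 * Jn u ^+ 2)).
  by rewrite ler_wpM2r ?sqr_ge0.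
by rewrite le_eqVlt; apply/orP; left; apply/eqP; ring.
Qed.

End homogeneity.
End energy.

(** * The cost of splitting the constraint *)

Section dichotomy.
Variable R : realType.
Implicit Types (c e x y j k A B M lam : R).

(** If y > e, both x and y are at least m = 10 d, and since x + y <= 1 + d both are at most r = 1 -
    9 d. On [0, r], t^(3/2) <= sqrt r t, so 1 - d <= j + k <= sqrt r (1 + d), which fails. *)
Lemma dichotomy_normalized c e : 0 < c -> 0 < e -> exists2 d : R, 0 < d &
  forall x y j k, c <= x -> 0 <= y -> x + y <= 1 + d -> 1 - d <= j + k ->
    j ^+ 2 <= x ^+ 3 -> k ^+ 2 <= y ^+ 3 -> y <= e.
Proof.
move=> c0 e0.
pose m := Num.min (Num.min c e) 1.
have m0 : 0 < m by rewrite !lt_min c0 e0 ltr01.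
have [mc [me m1]] : m <= c /\ (m <= e /\ m <= 1).
  by split; [|split]; rewrite ge_min ?ge_min lexx ?orbT.
exists (m / 10); first by rewrite divr_gt0.
set d := m / 10; have md : m = 10 * d by rewrite /d; field.
have d0 : 0 < d by rewrite divr_gt0.
move=> x y j k cx y0 xy jk jx ky; rewrite leNgt; apply/negP => ey.
pose r := 1 - 9 * d.
have xr : x <= r by rewrite /r; lra.
have yr : y <= r by rewrite /r; lra.
have x0 : 0 < x by exact: lt_le_trans cx.
have r0 : 0 <= r by lra.
pose s := Num.sqrt r.
have s0 : 0 <= s by exact: sqrtr_ge0.
have s2 : s ^+ 2 = r by rewrite sqr_sqrtr.
have le_s u v : 0 <= u -> u <= r -> v ^+ 2 <= u ^+ 3 -> v <= s * u.
  move=> u0 ur vu; apply: (le_trans (ler_norm _)).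
  rewrite -(@ler_pXn2r _ 2)// ?nnegrE ?mulr_ge0// real_normK ?num_real//.
  by apply: (le_trans vu); rewrite exprMn s2 exprS ler_wpM2r// exprn_ge0.
have Hj := le_s _ _ (ltW x0) xr jx; have Hk := le_s _ _ y0 yr ky.
have H1 : 1 - d <= s * (1 + d).
  by apply: (le_trans jk); apply: (@le_trans _ _ (s * (x + y))); [lra|rewrite ler_wpM2l].
have H2 : (1 - d) ^+ 2 <= r * (1 + d) ^+ 2.
  by rewrite -s2 -exprMn lerXn2r// nnegrE; [lra|rewrite mulr_ge0//; lra].
(* Expanded, this inequality says 5 d + 18 d^2 + 9 d^3 <= 0. *)
move: H2; rewrite /r.
have := mulr_gt0 d0 d0; have := mulr_gt0 (mulr_gt0 d0 d0) d0; nra.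
Qed.

(* Strict concavity of [t^(2/3)]: splitting the constraint between two pairs
   costs energy, unless one of them carries all of it. *)
Lemma dichotomy M lam c e : 0 < M -> 0 < lam -> 0 < c -> 0 < e ->
  exists2 d : R, 0 < d & forall A B j k, c <= A -> 0 <= B -> A + B <= M + d ->
    lam - d <= j + k -> M ^+ 3 * j ^+ 2 <= lam ^+ 2 * A ^+ 3 ->
    M ^+ 3 * k ^+ 2 <= lam ^+ 2 * B ^+ 3 -> B <= e.
Proof.
move=> M0 l0 c0 e0.
have [d d0 H] := dichotomy_normalized (divr_gt0 c0 M0) (divr_gt0 e0 M0).
exists (Num.min (d * M) (d * lam)); first by rewrite lt_min !mulr_gt0.
move=> A B j k cA B0 AB jk jA kB.
have M1 : M != 0 by rewrite gt_eqF.
have l1 : lam != 0 by rewrite gt_eqF.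
have E u v : M ^+ 3 * u ^+ 2 <= lam ^+ 2 * v ^+ 3 -> (u / lam) ^+ 2 <= (v / M) ^+ 3.
  move=> uv; rewrite !expr_div_n ler_pdivrMr ?exprn_gt0// mulrAC ler_pdivlMr ?exprn_gt0//.
  by rewrite mulrC (mulrC (v ^+ 3)).
have AB1 : A + B <= M + d * M by apply: (le_trans AB); rewrite lerD2l ge_min lexx.
have jk1 : lam - d * lam <= j + k.
  by apply: le_trans jk; rewrite lerD2l lerN2 ge_min lexx orbT.
have := H (A / M) (B / M) (j / lam) (k / lam).
have Mi : 0 < M^-1 by rewrite invr_gt0.
rewrite -[B <= e](ler_pM2r Mi) => HH; apply: HH; [| | | |exact: E|exact: E].
- by rewrite ler_pM2r ?invr_gt0.
- by rewrite divr_ge0// ltW.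
- by rewrite -mulrDl ler_pdivrMr//; lra.
- by rewrite -mulrDl ler_pdivlMr//; lra.
Qed.

End dichotomy.

(** * Sequences of functions: small values and uniform cluster points *)

Section sequential_limits.
Variable R : realType.
Local Notation mu := (@lebesgue_measure R).
Implicit Types (f g h : R -> R) (u : nat -> R).

Lemma cvg_eps_N u (l : R) : u n @[n --> \oo] --> l <->
  forall e : R, 0 < e -> exists N, forall n, (N <= n)%N -> `|u n - l| < e.
Proof.
split=> [/cvgrPdist_lt H e /H[N _ HN]|H].
  by exists N => n Nn; rewrite distrC; exact: HN.
apply/cvgrPdist_lt => e /H[N HN]; exists N => // n Nn.
by rewrite /= distrC; exact: HN.
Qed.

Lemma cauchy_cvg_seq u :
  (forall e : R, 0 < e -> exists N, forall m n, (N <= m)%N -> (N <= n)%N ->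
     `|u m - u n| < e) -> exists l : R, u n @[n --> \oo] --> l.
Proof.
move=> H; have : cvg (u @ \oo).
  apply: cauchy_cvg; apply: cauchy_exP => e e0.
  have [N HN] := H e e0; exists (u N), N => // n Nn.
  by apply: HN.
by move=> ?; exists (limn u).
Qed.

(** Otherwise h > eta on an interval of length B, and its integral would be at least eta B > C. This
    supplies the cutting points. *)
Lemma exists_small_value h (C B eta x : R) : Ig setT h -> (forall t, 0 <= h t) ->
  Rint h <= C -> C < eta * B -> 0 <= B -> exists2 t : R, x <= t <= x + B & h t <= eta.
Proof.
move=> Ih h0 hC CB B0; apply: contrapT => H.
have : eta * B <= Rint h.
  have xB : x <= x + B by rewrite lerDl.
  apply: le_trans (le_int_itv x (x + B) Ih h0).
  rewrite (_ : eta * B = eta * (x + B - x)); last by rewrite addrC addKr.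
  rewrite -int_itv_cst//; apply: le_Rintegral => //.
  - exact: Ig_itv_cst.
  - exact: IgT.
  - move=> t /=; rewrite in_itv/= => xt; rewrite leNgt; apply/negP => /ltW ht.
    by apply: H; exists t.
by move=> H'; have := lt_le_trans CB H'; rewrite ltNge hC.
Qed.

Lemma norm_close3 (a b c d e : R) :
  `|a - b| <= e / 4 -> `|b - c| <= e / 4 -> `|c - d| <= e / 2 -> `|a - d| <= e.
Proof.
rewrite !ler_norml => /andP[? ?] /andP[? ?] /andP[? ?].
by apply/andP; split; lra.
Qed.

Lemma norm_close4 (a b c d e : R) :
  `|a - b| < e / 8 -> `|c - d| < e / 8 -> `|a - c| <= e / 4 -> `|b - d| <= e / 2.
Proof.
rewrite !ltr_norml !ler_norml => /andP[? ?] /andP[? ?] /andP[? ?].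
by apply/andP; split; lra.
Qed.

(* The cluster point is provided by Tychonoff's theorem; equicontinuity and
   tightness upgrade closeness on a finite grid to uniform closeness. *)
Lemma uniform_cluster (s : nat -> bool -> R -> R) (K : R) :
  (forall n b x, `|s n b x| <= K) ->
  (forall e : R, 0 < e -> exists2 d : R, 0 < d &
     forall n b x y, `|x - y| <= d -> `|s n b x - s n b y| <= e) ->
  (forall e : R, 0 < e -> exists B : R, exists N, forall n b x,
     (N <= n)%N -> B <= `|x| -> `|s n b x| <= e) ->
  exists c : bool -> R -> R, forall (e : R) N, 0 < e ->
    exists2 n, (N <= n)%N & forall b x, `|s n b x - c b x| <= e.
Proof.
move=> sK sE sT.
(* Both components are treated at once: a sequence term is a point of the product of copies of R
   indexed by component and position. *)
pose T (i : (bool * R)%type) : topologicalType := R.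
pose X : topologicalType := prod_topology T.
pose S n : X := fun i => s n i.1 i.2.
have cK : compact [set f : X | forall i, `[- K, K]%classic (f i)].
  apply: (@tychonoff _ T (fun=> `[- K, K]%classic)) => i.
  exact: segment_compact.
have [c [_ cl]] : [set f : X | forall i, `[- K, K]%classic (f i)]
    `&` cluster (S n @[n --> \oo]) !=set0.
  apply: (cK (S n @[n --> \oo])).
  exists 0%N => // n _ i.
  by have := sK n i.1 i.2; rewrite ler_norml /= in_itv.
have near_c (l : seq (bool * R)) (e : R) : 0 < e ->
    nbhs (c : X) [set f : X | forall i, i \in l -> `|f i - c i| < e].
  move=> e0; elim: l => [|i l IH]; first by apply: filterS (@filterT _ _ _).
  have : nbhs (c : X) [set f : X | `|f i - c i| < e].
    have := @proj_continuous _ T i c.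
    move=> /(_ [set y : R | `|y - c i| < e]); apply.
    by exists e => // y /=; rewrite distrC.
  move=> H; apply: filterS (filterI H IH) => f [/= fi Hf] j.
  by rewrite inE => /orP[/eqP ->//|]; exact: Hf.
have pick (l : seq (bool * R)) (e : R) N : 0 < e ->
    exists2 n, (N <= n)%N & forall i, i \in l -> `|s n i.1 i.2 - c i| < e.
  move=> e0; have [] := cl [set f : X | exists2 n, (N <= n)%N & f = S n] _ _ (near_c l e e0).
    by exists N => // n Nn; exists n.
  by move=> f [[n Nn ->] Hf]; exists n.
exists (fun b x => c (b, x)) => e N e0.
have e4 : 0 < e / 4 by rewrite divr_gt0.
have [d d0 sd] := sE _ e4.
have [B [N' sB]] := sT _ e4.
have cd b x y : `|x - y| <= d -> `|c (b, x) - c (b, y)| <= e / 2.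
  move=> xy; have e8 : 0 < e / 8 by rewrite divr_gt0.
  have [n _ Hn] := pick [:: (b, x); (b, y)] (e / 8) 0%N e8.
  have H1 := Hn (b, x) (mem_head _ _).
  have H2 : `|s n b y - c (b, y)| < e / 8 by apply: (Hn (b, y)); rewrite !inE eqxx orbT.
  exact: norm_close4 H1 H2 (sd n b x y xy).
have cB b x : B <= `|x| -> `|c (b, x)| <= e / 2.
  move=> Bx; have [n Nn Hn] := pick [:: (b, x)] (e / 4) N' e4.
  have H1 := Hn (b, x) (mem_head _ _); have H2 := sB n b x Nn Bx.
  rewrite (_ : e / 2 = e / 4 + e / 4); last by field.
  rewrite -(subKr (s n b x) (c (b, x))); apply: (le_trans (ler_normB _ _)).
  exact: lerD H2 (ltW H1).
(* A neighbourhood in the product controls finitely many coordinates only; the points - |B| + d i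
   with i <= m form a grid of mesh d covering [- |B|, |B|]. *)
pose m := (Num.truncn (2 * `|B| / d)).+1.
pose g i : R := - `|B| + d * i%:R.
pose l := [seq (b, g i) | b <- [:: true; false], i <- iota 0 m.+1].
have [n Nn Hn] := pick l (e / 4) (maxn N N') e4.
have [Nn1 Nn2] : (N <= n)%N /\ (N' <= n)%N.
  by apply/andP; rewrite -geq_max.
exists n => // b x.
have [Bx|xB] := leP B `|x|.
  have H1 := sB n b x Nn2 Bx; have H2 := cB b x Bx.
  apply: (le_trans (ler_normB _ _)); apply: (le_trans (lerD H1 H2)).
  by rewrite -mulrDr ler_piMr ?(ltW e0)//; lra.
have xB' : `|x| < `|B| by rewrite (lt_le_trans xB)// ler_norm.
have t0 : 0 <= (x + `|B|) / d.
  by rewrite divr_ge0 ?(ltW d0)//; move: xB'; rewrite ltr_norml => /andP[? _]; lra.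
pose i := Num.truncn ((x + `|B|) / d).
have /andP[i1 i2] : i%:R <= (x + `|B|) / d < i.+1%:R.
  by apply/andP; split; [rewrite truncn_le//|rewrite truncnS_gt].
have im : (i < m.+1)%N.
  rewrite ltnS; apply: ltnW; rewrite -(ltr_nat R); apply: (le_lt_trans i1).
  rewrite /m; apply: le_lt_trans (truncnS_gt _).
  by rewrite ler_pM2r ?invr_gt0//; move: xB'; rewrite ltr_norml => /andP[_ ?]; lra.
have xg : `|x - g i| <= d.
  rewrite /g; move: i1 i2; rewrite ler_pdivlMr// ltr_pdivrMr// -addn1 natrD mulrDl mul1r.
  by rewrite (mulrC _ d) => ? ?; rewrite ler_norml; apply/andP; split; lra.
have gl : (b, g i) \in l.
  apply/allpairsP; exists (b, i); split; [by case: (b); rewrite !inE| |by []].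
  by rewrite mem_iota.
have H1 := Hn _ gl; have H2 := sd n b x (g i) xg.
apply: (norm_close3 H2 (ltW H1)); rewrite distrC; exact: cd.
Qed.

End sequential_limits.

(** * Completeness of L^2 along rapidly converging sequences *)

Section L2_completeness.
Variable R : realType.
Local Notation mu := (@lebesgue_measure R).
Implicit Types (f g h : R -> R).

Variable f : nat -> R -> R.
Hypothesis Lf : forall n, L2 (f n).
Hypothesis f_fast : forall n,
  Rint (fun x => (f n.+1 x - f n x) ^+ 2) <= (4^-1) ^+ n.

(* [|f_l - f_k|^2 <= 2^(1-k) S] for [k <= l], and [S] is integrable. *)
Let S (x : R) : \bar R := (\sum_(n <oo) (2 ^+ n * (f n.+1 x - f n x) ^+ 2)%:E)%E.

Let term_ge0 n x : (0 <= (2 ^+ n * (f n.+1 x - f n x) ^+ 2)%:E)%E.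
Proof. by rewrite lee_fin mulr_ge0 ?sqr_ge0 ?exprn_ge0. Qed.

Let Ld n : L2 (fun x => f n.+1 x - f n x).
Proof. exact: L2B. Qed.

Let mterm n : measurable_fun setT (fun x => (2 ^+ n * (f n.+1 x - f n x) ^+ 2)%:E).
Proof.
apply/measurable_EFinP; apply: measurable_funM => //.
by apply: measurable_funX; exact: (Ld n).1.
Qed.

Let mS : measurable_fun setT S.
Proof. by apply: (@ge0_emeasurable_sum _ _ _ _ _ xpredT) => // n x _ _; exact: term_ge0. Qed.

Let intS : (\int[mu]_x S x <= 2%:E)%E.
Proof.
rewrite integral_nneseries//.
apply: lime_le.
  by apply: is_cvg_nneseries => n _ _; apply: integral_ge0 => x _; exact: term_ge0.
apply: nearW => n.
(* The weight 2^i against the rate 4^(-i) leaves 2^(-i), whose partial sums stay below 2. *)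
apply: (@le_trans _ _ (\sum_(0 <= i < n) ((2^-1) ^+ i)%:E)%E).
  apply: lee_sum => i _.
  have Ii : Ig setT (fun x => 2 ^+ i * (f i.+1 x - f i x) ^+ 2).
    by apply: IgZ => //; exact: (Ld i).2.
  rewrite (EFin_Rint Ii) lee_fin RintZ; last exact: (Ld i).2.
  have -> : (2^-1) ^+ i = 2 ^+ i * (4^-1) ^+ i :> R.
    by rewrite -exprMn; congr (_ ^+ _); field.
  by rewrite ler_wpM2l ?exprn_ge0.
rewrite sumEFin lee_fin.
have : \sum_(0 <= i < n) (2^-1) ^+ i = 2 - 2 * (2^-1) ^+ n :> R.
  elim: n => [|n IH]; first by rewrite big_nil expr0; ring.
  by rewrite big_nat_recr//= IH exprS; field.
by move=> ->; rewrite gerBl mulr_ge0// exprn_ge0// invr_ge0.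
Qed.

Let S_ge0 x : (0 <= S x)%E.
Proof. by apply: nneseries_ge0 => n _ _; exact: term_ge0. Qed.

Let IS : mu.-integrable setT S.
Proof.
apply/integrableP; split => //.
under eq_integral do rewrite gee0_abs//.
by rewrite (le_lt_trans intS)// ltry.
Qed.

Let A : set R := [set x | S x \is a fin_num].

Let mA : measurable A.
Proof. by have := emeasurable_fin_num measurableT mS; rewrite setTI. Qed.

Let Sf x : R := fine (S x).

(** The first increment is peeled off by (a + b)^2 <= 2 a^2 + 2 b^2; repeating this accumulates
    factors 2, which the weights 2^n in [S] absorb. *)
Let Sf_bound x k j : A x ->
  (f (k + j)%N x - f k x) ^+ 2 <= 2 * (2^-1) ^+ k * Sf x.
Proof.
move=> Ax.
have H m : \sum_(0 <= i < m) (2 ^+ i * (f i.+1 x - f i x) ^+ 2) <= Sf x.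
  rewrite -lee_fin fineK// -sumEFin; apply: nneseries_lim_ge => n _ _.
  exact: term_ge0.
suff K : (f (k + j)%N x - f k x) ^+ 2 <=
    2 * (2^-1) ^+ k * \sum_(k <= i < k + j) (2 ^+ i * (f i.+1 x - f i x) ^+ 2).
  apply: (le_trans K); apply: ler_wpM2l; first by rewrite mulr_ge0// exprn_ge0// invr_ge0.
  apply: le_trans (H (k + j)%N).
  rewrite (@big_cat_nat _ _ _ k 0 (k + j))//= ?leq_addr// lerDr.
  by apply: sumr_ge0 => i _; rewrite mulr_ge0 ?sqr_ge0 ?exprn_ge0.
elim: j k => [|j IH] k.
  by rewrite addn0 subrr big_geq// mulr0 expr0n.
rewrite addnS -addSn big_ltn ?ltn_addr//.
have := IH k.+1; set T := \sum_(k.+1 <= i < _) _.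
set a := f (k.+1 + j)%N x; set b := f k.+1 x; set c := f k x.
move=> IHk; rewrite mulrDr -mulrA (mulrA ((2^-1) ^+ k)) -exprMn mulVf// expr1n mul1r.
have {IHk} : (a - b) ^+ 2 <= (2^-1) ^+ k * T.
  by apply: (le_trans IHk); rewrite exprS mulrA divff// mul1r.
move: (sqr_ge0 (a - b - (b - c))); set t := (2^-1) ^+ k * T.
rewrite -[2 * _ * T]mulrA -/t; nra.
Qed.

Let cauchy_f x : A x -> exists l : R, f n x @[n --> \oo] --> l.
Proof.
move=> Ax; apply: cauchy_cvg_seq => e e0.
pose b := 2 * Sf x.
have H : (fun k => b * (2^-1) ^+ k) @ \oo --> b * 0.
  by apply: cvgMr; apply: cvg_expr; rewrite ger0_norm ?invr_ge0// invf_lt1// ltr1n.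
move: H; rewrite mulr0 => /cvg_eps_N /(_ ((e / 2) ^+ 2)).
have e2 : 0 < e / 2 by rewrite divr_gt0.
rewrite exprn_gt0// => /(_ isT)[N HN].
have HN' n : (N <= n)%N -> `|f n x - f N x| < e / 2.
  move=> Nn; have := HN N (leqnn _); rewrite subr0.
  have := Sf_bound N (n - N) Ax; rewrite subnKC// => H1 H2.
  rewrite -(@ltr_pXn2r _ 2)// ?nnegrE ?(ltW e2)// real_normK ?num_real//.
  apply: (le_lt_trans H1); apply: le_lt_trans H2.
  by apply: le_trans (ler_norm _); rewrite /b mulrAC.
exists N => m n Nm Nn; have := HN' m Nm; have := HN' n Nn.
by rewrite !ltr_norml => /andP[? ?] /andP[? ?]; apply/andP; split; lra.
Qed.

Lemma L2_complete : exists g,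
  [/\ L2 g, {ae mu, forall x, f n x @[n --> \oo] --> g x} &
      forall n, Rint (fun x => (g x - f n x) ^+ 2) <= 4 * (2^-1) ^+ n].
Proof.
have aeA : {ae mu, forall x, A x}.
  have := integrable_ae measurableT IS.
  by apply: ae_imp => x /(_ Logic.I).
(* With the factor 1_A the sequence converges everywhere, so [g] is a pointwise limit of measurable
   functions. *)
pose g x := limn (fun n => f n x * \1_A x).
have cvg_g x : (fun n => f n x * \1_A x) @ \oo --> g x.
  have [Ax|Ax] := pselect (A x).
    have [l Hl] := cauchy_f Ax; rewrite /g.
    have -> : (fun n => f n x * \1_A x) = (fun n => f n x).
      by apply/funext => n; rewrite indicE mem_set// mulr1.
    by apply: (cvgP l).
  rewrite /g; have -> : (fun n => f n x * \1_A x) = (fun=> 0).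
    by apply/funext => n; rewrite indicE memNset// mulr0.
  by apply: (cvgP 0); exact: cvg_cst.
have gA x : A x -> f n x @[n --> \oo] --> g x.
  move=> Ax; have := cvg_g x.
  by rewrite (_ : (fun n => f n x * \1_A x) = (fun n => f n x))//;
    apply/funext => n; rewrite indicE mem_set// mulr1.
have mg : measurable_fun setT g.
  apply: (@measurable_fun_cvg _ _ _ setT (fun n x => f n x * \1_A x)) => [n|x _].
    by apply: measurable_funM; [exact: (Lf n).1|exact: measurable_indic].
  exact: cvg_g.
have g_bound k x : A x -> (g x - f k x) ^+ 2 <= 2 * (2^-1) ^+ k * Sf x.
  move=> Ax; have : (fun j => (f (k + j)%N x - f k x) ^+ 2) @ \oo --> (g x - f k x) ^+ 2.
    have : (fun j => f (k + j)%N x - f k x) @ \oo --> g x - f k x.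
      apply: cvgB; last exact: cvg_cst.
      apply/cvg_eps_N => e e0; have /cvg_eps_N /(_ e e0)[N HN] := gA x Ax.
      by exists N => n Nn; apply: HN; rewrite (leq_trans Nn)// leq_addl.
    by move=> H; exact: (cvgM H H).
  move=> H; rewrite -(cvg_lim _ H)//; apply: limr_le; first exact: cvgP H.
  by apply: nearW => j; exact: Sf_bound.
have mSf : measurable_fun setT Sf by exact: measurableT_comp.
have Sf_le x : ((Sf x)%:E <= S x)%E.
  by rewrite /Sf; have := S_ge0 x; case: (S x) => [r| |] //= _; rewrite leey.
have Sf_ge0 x : 0 <= Sf x by exact: fine_ge0.
have ISf : Ig setT Sf.
  apply: le_integrable IS => //; first exact/measurable_EFinP.
  by move=> x _; rewrite (gee0_abs (S_ge0 x)) /= ger0_norm//.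
have RSf : Rint Sf <= 2.
  rewrite -lee_fin -EFin_Rint//; apply: le_trans intS.
  apply: ge0_le_integral => //; first by move=> x _; rewrite lee_fin.
  exact/measurable_EFinP.
have mgk k : measurable_fun setT (fun x => (g x - f k x) ^+ 2).
  by apply: measurable_funX; apply: measurable_funB => //; exact: (Lf k).1.
have Ibk k : Ig setT (fun x => 2 * (2^-1) ^+ k * Sf x) by exact: IgZ.
have Igk k : Ig setT (fun x => (g x - f k x) ^+ 2).
  have : Ig setT (fun x => (g x - f k x) ^+ 2 * \1_A x).
    apply: (Ig_le _ _ _ (Ibk k)) => //.
      by apply: measurable_funM => //; exact: measurable_indic.
    move=> x _; rewrite normrM (ger0_norm (sqr_ge0 _)).
    rewrite indicE; have [Ax|Ax] := pselect (A x).
      by rewrite mem_set// normr1 mulr1; exact: g_bound.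
    by rewrite memNset// normr0 mulr0 !mulr_ge0// exprn_ge0// invr_ge0.
  apply: Ig_ae => //; apply: ae_imp aeA => x Ax.
  by rewrite indicE mem_set// mulr1.
exists g; split.
- have : L2 (fun x => (g x - f 0%N x) + f 0%N x).
    by apply: L2D => //; split => //; apply: measurable_funB => //; exact: (Lf 0).1.
  by congr L2; apply/funext => x; rewrite subrK.
- by apply: ae_imp aeA => x Ax; exact: gA.
- move=> k; have -> : 4 * (2^-1) ^+ k = 2 * (2^-1) ^+ k * 2 :> R by ring.
  apply: (@le_trans _ _ (Rint (fun x => 2 * (2^-1) ^+ k * Sf x))); last first.
    by rewrite RintZ// ler_wpM2l// mulr_ge0// exprn_ge0// invr_ge0.
  rewrite (@Rint_ae _ _ (fun x => (g x - f k x) ^+ 2 * \1_A x)) => //.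
  + apply: le_Rint => //.
      apply: (Ig_le _ _ _ (Igk k)) => //.
        by apply: measurable_funM => //; exact: measurable_indic.
      move=> x _; rewrite normrM (ger0_norm (sqr_ge0 _)) ler_piMr ?sqr_ge0//.
      by rewrite indicE; case: (x \in A); rewrite ?normr1 ?normr0.
    move=> x; rewrite indicE; have [Ax|Ax] := pselect (A x).
      by rewrite mem_set// mulr1; exact: g_bound.
    by rewrite memNset// mulr0 !mulr_ge0// exprn_ge0// invr_ge0.
  + by apply: measurable_funM => //; exact: measurable_indic.
  + apply: ae_imp aeA => x Ax; rewrite indicE mem_set// mulr1//.
Qed.

End L2_completeness.

Section L2_completeness_pointwise.
Variable R : realType.
Local Notation mu := (@lebesgue_measure R).

(** Identifies the L^2 limit with a limit known beforehand, here the uniform cluster point; the two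
    agree a.e. because the sequence also converges a.e. to the former. *)
Lemma L2_complete_pointwise (f : nat -> R -> R) (g : R -> R) :
  (forall n, L2 (f n)) ->
  (forall n, Rint (fun x => (f n.+1 x - f n x) ^+ 2) <= (4^-1) ^+ n) ->
  (forall x, f n x @[n --> \oo] --> g x) ->
  L2 g /\ forall n, Rint (fun x => (g x - f n x) ^+ 2) <= 4 * (2^-1) ^+ n.
Proof.
move=> Lf ffast fg; have [h [Lh fh Hh]] := L2_complete Lf ffast.
have mg : measurable_fun setT g.
  by apply: (@measurable_fun_cvg _ _ _ setT f) => // n; exact: (Lf n).1.
have hg : {ae mu, forall x, h x = g x}.
  by apply: ae_imp fh => x fhx; exact: cvg_unique fhx (fg x).
split; first exact: L2_ae hg Lh.
move=> n; rewrite -(@Rint_ae _ (fun x => (h x - f n x) ^+ 2))//.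
- by apply: measurable_funX; apply: measurable_funB; [exact: Lh.1|exact: (Lf n).1].
- by apply: measurable_funX; apply: measurable_funB => //; exact: (Lf n).1.
- by apply: ae_imp hg => x ->.
Qed.

End L2_completeness_pointwise.

(** * Compactness of almost minimizers *)

Section existence.
Variable R : realType.
Local Notation mu := (@lebesgue_measure R).
Variables a0 b0 : R.
Hypotheses (a0_gt0 : 0 < a0) (b0_gt0 : 0 < b0).
Variables lam M : R.
Hypotheses (lam_gt0 : 0 < lam) (M_gt0 : 0 < M).

Local Notation state := (state R).
Local Notation En := (En a0 b0).
Implicit Types (u v w z : state) (s t x y e c d : R) (n k N : nat).

Hypothesis HM : forall u, h2 u -> Jn u = lam -> M <= En u.

Let En_hom u (hu : h2 u) := En_homogeneous a0_gt0 b0_gt0 lam_gt0 M_gt0 HM hu.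

Ltac light_lra := clear - a0_gt0 b0_gt0 lam_gt0 M_gt0 HM; lra.

Lemma norm_le_sqr x y : 0 <= y -> x ^+ 2 <= y ^+ 2 -> `|x| <= y.
Proof.
move=> y0; rewrite -(@real_normK _ x) ?num_real//.
by rewrite ler_pXn2r// nnegrE.
Qed.

Lemma le_harmonic (a b c : R) : (forall k, a <= b + c / k.+1%:R) -> a <= b.
Proof.
move=> H; rewrite leNgt; apply/negP => ba.
have ab0 : 0 < a - b by rewrite subr_gt0.
have c0 : 0 < c by have := H 0%N; rewrite divr1; lra.
pose k := Num.truncn (c / (a - b)).
have := truncnS_gt (c / (a - b)); rewrite -/k ltr_pdivrMr// => Hk.
have := H k; rewrite -lerBlDl ler_pdivlMr ?ltr0n//.
by rewrite mulrC leNgt Hk.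
Qed.

Lemma half_power_le k : (2^-1 : R) ^+ k <= k.+1%:R^-1.
Proof.
rewrite exprVn lef_pV2 ?posrE ?exprn_gt0 ?ltr0n//.
by rewrite -natrX ler_nat ltn_expl.
Qed.

(* Parallelogram law: the midpoint of two nearby almost minimizers is almost
   admissible, so its energy is almost at least [M]. *)
Lemma almost_minimizers_close e : 0 < e -> exists2 d : R, 0 < d &
  forall u v, h2 u -> h2 v -> En u <= M + d -> En v <= M + d -> lam - d <= Jn u ->
    (forall x, `|sF u x - sF v x| <= d) -> (forall x, `|sG u x - sG v x| <= d) ->
    En (comb 1 u (-1) v) <= e.
Proof.
move=> e0; pose t := Num.min (e / 8) (M / 2) / M.
have t0 : 0 < t by rewrite divr_gt0// lt_min !divr_gt0.
have tM : t * M = Num.min (e / 8) (M / 2) by rewrite /t divfK ?gt_eqF.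
have te : t * M <= e / 8 by rewrite tM ge_min lexx.
have t2 : t <= 2^-1.
  by rewrite /t ler_pdivrMr// ge_min; apply/orP; right; rewrite mulrC.
pose kap := a0^-1 + b0^-1.
have kap0 : 0 < kap by rewrite addr_gt0 ?invr_gt0.
(* Chosen so that the midpoint has [Jn m >= lam - d * L]: the 1 is the defect of [Jn u], the rest
   comes from [Jn_dist] at energies at most M + 1. *)
pose L := 1 + 2 * kap * (M + 1).
have L0 : 0 < L by rewrite addr_gt0// !mulr_gt0// addr_gt0.
pose d := Num.min (Num.min 1 (e / 8)) (lam * (t / 2) / L).
have d0 : 0 < d by rewrite !lt_min ltr01 !divr_gt0// mulr_gt0// divr_gt0.
have [d1 [de dL]] : d <= 1 /\ (d <= e / 8 /\ d * L <= lam * (t / 2)).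
  split; [|split]; rewrite /d ?ge_min ?lexx ?orbT//.
  by rewrite -ler_pdivlMr// ge_min lexx orbT.
exists d => // u v hu hv Eu Ev Ju HF HG.
have hm := h2_comb 2^-1 2^-1 hu hv; set m := comb _ _ _ _ in hm.
have := En_parallelogram a0 b0 hu hv; rewrite -/m => par.
have Em0 := En_ge0 a0_gt0 b0_gt0 m.
have Ed0 := En_ge0 a0_gt0 b0_gt0 (comb 1 u (-1) v).
have Em : En m <= M + d by move: par Eu Ev Ed0; light_lra.
(* The parallelogram law then bounds the energy of the difference by 4 d + 4 t M, and each of d and
   t M is at most e / 8. *)
suff : M - t * M <= En m by move: par Eu Ev de te; light_lra.
rewrite leNgt; apply/negP => Hm.
have close (f g : R) : `|f - g| <= d -> `|2^-1 * f + 2^-1 * g - f| <= d / 2.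
  move=> H; have -> : 2^-1 * f + 2^-1 * g - f = - (2^-1 * (f - g)) by field.
  by rewrite normrN normrM ger0_norm ?invr_ge0// mulrC ler_pM2r ?invr_gt0.
have := Jn_dist a0_gt0 b0_gt0 hm hu (fun x => close _ _ (HF x)) (fun x => close _ _ (HG x)).
rewrite -/kap (_ : 2 * (d / 2) = d); last by rewrite mulrC divfK.
move=> HJ.
have HJ2 : `|Jn m - Jn u| <= d * kap * (2 * (M + 1)).
  apply: (le_trans HJ); rewrite ler_wpM2l//; first by rewrite mulr_ge0// ltW.
  by move: Em Eu d1; light_lra.
have HJ3 : lam * (1 - t / 2) <= Jn m.
  move: HJ2 Ju dL; rewrite ler_norml /L => /andP[]; light_lra.
have := En_hom hm.
have lt0 : 0 < lam * (1 - t / 2) by rewrite mulr_gt0//; move: t2; light_lra.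
have H1 : (lam * (1 - t / 2)) ^+ 2 <= Jn m ^+ 2.
  by rewrite lerXn2r// nnegrE ?(ltW lt0)// (le_trans (ltW lt0)).
have H2 : En m ^+ 3 <= (M * (1 - t)) ^+ 3.
  rewrite lerXn2r// ?nnegrE//; first by rewrite mulr_ge0 ?(ltW M_gt0)//; move: t2; light_lra.
  by move: Hm; light_lra.
rewrite leNgt => /negP; apply.
(* If [En m < M (1 - t)], homogeneity would give (1 - t/2)^2 <= (1 - t)^3, whereas (1 - t)^3 <= (1 -
   t)^2 < (1 - t/2)^2. *)
apply: (@le_lt_trans _ _ (lam ^+ 2 * (M * (1 - t)) ^+ 3)).
  by rewrite ler_wpM2l ?sqr_ge0.
apply: (@lt_le_trans _ _ (M ^+ 3 * (lam * (1 - t / 2)) ^+ 2)); last first.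
  by rewrite ler_wpM2l// exprn_ge0// ltW.
rewrite !exprMn mulrCA ltr_pM2l ?exprn_gt0// ltr_pM2l ?exprn_gt0//.
have H4 : (1 - t) ^+ 3 <= (1 - t) ^+ 2.
  by rewrite exprS ler_piMl ?sqr_ge0//; move: t0; light_lra.
apply: (le_lt_trans H4); rewrite ltrXn2r//; move: t0 t2; light_lra.
Qed.

(** Two tents at distance at least 1 do not interfere at their centres, and the energy of such an
    interpolation is controlled by the squares of the prescribed values. *)
Lemma exists_tent_pair a b (fa fb ga gb eta : R) : 1 <= b - a ->
  fa ^+ 2 + ga ^+ 2 <= eta -> fb ^+ 2 + gb ^+ 2 <= eta ->
  exists z, [/\ h2 z, [/\ sF z a = fa, sF z b = fb, sG z a = ga & sG z b = gb]
    & En z <= 8 * (1 + a0 + b0) * eta].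
Proof.
move=> ab Ha Hb.
pose z := State (fun x => fa * tent a x + fb * tent b x)
  (fun x => fa * dtent a x + fb * dtent b x)
  (fun x => ga * tent a x + gb * tent b x)
  (fun x => ga * dtent a x + gb * dtent b x).
have Tab : tent a b = 0 by apply: tent_far; rewrite ger0_norm//; move: ab; light_lra.
have Tba : tent b a = 0 by apply: tent_far; rewrite distrC ger0_norm//; move: ab; light_lra.
have hz : h2 z by split; apply: h1D; apply: h1Z; exact: h1_tent.
exists z; split => //=.
  by rewrite !tent_center Tab Tba !mulr0 !mulr1 !addr0 !add0r.
have sq_le2 (s t : R) f g : L2 f -> L2 g -> sq f <= 2 -> sq g <= 2 ->
    sq (fun x => s * f x + t * g x) <= 4 * (s ^+ 2 + t ^+ 2).
  move=> Lf Lg f2 g2.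
  have := sq_ge0 (fun x => s * f x + (- t) * g x).
  rewrite !sq_comb// => H.
  have H1 := ler_wpM2l (sqr_ge0 s) f2; have H2 := ler_wpM2l (sqr_ge0 t) g2.
  by move: H H1 H2; light_lra.
have L (r : R) := h1_tent r.
have Lt (r : R) : L2 (tent r) by case: (L r).
have Ld (r : R) : L2 (dtent r) by case: (L r).
have T2 (r : R) : sq (tent r) <= 2 := Rint_tent2 r.
have D2 (r : R) : sq (dtent r) <= 2 := Rint_dtent2 r.
have E1 := sq_le2 fa fb _ _ (Lt a) (Lt b) (T2 a) (T2 b).
have E2 := sq_le2 fa fb _ _ (Ld a) (Ld b) (D2 a) (D2 b).
have E3 := sq_le2 ga gb _ _ (Lt a) (Lt b) (T2 a) (T2 b).
have E4 := sq_le2 ga gb _ _ (Ld a) (Ld b) (D2 a) (D2 b).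
rewrite EnE /=.
have F1 := ler_wpM2l (ltW a0_gt0) E1; have F3 := ler_wpM2l (ltW b0_gt0) E3.
have G0 := sqr_ge0 fa; have G1 := sqr_ge0 fb; have G2 := sqr_ge0 ga; have G3 := sqr_ge0 gb.
have K1 : 4 * (fa ^+ 2 + fb ^+ 2) + 4 * (ga ^+ 2 + gb ^+ 2) <= 8 * eta by move: Ha Hb; light_lra.
have K2 : a0 * (4 * (fa ^+ 2 + fb ^+ 2)) <= a0 * (8 * eta) by rewrite ler_wpM2l ?(ltW a0_gt0)//; move: K1 G2 G3; light_lra.
have K3 : b0 * (4 * (ga ^+ 2 + gb ^+ 2)) <= b0 * (8 * eta) by rewrite ler_wpM2l ?(ltW b0_gt0)//; move: K1 G0 G1; light_lra.
have -> : 8 * (1 + a0 + b0) * eta = 8 * eta + a0 * (8 * eta) + b0 * (8 * eta) by ring.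
by move: E2 E4 F1 F3 K1 K2 K3; light_lra.
Qed.

(** Exchanging u with a negligible z between cutting points a < 0 < b yields v, equal to u on
    [a, b], and w, equal to u outside. As v keeps the value at 0, its energy is at least c / ks, so
    [dichotomy] leaves little energy to w, and the sup bound applied to w bounds u far out. *)
Lemma tightness c e : 0 < c -> 0 < e -> exists B d : R, [/\ 0 < B, 0 < d &
  forall u, h2 u -> En u <= M + d -> lam - d <= Jn u -> c <= sG u 0 ^+ 2 ->
    forall x, B <= `|x| -> sF u x ^+ 2 <= e /\ sG u x ^+ 2 <= e].
Proof.
move=> c0 e0.
have ks0 := ksup_gt0 a0_gt0 b0_gt0; have kJ0 := kJ_gt0 a0_gt0 b0_gt0.
set ks := ksup a0 b0 in ks0; set kJ := kJ a0 b0 in kJ0.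
have [d d0 Hd] := dichotomy M_gt0 lam_gt0 (divr_gt0 c0 ks0) (divr_gt0 e0 ks0).
pose d1 := Num.min (d / 2) 1.
have d10 : 0 < d1 by rewrite lt_min divr_gt0//= ltr01.
have [d1d d11] : d1 <= d / 2 /\ d1 <= 1 by split; rewrite ge_min lexx ?orbT.
(* an energy bound making the auxiliary pair [z] below negligible *)
pose ez := Num.min d1 (d1 ^+ 2 / kJ).
have ez0 : 0 < ez by rewrite lt_min d10 divr_gt0// exprn_gt0.
pose K := 8 * (1 + a0 + b0).
have K0 : 0 < K by rewrite mulr_gt0// !addr_gt0.
pose eta := ez / K.
have eta0 : 0 < eta by rewrite divr_gt0.
pose C := (a0^-1 + b0^-1) * (M + 1).
have C0 : 0 < C by rewrite mulr_gt0 ?addr_gt0// invr_gt0.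
(* Makes C < eta B, so that every interval of length B contains a point where f^2 + g^2 <= eta. *)
pose B := C / eta + 1.
have B1 : 1 < B by rewrite ltrDr divr_gt0.
have CB : C < eta * B by rewrite /B mulrDr mulr1 mulrC divfK ?gt_eqF// ltrDl.
exists (2 * B + 1), d1; split => //; first by move: B1; light_lra.
move=> u hu Eu Ju u0.
have Eu1 : En u <= M + 1 by apply: (le_trans Eu); rewrite lerD2l.
have [LF _ LG _] := h2_L2 hu; have [_ _ sqF sqG] := sq_le a0_gt0 b0_gt0 u.
pose h x := sF u x ^+ 2 + sG u x ^+ 2.
have h0 x : 0 <= h x by rewrite addr_ge0 ?sqr_ge0.
have Ih : Ig setT h by apply: IgD => //; [exact: LF.2|exact: LG.2].
have hC : Rint h <= C.
  rewrite RintD//; [|exact: LF.2|exact: LG.2].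
  rewrite -!/(sq _) /C mulrDl; apply: lerD; [apply: (le_trans sqF)|apply: (le_trans sqG)];
    by rewrite ler_wpM2l// invr_ge0 ltW.
have B0 : 0 <= B by rewrite (le_trans ler01)// ltW.
have [b /andP[b1 b2] hb] := exists_small_value B Ih h0 hC CB B0.
have [a /andP[a1 a2] ha] := exists_small_value (- (2 * B)) Ih h0 hC CB B0.
have ab : 1 <= b - a by move: b1 a2 B1; light_lra.
have [z [hz [za zb za' zb'] Ez]] := exists_tent_pair ab ha hb.
have Ez' : En z <= ez by apply: (le_trans Ez); rewrite -/K /eta mulrC divfK ?gt_eqF.
have [Ezd EzJ] : En z <= d1 /\ kJ * En z <= d1 ^+ 2.
  split; first by apply: (le_trans Ez'); rewrite ge_min lexx.
  rewrite mulrC -ler_pdivlMr//; apply: (le_trans Ez').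
  by rewrite ge_min lexx orbT.
have Ez0 := En_ge0 a0_gt0 b0_gt0 z.
(* The constraint of z may be negative, so a lower bound is needed; since [En z <= 1], its square is
   at most [kJ * En z <= d1 ^+ 2]. *)
have Jz : - d1 <= Jn z.
  have H : Jn z ^+ 2 <= d1 ^+ 2.
    apply: (le_trans (Jn_sq_le a0_gt0 b0_gt0 hz)); apply: le_trans EzJ.
    by rewrite -/kJ ler_pM2l// exprS ler_piMr// exprn_ile1// (le_trans Ezd d11).
  have := norm_le_sqrt H; rewrite sqrtr_sqr (ger0_norm (ltW d10)) ler_norml.
  by case/andP.
have ab' : a < b by move: ab; light_lra.
have hv : h2 (sswap a b u z) by exact: h2_swap.
have hw : h2 (sswap a b z u) by exact: h2_swap.
have EE := En_swap a0 b0 hu hz hv hw; have JJ := Jn_swap a0_gt0 b0_gt0 hu hz hv hw.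
set v := sswap a b u z in hv EE JJ; set w := sswap a b z u in hw EE JJ.
(* Since a <= - B < 0 < B <= b, the origin lies in the part that v takes from u. *)
have v0 : sG v 0 = sG u 0.
  by rewrite /v /= /swap ifF ?ifT//; [exact: le_trans B0 b1|apply/negbTE; rewrite -ltNge; move: a2 B1; light_lra].
have Ev : c / ks <= En v.
  rewrite ler_pdivrMr// mulrC; apply: (le_trans u0); rewrite -v0.
  by have [] := h2_sup a0_gt0 b0_gt0 0 hv.
have Ew : En w <= e / ks.
  have EE' : En v + En w <= M + d by rewrite EE; move: Eu Ezd d1d; light_lra.
  have JJ' : lam - d <= Jn v + Jn w by rewrite JJ; move: Ju Jz d1d; light_lra.
  exact: (Hd _ _ _ _ Ev (En_ge0 a0_gt0 b0_gt0 w) EE' JJ' (En_hom hv) (En_hom hw)).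
move=> x xB.
have xab : (x <= a) || ((x <= a) == false) && ((x <= b) == false).
  move: xB; rewrite ler_normr => /orP[xB|xB].
    by apply/orP; right; apply/andP; split; rewrite eqbF_neg -ltNge; move: xB a2 b2 B1; light_lra.
  by apply/orP; left; move: xB a1; light_lra.
have [wF wG] : sF w x = sF u x /\ sG w x = sG u x.
  by rewrite /w /= /swap; case/orP: xab => [->|/andP[/eqP -> /eqP ->]].
have [HF HG] := h2_sup a0_gt0 b0_gt0 x hw.
rewrite -wF -wG; have H : ks * En w <= e by rewrite mulrC -ler_pdivlMr.
by split; [exact: le_trans HF H|exact: le_trans HG H].
Qed.

Lemma cvg_sq_harmonic (a : nat -> R) l c :
  (forall k, (a k - l) ^+ 2 <= c / k.+1%:R) -> a k @[k --> \oo] --> l.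
Proof.
move=> H; apply/cvg_eps_N => e e0.
pose N := Num.truncn (c / e ^+ 2); exists N => n Nn.
rewrite -(@ltr_pXn2r _ 2)// ?nnegrE ?(ltW e0)// real_normK ?num_real//.
apply: (le_lt_trans (H n)); rewrite ltr_pdivrMr ?ltr0n// mulrC.
rewrite -ltr_pdivrMr ?exprn_gt0//; apply: (lt_le_trans (truncnS_gt _)).
by rewrite ler_nat.
Qed.

(** By Cauchy-Schwarz on [x, y], L^2 convergence of the derivatives implies convergence of their
    integrals, and uniqueness of the limit gives the identity. *)
Lemma AC_limit (F : nat -> R -> R) (p : nat -> R -> R) G q c :
  (forall k, AC (F k) (p k)) -> (forall k, L2 (p k)) -> L2 q ->
  (forall x, F k x @[k --> \oo] --> G x) ->
  (forall k, sq (fun x => q x - p k x) <= c / k.+1%:R) -> AC G q.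
Proof.
move=> AF Lp Lq FG pq; split; first exact: L2_loc1.
move=> x y xy; have I1 k : Ig `[x, y]%classic (p k) by exact: L2_Ig_itv.
have I2 : Ig `[x, y]%classic q by exact: L2_Ig_itv.
have H1 : \int[mu]_(t in `[x, y]) p k t @[k --> \oo] --> \int[mu]_(t in `[x, y]) q t.
  apply: (@cvg_sq_harmonic _ _ ((y - x) * c)) => k.
  have Ld : L2 (fun t => q t - p k t) by exact: L2B.
  rewrite -sqrrN opprB -RintegralB//; last exact: I1.
  apply: (le_trans (cauchy_schwarz_itv xy Ld)); rewrite -mulrA ler_wpM2l ?subr_ge0//.
  apply: le_trans (pq k); apply: le_int_itv; first exact: Ld.2.
  by move=> t; exact: sqr_ge0.
have H2 : \int[mu]_(t in `[x, y]) p k t @[k --> \oo] --> G y - G x.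
  have -> : (fun k => \int[mu]_(t in `[x, y]) p k t) = (fun k => F k y - F k x).
    by apply/funext => k; rewrite (AF k).2.
  by apply: cvgB; exact: FG.
exact: cvg_unique H2 H1.
Qed.

(* After translation, almost minimizing sequences are uniformly close to a
   single function along a subsequence, hence Cauchy in H^1. *)
Lemma minimizing_sequence_compact (U : nat -> state) c : 0 < c ->
  (forall n, h2 (U n)) -> (forall n, En (U n) <= M + 1) ->
  (forall n, c <= sG (U n) 0 ^+ 2) ->
  En (U n) @[n --> \oo] --> M -> Jn (U n) @[n --> \oo] --> lam ->
  exists nk : nat -> nat, exists w, exists C,
    [/\ forall k, (nk k < nk k.+1)%N, h2 w, En w = M /\ Jn w = lam &
        forall k, En (comb 1 (U (nk k)) (-1) w) <= C / k.+1%:R].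
Proof.
move=> c0 hU UM Uc EU JU.
have even d : 0 < d -> exists N, forall n, (N <= n)%N ->
    En (U n) <= M + d /\ `|Jn (U n) - lam| <= d.
  move=> d0; have /cvg_eps_N /(_ d d0)[N1 H1] := EU.
  have /cvg_eps_N /(_ d d0)[N2 H2] := JU.
  exists (maxn N1 N2) => n; rewrite geq_max => /andP[n1 n2].
  split; last exact: ltW (H2 n n2).
  by have := ltW (H1 n n1); rewrite ler_norml => /andP[_]; light_lra.
have ks0 := ksup_gt0 a0_gt0 b0_gt0; set ks := ksup a0 b0 in ks0.
pose s n (b : bool) x := if b then sF (U n) x else sG (U n) x.
have M1 : 0 < M + 1 by rewrite addr_gt0.
have s_sup n b x : `|s n b x| <= Num.sqrt (ks * (M + 1)).
  apply: norm_le_sqrt; have [HF HG] := h2_sup a0_gt0 b0_gt0 x (hU n).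
  have H : ks * En (U n) <= ks * (M + 1) by rewrite ler_wpM2l// ltW.
  by rewrite /s; case: b; [exact: le_trans HF H|exact: le_trans HG H].
have s_equi e : 0 < e -> exists2 d : R, 0 < d &
    forall n b x y, `|x - y| <= d -> `|s n b x - s n b y| <= e.
  move=> e0; exists (e ^+ 2 / (M + 1)); first by rewrite divr_gt0// exprn_gt0.
  move=> n b x y; rewrite ler_pdivlMr// => xy.
  have H q : L2 q -> forall F, AC F q -> sq q <= En (U n) -> `|F x - F y| <= e.
    move=> Lq F AF Hq; apply: norm_le_sqr (ltW e0) _.
    apply: (le_trans (AC_holder_global y x Lq AF)); apply: le_trans xy.
    by rewrite ler_wpM2l// (le_trans Hq).
  have [E1 E2 _ _] := sq_le a0_gt0 b0_gt0 (U n).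
  have [[_ L1 A1] [_ L2 A2]] := hU n.
  by rewrite /s; case: b; [exact: (H (dF (U n)))|exact: (H (dG (U n)))].
have s_tight e : 0 < e -> exists B : R, exists N, forall n b x,
    (N <= n)%N -> B <= `|x| -> `|s n b x| <= e.
  move=> e0; have [B [d [B0 d0 H]]] := tightness c0 (exprn_gt0 2 e0).
  have [N HN] := even d d0; exists B, N => n b x Nn Bx.
  have [H1 H2] := HN n Nn.
  have H3 : lam - d <= Jn (U n) by move: H2; rewrite ler_norml; light_lra.
  have [HF HG] := H (U n) (hU n) H1 H3 (Uc n) x Bx.
  by apply: norm_le_sqr (ltW e0) _; rewrite /s; case: b.
have [g Hg] := uniform_cluster s_sup s_equi s_tight.
(* Energy at most kap 4^(-k) then bounds each of the four squared L^2 norms by 4^(-k), the rate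
   asked for by [L2_complete]. *)
pose kap := Num.min 1 (Num.min a0 b0).
have kap0 : 0 < kap by rewrite !lt_min ltr01 a0_gt0 b0_gt0.
have [kap1 [kapa kapb]] : kap <= 1 /\ (kap <= a0 /\ kap <= b0).
  by rewrite /kap !ge_min !lexx !orbT.
have ek0 k : 0 < kap * (4^-1) ^+ k by rewrite mulr_gt0// exprn_gt0// invr_gt0.
have /choice[dl Hdl] : forall k, exists d, 0 < d /\ forall u v, h2 u -> h2 v ->
    En u <= M + d -> En v <= M + d -> lam - d <= Jn u ->
    (forall x, `|sF u x - sF v x| <= d) -> (forall x, `|sG u x - sG v x| <= d) ->
    En (comb 1 u (-1) v) <= kap * (4^-1) ^+ k.
  by move=> k; have [d d0 H] := almost_minimizers_close (ek0 k); exists d.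
(* The k-th selected state is compared with its successor at tolerance [dl k] and with its
   predecessor at tolerance [dl k.-1]. *)
pose ds k := Num.min (Num.min (dl k) (dl k.-1)) (k.+1%:R^-1).
have ds0 k : 0 < ds k by rewrite !lt_min !(Hdl _).1 invr_gt0 ltr0n.
have [ds1 [ds2 ds3]] : (forall k, ds k <= dl k) /\
    ((forall k, ds k.+1 <= dl k) /\ forall k, ds k <= k.+1%:R^-1).
  by split; [|split] => k; rewrite /ds !ge_min lexx ?orbT.
pose good d n := [/\ En (U n) <= M + d, `|Jn (U n) - lam| <= d &
  forall b x, `|s n b x - g b x| <= d / 2].
have /choice[f Hf] : forall kN : nat * nat, exists n,
    (kN.2 <= n)%N /\ good (ds kN.1) n.
  move=> [k N] /=; have [N' HN'] := even _ (ds0 k).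
  have d2 : 0 < ds k / 2 by rewrite divr_gt0.
  have [n nN Hn] := Hg _ (maxn N N') d2; exists n.
  move: nN; rewrite geq_max => /andP[-> n2]; split => //.
  by have [? ?] := HN' n n2; split.
pose nk := fix nk k := if k is k'.+1 then f (k'.+1, (nk k').+1) else f (0%N, 0%N).
have nk_good k : good (ds k) (nk k) by case: k => [|k]; exact: (Hf _).2.
have nk_incr k : (nk k < nk k.+1)%N by exact: (Hf (k.+1, (nk k).+1)).1.
clearbody nk; clear f Hf.
pose V k := U (nk k).
have V_fast k : En (comb 1 (V k.+1) (-1) (V k)) <= kap * (4^-1) ^+ k.
  have [A1 A2 A3] := nk_good k; have [B1 B2 B3] := nk_good k.+1.
  have D b x : `|s (nk k.+1) b x - s (nk k) b x| <= dl k.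
    rewrite -(subrKA (g b x)); apply: (le_trans (ler_normD _ _)).
    have C1 := A3 b x; rewrite distrC in C1; have C2 := B3 b x.
    by move: C1 C2 (ds1 k) (ds2 k); light_lra.
  apply: (Hdl k).2 => //.
  - exact: hU.
  - exact: hU.
  - by apply: (le_trans B1); rewrite lerD2l.
  - by apply: (le_trans A1); rewrite lerD2l.
  - by move: B2 (ds2 k); rewrite ler_norml => /andP[]; light_lra.
  - exact: (D true).
  - exact: (D false).
have fast (P : state -> R -> R) (r : R) : 0 < r -> kap <= r ->
    (forall u v x, P (comb 1 u (-1) v) x = 1 * P u x + (-1) * P v x) ->
    (forall u, sq (P u) <= r^-1 * En u) ->
    forall n, Rint (fun x => (P (V n.+1) x - P (V n) x) ^+ 2) <= (4^-1) ^+ n.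
  move=> r0 kr PD Pr n.
  have -> : Rint (fun x => (P (V n.+1) x - P (V n) x) ^+ 2)
      = sq (P (comb 1 (V n.+1) (-1) (V n))).
    by apply: eq_Rint => x; rewrite PD; ring.
  apply: (le_trans (Pr _)); rewrite ler_pdivrMl//; apply: (le_trans (V_fast n)).
  by rewrite ler_wpM2r// exprn_ge0// invr_ge0.
have fastdF := fast (@dF R) 1 ltr01 kap1 (fun _ _ _ => erefl)
  (fun u => ltac:(rewrite invr1 mul1r; by have [] := sq_le a0_gt0 b0_gt0 u)).
have fastdG := fast (@dG R) 1 ltr01 kap1 (fun _ _ _ => erefl)
  (fun u => ltac:(rewrite invr1 mul1r; by have [] := sq_le a0_gt0 b0_gt0 u)).
have fastF := fast (@sF R) a0 a0_gt0 kapa (fun _ _ _ => erefl)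
  (fun u => ltac:(by have [] := sq_le a0_gt0 b0_gt0 u)).
have fastG := fast (@sG R) b0 b0_gt0 kapb (fun _ _ _ => erefl)
  (fun u => ltac:(by have [] := sq_le a0_gt0 b0_gt0 u)).
have [LsF LdF LsG LdG] : [/\ forall k, L2 (sF (V k)), forall k, L2 (dF (V k)),
    forall k, L2 (sG (V k)) & forall k, L2 (dG (V k))].
  by split=> k; have [] := h2_L2 (hU (nk k)).
have [p [Lp _ Hp]] := L2_complete LdF fastdF.
have [q [Lq _ Hq]] := L2_complete LdG fastdG.
have sg k b x : `|s (nk k) b x - g b x| <= k.+1%:R^-1.
  have [_ _ H] := nk_good k; apply: (le_trans (H b x)).
  apply: le_trans (ds3 k).
  by rewrite ler_pdivrMr// ler_peMr ?(ltW (ds0 k))// ler1n.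
have cvg_g b x : s (nk k) b x @[k --> \oo] --> g b x.
  apply: (@cvg_sq_harmonic _ _ 1) => k; rewrite mul1r.
  have k1 : k.+1%:R^-1 <= 1 :> R by rewrite invf_le1 ?ltr0n// ler1n.
  rewrite -real_normK ?num_real// expr2 -[leRHS]mulr1.
  by apply: ler_pM => //; exact: le_trans (sg k b x) k1.
have [LF HF] := L2_complete_pointwise LsF fastF (cvg_g true).
have [LG HG] := L2_complete_pointwise LsG fastG (cvg_g false).
have pw k : 4 * (2^-1) ^+ k <= 4 / k.+1%:R :> R by rewrite ler_wpM2l// half_power_le.
pose w := State (g true) p (g false) q.
have hw : h2 w.
  split; (split => //).
  - apply: (@AC_limit (fun k => sF (V k)) (fun k => dF (V k)) _ _ 4) => //.
    + by move=> k; have [[_ _ ?] _] := hU (nk k).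
    + exact: (cvg_g true).
    + by move=> k; exact: le_trans (Hp k) (pw k).
  - apply: (@AC_limit (fun k => sG (V k)) (fun k => dG (V k)) _ _ 4) => //.
    + by move=> k; have [_ [_ _ ?]] := hU (nk k).
    + exact: (cvg_g false).
    + by move=> k; exact: le_trans (Hq k) (pw k).
pose C := 4 * (2 + a0 + b0).
have C0 : 0 < C by rewrite mulr_gt0// !addr_gt0.
have Vw k : En (comb 1 (V k) (-1) w) <= C / k.+1%:R.
  have sqN (a b : R -> R) : sq (fun x => 1 * a x + (-1) * b x) = Rint (fun x => (b x - a x) ^+ 2).
    by apply: eq_Rint => x; ring.
  rewrite !EnE /= !sqN.
  have K1 := le_trans (Hp k) (pw k); have K2 := le_trans (Hq k) (pw k).
  have K3 := ler_wpM2l (ltW a0_gt0) (le_trans (HF k) (pw k)).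
  have K4 := ler_wpM2l (ltW b0_gt0) (le_trans (HG k) (pw k)).
  have -> : C / k.+1%:R = 4 / k.+1%:R + 4 / k.+1%:R + a0 * (4 / k.+1%:R) + b0 * (4 / k.+1%:R).
    by rewrite /C; ring.
  by apply: lerD => //; apply: lerD => //; exact: lerD.
have EV k : En (V k) <= M + k.+1%:R^-1.
  by have [H _ _] := nk_good k; apply: (le_trans H); rewrite lerD2l.
have Ew : En w <= M.
  (* A double limit in [En_triangle]: the inner use of [le_harmonic] sends k to infinity at fixed t,
     the outer one sends t to 0. *)
  apply: (@le_harmonic _ _ M) => j; set t : R := j.+1%:R^-1.
  have t0 : 0 < t by rewrite invr_gt0 ltr0n.
  apply: (@le_harmonic _ _ ((1 + t) + (1 + t^-1) * C)) => k.
  apply: (le_trans (En_triangle a0_gt0 b0_gt0 t0 (hU (nk k)) hw)).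
  have t1 : 0 <= 1 + t by rewrite addr_ge0// ltW.
  have t2 : 0 <= 1 + t^-1 by rewrite addr_ge0// invr_ge0 ltW.
  have K1 := ler_wpM2l t1 (EV k); have K2 := ler_wpM2l t2 (Vw k).
  apply: (le_trans (lerD K1 K2)); rewrite le_eqVlt; apply/orP; left; apply/eqP; ring.
have Jw : Jn w = lam.
  apply/eqP; rewrite -subr_eq0 -normr_le0.
  pose kp := a0^-1 + b0^-1.
  apply: (@le_harmonic _ _ (2 * kp * (M + 1 + M) + 1)) => k; rewrite add0r.
  have H := Jn_dist a0_gt0 b0_gt0 (hU (nk k)) hw (sg k true) (sg k false).
  have [_ H2 _] := nk_good k.
  have H3 : `|Jn (V k) - Jn w| <= 2 * k.+1%:R^-1 * kp * (M + 1 + M).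
    apply: (le_trans H); rewrite ler_wpM2l//.
      by rewrite !mulr_ge0 ?invr_ge0// addr_ge0// invr_ge0 ltW.
    by apply: lerD => //; exact: UM.
  rewrite -(subrKA (Jn (V k))) mulrDl mul1r; apply: (le_trans (ler_normD _ _)).
  apply: lerD; last exact: le_trans H2 (ds3 k).
  rewrite distrC; apply: (le_trans H3).
  by rewrite le_eqVlt; apply/orP; left; apply/eqP; ring.
exists nk, w, C; split => //; split => //.
by apply/eqP; rewrite eq_le Ew HM.
Qed.

End existence.

(** * Translation between the spaces of the statement and states *)

Section representatives.
Variable R : realType.
Local Notation mu := (@lebesgue_measure R).
Variables a0 b0 : R.
Hypotheses (a0_gt0 : 0 < a0) (b0_gt0 : 0 < b0).
Local Notation state := (state R).
Implicit Types (f g F G p q : R -> R) (u v w : state).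

Definition represents u (f g : R -> R) : Prop :=
  h1_rep f (sF u) (dF u) /\ h1_rep g (sG u) (dG u).

Lemma represents_h2 u f g : represents u f g -> h2 u.
Proof. by move=> [[? _ _] [? _ _]]. Qed.

Lemma h2_represents u : h2 u -> represents u (sF u) (sG u).
Proof.
by move=> [hF hG]; split; split => //; [case: hF => -[]|exact: aeW|case: hG => -[]|exact: aeW].
Qed.

Lemma h1_rep_meas_deriv f F p : h1_rep f F p -> measurable_fun setT (weak_deriv 1 f).
Proof. by move=> /h1_rep_weak_deriv /weak_derivE[/weak_deriv_loc1[_ []]]. Qed.

Lemma ae_and (P Q : R -> Prop) : {ae mu, forall x, P x} -> {ae mu, forall x, Q x} ->
  {ae mu, forall x, P x /\ Q x}.
Proof.
move=> HP HQ; have H := filterI (Filter := ae_filter_ringOfSetsType mu) HP HQ.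
by apply: ae_imp H.
Qed.

Lemma ae_integral_Rint f g : measurable_fun setT f -> Ig setT g ->
  {ae mu, forall x, g x = f x} -> (\int[mu]_x (f x)%:E)%E = (Rint g)%:E.
Proof.
move=> mf Ig' gf; have If := Ig_ae mf gf Ig'.
by rewrite (EFin_Rint If) (Rint_ae (Ig_meas Ig') mf gf).
Qed.

Lemma energyE u f g : represents u f g -> energy a0 b0 f g = (En a0 b0 u)%:E.
Proof.
move=> ur; have hu := represents_h2 ur; have [LF LdF LG LdG] := h2_L2 hu.
have [rf rg] := ur; have [_ mf Ff] := rf; have [_ mg Gg] := rg.
have Df := h1_rep_weak_derivE rf; have Dg := h1_rep_weak_derivE rg.
have mDf := h1_rep_meas_deriv rf; have mDg := h1_rep_meas_deriv rg.
have I1 : Ig setT (fun x => a0 * sF u x ^+ 2) by apply: IgZ => //; exact: LF.2.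
have I2 : Ig setT (fun x => b0 * sG u x ^+ 2) by apply: IgZ => //; exact: LG.2.
have I3 : Ig setT (fun x => dF u x ^+ 2 + dG u x ^+ 2).
  by apply: IgD => //; [exact: LdF.2|exact: LdG.2].
have I4 : Ig setT (fun x => dF u x ^+ 2 + dG u x ^+ 2 + a0 * sF u x ^+ 2) by exact: IgD.
rewrite /energy (@ae_integral_Rint _ (fun x => dF u x ^+ 2 + dG u x ^+ 2
   + a0 * sF u x ^+ 2 + b0 * sG u x ^+ 2)).
- congr (_%:E); rewrite /En /sq RintD// RintD// RintD//; [|exact: LdF.2|exact: LdG.2].
  by rewrite !RintZ//; [exact: LG.2|exact: LF.2].
- apply: measurable_funD; [apply: measurable_funD; [apply: measurable_funD|]|].
  + exact: measurable_funX.
  + exact: measurable_funX.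
  + by apply: measurable_funM => //; exact: measurable_funX.
  + by apply: measurable_funM => //; exact: measurable_funX.
- exact: IgD.
- by apply: ae_imp (ae_and (ae_and Df Dg) (ae_and Ff Gg)) => x [[-> ->] [-> ->]].
Qed.

Lemma constrE u f g : represents u f g -> constr f g = (Jn u)%:E.
Proof.
move=> ur; have hu := represents_h2 ur.
have [[_ mf Ff] [_ mg Gg]] := ur.
rewrite /constr (@ae_integral_Rint _ (fun x => sF u x ^+ 2 * sG u x)) //.
- by apply: measurable_funM => //; exact: measurable_funX.
- exact: Ig_J a0_gt0 b0_gt0 _ hu.
- by apply: ae_imp (ae_and Ff Gg) => x [-> ->].
Qed.

Lemma represents_ex f g : H1 f -> H1 g -> exists u, represents u f g.
Proof.
move=> /H1_h1_rep[F [p rf]] /H1_h1_rep[G [q rg]].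
by exists (State F p G q).
Qed.

Lemma represents_H1 u f g : represents u f g -> H1 f /\ H1 g.
Proof. by move=> [/h1_rep_H1 ? /h1_rep_H1 ?]. Qed.

Lemma ae_shift (y : R) (P : R -> Prop) : {ae mu, forall x, P x} ->
  {ae mu, forall x, P (x + y)}.
Proof.
move=> [N [mN N0 NP]]; exists ((fun x => x + y) @^-1` N); split.
- by rewrite -[X in measurable X]setTI; exact: measurable_shift.
- by have := lebesgue_measure_shift y mN; rewrite /pushforward => ->.
- by move=> x /= H; apply: NP.
Qed.

Lemma h1_rep_shift f F p (y : R) : h1_rep f F p ->
  h1_rep (fun x => f (x + y)) (fun x => F (x + y)) (fun x => p (x + y)).
Proof.
move=> [hF mf Ff]; split; [exact: h1_shift|exact: measurable_funShift|].
exact: (@ae_shift y (fun x => F x = f x)).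
Qed.

Lemma h1_repB f F p g G q : h1_rep f F p -> h1_rep g G q ->
  h1_rep (fun x => f x - g x) (fun x => F x - G x) (fun x => p x - q x).
Proof.
move=> [hF mf Ff] [hG mg Gg]; split; [exact: h1B|exact: measurable_funB|].
by apply: ae_imp (ae_and Ff Gg) => x [-> ->].
Qed.

Lemma H1normE f F p : h1_rep f F p -> H1norm f = (Num.sqrt (sq F + sq p))%:E.
Proof.
move=> rf; have [[LF Lp _] mf Ff] := rf; have Df := h1_rep_weak_derivE rf.
have mDf := h1_rep_meas_deriv rf.
rewrite /H1norm (@ae_integral_Rint _ (fun x => F x ^+ 2 + p x ^+ 2)).
- rewrite RintD//; [|exact: LF.2|exact: Lp.2].
  by rewrite poweR_EFin powR12_sqrt// addr_ge0 ?sq_ge0.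
- by apply: measurable_funD; exact: measurable_funX.
- by apply: IgD => //; [exact: LF.2|exact: Lp.2].
- by apply: ae_imp (ae_and Df Ff) => x [-> ->].
Qed.

Lemma H1norm_cvg0 (f F p : nat -> R -> R) (C : R) :
  (forall k, h1_rep (f k) (F k) (p k)) ->
  (forall k, sq (F k) + sq (p k) <= C / k.+1%:R) ->
  H1norm (f k) @[k --> \oo] --> 0%E.
Proof.
move=> rf H; under eq_fun do rewrite (H1normE (rf _)).
apply: cvg_EFin; first exact: nearW.
apply: (@cvg_sq_harmonic _ _ _ C) => k; rewrite subr0 sqr_sqrtr//.
by rewrite addr_ge0 ?sq_ge0.
Qed.

End representatives.

(** * The infimum, minimizing sequences and existence of minimizers *)

Section minimization_problem.
Variable R : realType.
Local Notation mu := (@lebesgue_measure R).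
Variables a0 b0 lam : R.
Hypotheses (a0_gt0 : 0 < a0) (b0_gt0 : 0 < b0) (lam_gt0 : 0 < lam).
Local Notation state := (state R).
Local Notation En := (En a0 b0).
Implicit Types (f g F G p q : R -> R) (u v w : state).

Lemma Rint_tent3_gt0 : 0 < Rint (fun x : R => tent 0 x ^+ 2 * tent 0 x).
Proof.
have hT : h1 (tent (0 : R)) (dtent 0) := h1_tent 0.
have [LT _ _] := hT.
have T1 (x : R) : `|tent 0 x| <= 1.
  by have /andP[t0 t1] := tent_bound 0 x; rewrite ger0_norm// (le_trans t1).
(* The tent is at least 1/2 on [-1/2, 1/2], so its cube is at least 1/8 there. *)
apply: (@lt_le_trans _ _ (\int[mu]_(x in `[- 2^-1, 2^-1]) (8^-1 : R))).
  by rewrite int_itv_cst; [rewrite mulr_gt0 ?invr_gt0//; lra|lra].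
have IT : Ig setT (fun x : R => tent 0 x ^+ 2 * tent 0 x).
  exact: Ig_bounded_mul LT.1 T1 LT.
apply: le_trans (le_int_itv (- 2^-1) (2^-1) IT _); last first.
  by move=> x; rewrite mulr_ge0 ?sqr_ge0//; have /andP[] := tent_bound 0 x.
apply: le_Rintegral => //.
- exact: Ig_itv_cst.
- exact: IgT.
- move=> x /=; rewrite in_itv/= => /andP[x1 x2].
  have Tx : 2^-1 <= tent 0 x.
    rewrite /tent ifF; last by apply/negbTE; rewrite -ltNge; lra.
    by case: ifP => Hx; [|rewrite ifT]; lra.
  have -> : 8^-1 = 2^-1 ^+ 3 :> R by field.
  rewrite -exprSr lerXn2r ?nnegrE ?invr_ge0//.
  by apply: le_trans Tx; rewrite invr_ge0.
Qed.

(** The constraint is linear in the second component, so a multiple of the tent there reaches any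
    value. *)
Lemma admissible_ex : exists2 u, h2 u & Jn u = lam.
Proof.
have J0 := Rint_tent3_gt0; set J := Rint _ in J0.
exists (State (tent 0) (dtent 0) (fun x => lam / J * tent 0 x) (fun x => lam / J * dtent 0 x)).
  by split; [exact: h1_tent|apply: h1Z; exact: h1_tent].
rewrite /Jn /=; transitivity (Rint (fun x : R => lam / J * (tent 0 x ^+ 2 * tent 0 x))).
  by apply: eq_Rint => x; ring.
have [LT _ _] := h1_tent (0 : R).
rewrite RintZ ?divfK ?gt_eqF//.
apply: (Ig_bounded_mul (M := 1) LT.1 _ LT) => x.
by have /andP[t0 t1] := tent_bound 0 x; rewrite ger0_norm// (le_trans t1).
Qed.

Definition Mval : R := fine (Mmin a0 b0 lam).

Lemma admissible_represents f g : admissible lam (f, g) ->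
  exists u, [/\ represents u f g, h2 u & Jn u = lam].
Proof.
move=> [/= Hf Hg]; have [u ur] := represents_ex Hf Hg.
rewrite (constrE a0_gt0 b0_gt0 ur) => -[Ju].
by exists u; split => //; exact: represents_h2 ur.
Qed.

Lemma represents_admissible u f g : represents u f g -> Jn u = lam ->
  admissible lam (f, g).
Proof.
move=> ur Ju; have [Hf Hg] := represents_H1 ur.
by split => //=; rewrite (constrE a0_gt0 b0_gt0 ur) Ju.
Qed.

Lemma Mmin_le u : h2 u -> Jn u = lam -> (Mmin a0 b0 lam <= (En u)%:E)%E.
Proof.
move=> hu Ju; apply: ereal_inf_lbound; have ur := h2_represents hu.
exists (sF u, sG u); first exact: represents_admissible ur Ju.
exact: energyE.
Qed.

Lemma Mmin_bounds : (0 < Mmin a0 b0 lam < +oo)%E.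
Proof.
apply/andP; split; last first.
  by have [u hu Ju] := admissible_ex; rewrite (le_lt_trans (Mmin_le hu Ju))// ltry.
have kJ0 := kJ_gt0 a0_gt0 b0_gt0; set k := kJ a0 b0 in kJ0.
(* Either the energy is at least 1, or lam^2 <= k En^3 <= k En. *)
pose m := Num.min 1 (lam ^+ 2 / k).
have m0 : 0 < m by rewrite lt_min ltr01 divr_gt0// exprn_gt0.
apply: (@lt_le_trans _ _ m%:E); first by rewrite lte_fin.
apply: le_ereal_inf_tmp => _ [[f g] /admissible_represents[u [ur hu Ju]] <-] /=.
rewrite (energyE a0 b0 ur) lee_fin.
have E0 := En_ge0 a0_gt0 b0_gt0 u.
have [E1|E1] := leP 1 (En u); first by rewrite (le_trans _ E1)// ge_min lexx.
have := Jn_sq_le a0_gt0 b0_gt0 hu; rewrite Ju -/k => H.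
rewrite ge_min; apply/orP; right; rewrite ler_pdivrMr// mulrC.
by apply: (le_trans H); rewrite ler_pM2l// exprS ler_piMr// exprn_ile1// ltW.
Qed.

Lemma MminE : Mmin a0 b0 lam = Mval%:E.
Proof.
rewrite /Mval fineK//; have /andP[M0 M1] := Mmin_bounds.
by rewrite fin_numE gt_eqF ?lt_eqF// (lt_trans _ M0)// ltNyr.
Qed.

Lemma Mval_gt0 : 0 < Mval.
Proof. by have /andP[+ _] := Mmin_bounds; rewrite MminE lte_fin. Qed.

Lemma Mval_le u : h2 u -> Jn u = lam -> Mval <= En u.
Proof. by move=> hu Ju; have := Mmin_le hu Ju; rewrite MminE lee_fin. Qed.

Lemma Smin_represents f g : Smin a0 b0 lam (f, g) ->
  exists u, [/\ represents u f g, h2 u, Jn u = lam & En u = Mval].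
Proof.
move=> [/= /admissible_represents[u [ur hu Ju]]].
by rewrite (energyE a0 b0 ur) MminE => -[Eu]; exists u.
Qed.

Lemma represents_Smin u f g : represents u f g -> Jn u = lam -> En u = Mval ->
  Smin a0 b0 lam (f, g).
Proof.
move=> ur Ju Eu; split; first exact: represents_admissible ur Ju.
by rewrite /= (energyE a0 b0 ur) Eu MminE.
Qed.

Lemma nonvanishing : exists2 c : R, 0 < c & forall u, h2 u -> En u <= Mval + 1 ->
  lam / 2 <= Jn u -> exists y, c <= sG u y ^+ 2.
Proof.
have M1 : 0 < Mval + 1 by rewrite addr_gt0// Mval_gt0.
(* If |g| <= s everywhere, [Jn_le] gives |J| <= s (Mval + 1) / a0 = lam / 4, below the assumed lam /
   2. *)
pose s := lam * a0 / (4 * (Mval + 1)).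
have s0 : 0 < s by rewrite divr_gt0 ?mulr_gt0.
exists (s ^+ 2); first by rewrite exprn_gt0.
move=> u hu Eu Ju; apply: contrapT => /forallNP H.
have Gs x : `|sG u x| <= s.
  apply: norm_le_sqr (ltW s0) _; rewrite leNgt; apply/negP => /ltW Hx.
  exact: H x Hx.
have J1 := Jn_le a0_gt0 b0_gt0 hu Gs.
have [_ _ H3 _] := sq_le a0_gt0 b0_gt0 u.
have J2 : `|Jn u| <= lam / 4.
  apply: (le_trans J1); apply: (@le_trans _ _ (s * (a0^-1 * (Mval + 1)))).
    rewrite ler_wpM2l ?(ltW s0)// (le_trans H3)// ler_wpM2l// invr_ge0 ltW//.
  rewrite le_eqVlt; apply/orP; left; apply/eqP; rewrite /s; field.
  by rewrite !gt_eqF.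
have := le_trans Ju (le_trans (ler_norm (Jn u)) J2).
by rewrite leNgt ltr_pM2l// ltf_pV2 ?posrE// ltr_nat.
Qed.

Lemma minimizing_sequences (f g : nat -> R -> R) :
  (forall n, H1 (f n) /\ H1 (g n)) ->
  constr (f n) (g n) @[n --> \oo] --> lam%:E ->
  energy a0 b0 (f n) (g n) @[n --> \oo] --> Mmin a0 b0 lam ->
  exists (nk : nat -> nat) (y : nat -> R) (phi psi : R -> R),
    [/\ forall k l, (k < l)%N -> (nk k < nk l)%N,
        Smin a0 b0 lam (phi, psi),
        H1norm (fun x => f (nk k) (x + y k) - phi x) @[k --> \oo] --> 0%E &
        H1norm (fun x => g (nk k) (x + y k) - psi x) @[k --> \oo] --> 0%E].
Proof.
move=> Hfg Hc He.
have /choice[U HU] : forall n, exists u, represents u (f n) (g n).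
  by move=> n; have [? ?] := Hfg n; exact: represents_ex.
have hU n := represents_h2 (HU n).
have JU : Jn (U n) @[n --> \oo] --> lam.
  move: Hc; under eq_fun do rewrite (constrE a0_gt0 b0_gt0 (HU _)).
  by move=> /fine_cvg.
have EU : En (U n) @[n --> \oo] --> Mval.
  move: He; under eq_fun do rewrite (energyE a0 b0 (HU _)).
  by rewrite MminE => /fine_cvg.
have [c c0 Hc0] := nonvanishing.
have l2 : 0 < lam / 2 by rewrite divr_gt0.
have /cvg_eps_N /(_ _ l2)[N1 HN1] := JU.
have /cvg_eps_N /(_ _ ltr01)[N2 HN2] := EU.
(* Past N the energy is at most [Mval + 1] and the constraint at least lam / 2, so [nonvanishing]
   provides a translation for every remaining term. The final subsequence is therefore offset by
   N. *)
pose N := maxn N1 N2.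
have UN n : En (U (n + N)%N) <= Mval + 1.
  have := ltW (HN2 (n + N)%N _); rewrite /N (leq_trans (leq_maxr N1 N2)) ?leq_addl//.
  by move=> /(_ isT); rewrite ler_norml => /andP[_]; lra.
have /choice[y Hy] : forall n, exists y, c <= sG (U (n + N)%N) y ^+ 2.
  move=> n; apply: Hc0 => //.
  have := ltW (HN1 (n + N)%N _); rewrite /N (leq_trans (leq_maxl N1 N2)) ?leq_addl//.
  by move=> /(_ isT); rewrite ler_norml => /andP[+ _]; lra.
pose W n := sshift (y n) (U (n + N)%N).
have hW n : h2 (W n) by exact: h2_shift.
have EW n : En (W n) = En (U (n + N)%N) by exact: En_shift.
have JW n : Jn (W n) = Jn (U (n + N)%N) by exact: (Jn_shift a0_gt0 b0_gt0).
have cvg_shift (a : nat -> R) (l : R) : a n @[n --> \oo] --> l -> a (n + N)%N @[n --> \oo] --> l.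
  move=> /cvg_eps_N H; apply/cvg_eps_N => e /H[N' HN']; exists N' => n Nn.
  by apply: HN'; rewrite (leq_trans Nn)// leq_addr.
have [||||nk [w [C [nk_incr hw [Ew Jw] HC]]]] :=
  minimizing_sequence_compact a0_gt0 b0_gt0 lam_gt0 Mval_gt0 Mval_le c0 hW.
- by move=> n; rewrite EW.
- by move=> n; rewrite /W /= add0r.
- by under eq_fun do rewrite EW; exact: (cvg_shift (fun n => En (U n))).
- by under eq_fun do rewrite JW; exact: (cvg_shift (fun n => Jn (U n))).
have wr := h2_represents hw.
exists (fun k => (nk k + N)%N), (fun k => y (nk k)), (sF w), (sG w).
have sqs k : [/\ sq (fun x => dF (W (nk k)) x - dF w x) <= C / k.+1%:R,
    sq (fun x => dG (W (nk k)) x - dG w x) <= C / k.+1%:R,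
    sq (fun x => sF (W (nk k)) x - sF w x) <= a0^-1 * (C / k.+1%:R) &
    sq (fun x => sG (W (nk k)) x - sG w x) <= b0^-1 * (C / k.+1%:R)].
  have [S1 S2 S3 S4] := sq_le a0_gt0 b0_gt0 (comb 1 (W (nk k)) (-1) w).
  have E (P Q : R -> R) : sq (fun x => P x - Q x) = sq (fun x => 1 * P x + (-1) * Q x).
    by apply: eq_Rint => x; ring.
  rewrite !E; split; [exact: le_trans S1 (HC k)|exact: le_trans S2 (HC k)| |].
    by apply: (le_trans S3); rewrite ler_wpM2l// invr_ge0 ltW.
  by apply: (le_trans S4); rewrite ler_wpM2l// invr_ge0 ltW.
split.
- move=> k l kl; rewrite ltn_add2r; exact: (homo_ltn ltn_trans nk_incr).
- exact: represents_Smin wr Jw Ew.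
- apply: (@H1norm_cvg0 _ _ (fun k x => sF (W (nk k)) x - sF w x)
    (fun k x => dF (W (nk k)) x - dF w x) (a0^-1 * C + C)).
    by move=> k; apply: h1_repB wr.1; apply: h1_rep_shift; exact: (HU _).1.
  move=> k; have [S1 _ S3 _] := sqs k.
  by rewrite mulrDl -mulrA; exact: lerD.
- apply: (@H1norm_cvg0 _ _ (fun k x => sG (W (nk k)) x - sG w x)
    (fun k x => dG (W (nk k)) x - dG w x) (b0^-1 * C + C)).
    by move=> k; apply: h1_repB wr.2; apply: h1_rep_shift; exact: (HU _).2.
  move=> k; have [_ S2 _ S4] := sqs k.
  by rewrite mulrDl -mulrA; exact: lerD.
Qed.

(** The infimum provides admissible pairs of energy at most M + 1/(n+1), to which the compactness
    statement applies. *)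
Lemma Smin_nonempty : Smin a0 b0 lam !=set0.
Proof.
have Mfin : Mmin a0 b0 lam \is a fin_num by rewrite MminE.
have /choice[U HU] : forall n : nat, exists u,
    [/\ h2 u, Jn u = lam & En u <= Mval + n.+1%:R^-1].
  move=> n; have n0 : 0 < n.+1%:R^-1 :> R by rewrite invr_gt0 ltr0n.
  have [_ [[f g] /admissible_represents[u [ur hu Ju]] <-]] :=
    lb_ereal_inf_adherent n0 Mfin.
  rewrite /= (energyE a0 b0 ur) -/(Mmin a0 b0 lam) MminE -EFinD lte_fin => /ltW Eu.
  by exists u.
have rU n : represents (U n) (sF (U n)) (sG (U n)).
  by apply: h2_represents; have [] := HU n.
have [|||nk [y [phi [psi [_ HS _ _]]]]] :=
    @minimizing_sequences (fun n => sF (U n)) (fun n => sG (U n)).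
- by move=> n; exact: represents_H1 (rU n).
- under eq_fun do rewrite (constrE a0_gt0 b0_gt0 (rU _)).
  rewrite (_ : (fun n => (Jn (U n))%:E) = fun=> lam%:E); first exact: cvg_cst.
  by apply/funext => n; have [_ -> _] := HU n.
- under eq_fun do rewrite (energyE a0 b0 (rU _)).
  rewrite MminE; apply: cvg_EFin; first exact: nearW.
  apply: (@cvg_sq_harmonic _ _ _ 1) => k; rewrite mul1r.
  have [hu Ju Eu] := HU k; have ME := Mval_le hu Ju.
  have k1 : k.+1%:R^-1 <= 1 :> R by rewrite invf_le1 ?ltr0n// ler1n.
  rewrite expr2 -[leRHS]mulr1; apply: ler_pM; rewrite ?subr_ge0// lerBlDl//.
  by apply: (le_trans Eu); rewrite lerD2l.
- by exists (phi, psi).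
Qed.

End minimization_problem.

(** * First variation and the Euler-Lagrange system *)

Section Euler_Lagrange.
Variable R : realType.
Local Notation mu := (@lebesgue_measure R).
Variables a0 b0 : R.
Hypotheses (a0_gt0 : 0 < a0) (b0_gt0 : 0 < b0).
Local Notation state := (state R).
Local Notation En := (En a0 b0).
Implicit Types (f g h F G p q r phi : R -> R) (u v w : state) (x y t l e : R).

Lemma dv_min0 f l : (forall t, 0 <= f t) -> f 0 = 0 -> dv f 0 l -> l = 0.
Proof.
move=> f0 f00 /dvP H; apply/eqP; apply: contraT => l0.
have l2 : 0 < `|l| / 2 by rewrite divr_gt0 ?normr_gt0.
have [d d0 Hd] := H _ l2.
(* An increment of sign opposite to l: as f h >= 0, the difference quotient is 0 or of sign opposite
   to l, so it stays at distance at least |l| from l. *)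
pose h := - Num.sg l * (d / 2).
have h0 : h != 0 by rewrite mulf_neq0 ?oppr_eq0 ?sgr_eq0// mulf_neq0 ?gt_eqF// ?invr_gt0.
have hd : `|h| < d.
  rewrite /h normrM normrN normr_sg l0 mul1r ger0_norm; last by rewrite divr_ge0// ltW.
  by rewrite ltr_pdivrMr//; lra.
have := Hd h h0 hd; rewrite add0r f00 subr0.
have fh := f0 h; have dp : 0 < d / 2 by rewrite divr_gt0.
have : l < 0 \/ 0 < l by move: l0; rewrite neq_lt => /orP.
move: h0 fh l2 {Hd hd}; rewrite /h => h0 fh l2 [ln|lp]; last first.
- move: h0 fh; rewrite (gtr0_sg lp) mulN1r => h0 fh; rewrite invrN mulNr ltr_norml => /andP[H1 _].
  have : 0 <= (d / 2)^-1 * f (- (d / 2)) by rewrite mulr_ge0// invr_ge0 ltW.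
  by move: H1; rewrite gtr0_norm//; lra.
- move: h0 fh; rewrite (ltr0_sg ln) opprK mul1r => h0 fh; rewrite ltr_norml => /andP[_ H1].
  have : 0 <= (d / 2)^-1 * f (d / 2) by rewrite mulr_ge0// invr_ge0 ltW.
  by move: H1; rewrite ltr0_norm//; lra.
Qed.

Lemma h1_bounded F p : h1 F p -> exists M, forall x, `|F x| <= M.
Proof.
move=> hF; exists (Num.sqrt (2 * (Rint (fun t => F t ^+ 2) + Rint (fun t => p t ^+ 2)))).
by move=> x; apply: norm_le_sqrt; exact: h1_sup.
Qed.

(** Two factors are in L^2 and the third is bounded. *)
Lemma Ig3 F p G q h r : h1 F p -> h1 G q -> h1 h r ->
  Ig setT (fun x => F x * G x * h x).
Proof.
move=> [LF _ _] [LG _ _] hh; have [M HM] := h1_bounded hh; have [Lh _ _] := hh.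
apply: (@Ig_le _ _ _ (fun x => M * (F x ^+ 2 + G x ^+ 2))) => //.
- by apply: measurable_funM; [apply: measurable_funM; [exact: LF.1|exact: LG.1]|exact: Lh.1].
- move=> x _; rewrite normrM mulrC; apply: ler_pM => //.
  rewrite ler_norml; apply/andP; split; move: (F x) (G x) => a b; nra.
- by apply: IgZ => //; apply: IgD => //; [exact: LF.2|exact: LG.2].
Qed.

(** The first variation of [Jn] at [u] in the direction [v]. *)
Definition J1 u v : R := Rint (fun x => 2 * (sF u x * sG u x * sF v x) + sF u x * sF u x * sG v x).

Lemma Jn_expand u v : h2 u -> h2 v -> exists j2 j3, forall t,
  Jn (comb 1 u t v) = Jn u + t * J1 u v + t ^+ 2 * j2 + t ^+ 3 * j3.
Proof.
move=> [hF hG] [hf hg].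
exists (Rint (fun x => 2 * (sF u x * sF v x * sG v x) + sF v x * sF v x * sG u x)), (Jn v) => t.
have I0 : Ig setT (fun x => sF u x ^+ 2 * sG u x) by exact: (Ig3 hF hF hG).
have I1 : Ig setT (fun x => 2 * (sF u x * sG u x * sF v x) + sF u x * sF u x * sG v x).
  by apply: IgD => //; [apply: IgZ => //; exact: (Ig3 hF hG hf)|exact: (Ig3 hF hF hg)].
have I2 : Ig setT (fun x => 2 * (sF u x * sF v x * sG v x) + sF v x * sF v x * sG u x).
  by apply: IgD => //; [apply: IgZ => //; exact: (Ig3 hF hf hg)|exact: (Ig3 hf hf hG)].
have I3 : Ig setT (fun x => sF v x ^+ 2 * sG v x) by exact: (Ig3 hf hf hg).
have I1t : Ig setT (fun x => t * (2 * (sF u x * sG u x * sF v x) + sF u x * sF u x * sG v x)) by exact: IgZ.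
have I2t : Ig setT (fun x => t ^+ 2 * (2 * (sF u x * sF v x * sG v x) + sF v x * sF v x * sG u x)) by exact: IgZ.
have I3t : Ig setT (fun x => t ^+ 3 * (sF v x ^+ 2 * sG v x)) by exact: IgZ.
rewrite /J1 /Jn -(RintZ t I1) -(RintZ (t ^+ 2) I2) -(RintZ (t ^+ 3) I3).
rewrite -(RintD I0 I1t) -(RintD (IgD measurableT I0 I1t) I2t).
rewrite -(RintD (IgD measurableT (IgD measurableT I0 I1t) I2t) I3t).
by apply: eq_Rint => x /=; ring.
Qed.

Variables lam M : R.
Hypotheses (lam_gt0 : 0 < lam) (M_gt0 : 0 < M).
Hypothesis HM : forall u, h2 u -> Jn u = lam -> M <= En u.

Variable u : state.
Hypotheses (hu : h2 u) (Ju : Jn u = lam) (Eu : En u = M).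

Let kap : R := 2 * M / (3 * lam).

(* [t |-> lam^2 En(u + t v)^3 - M^3 Jn(u + t v)^2] is minimal at [t = 0]. *)
Lemma weak_Euler_Lagrange v : h2 v -> Bn a0 b0 u v = kap / 2 * J1 u v.
Proof.
move=> hv; have [j2 [j3 HJ]] := Jn_expand hu hv.
pose P t := lam ^+ 2 * (M + 2 * Bn a0 b0 u v * t + En v * t ^+ 2) ^+ 3
  - M ^+ 3 * (lam + J1 u v * t + j2 * t ^+ 2 + j3 * t ^+ 3) ^+ 2.
have P0 t : 0 <= P t.
  have hc := h2_comb 1 t hu hv.
  have := En_homogeneous a0_gt0 b0_gt0 lam_gt0 M_gt0 HM hc.
  rewrite HJ En_comb// Eu Ju -subr_ge0 => H; apply: (le_trans H).
  by rewrite le_eqVlt; apply/orP; left; apply/eqP; rewrite /P; ring.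
have P00 : P 0 = 0 by rewrite /P; ring.
have d1 := dv_id (0 : R).
have D1 : dv (fun t => M + 2 * Bn a0 b0 u v * t + En v * t ^+ 2) 0 (2 * Bn a0 b0 u v).
  have := dvD (dvD (dv_cst M 0) (dvZ (2 * Bn a0 b0 u v) d1)) (dvZ (En v) (dvX2 d1)).
  by move/dv_eq; apply; ring.
have D2 : dv (fun t => lam + J1 u v * t + j2 * t ^+ 2 + j3 * t ^+ 3) 0 (J1 u v).
  have := dvD (dvD (dvD (dv_cst lam 0) (dvZ (J1 u v) d1)) (dvZ j2 (dvX2 d1))) (dvZ j3 (dvXn 3 d1)).
  by move/dv_eq; apply; rewrite /=; ring.
have := dvB (dvZ (lam ^+ 2) (dvXn 3 D1)) (dvZ (M ^+ 3) (dvXn 2 D2)).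
move=> /(dv_min0 P0 P00) /=; set B := Bn a0 b0 u v; set J := J1 u v => H.
(* The derivative of P at 0 is 6 lam^2 M^2 B - 2 lam M^3 J, factored here. *)
have H2 : (2 * lam * M ^+ 2) * (3 * lam * B - M * J) = 0.
  by rewrite -[RHS]H; ring.
move/eqP: H2; rewrite mulf_eq0 => /orP[|/eqP H3].
  by rewrite gt_eqF// !mulr_gt0// exprn_gt0.
have lam3 : 3 * lam != 0 by rewrite mulf_neq0// gt_eqF.
apply: (mulfI lam3); rewrite /kap; apply/eqP; rewrite -subr_eq0; apply/eqP.
by rewrite -[RHS]H3; field; rewrite gt_eqF.
Qed.

Lemma test_h1 phi : test_function phi -> h1 phi (derive1 phi).
Proof.
move=> tphi; have tpsi := test_derive tphi.
have Lt (q : R -> R) : test_function q -> L2 q.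
  move=> tw; have lw := continuous_loc1 (test_continuous tw).
  by split; [exact: lw.1|exact: (Ig_mul_test lw tw)].
split; [exact: Lt|exact: Lt|].
by apply: AC_dv; [move=> x; exact: test_dv|exact: test_continuous].
Qed.

Lemma L2_0 : L2 ((fun=> 0) : R -> R).
Proof.
split; first exact: measurable_cst.
have := @Ig_indic R (cst 0) set0 measurable0 (integrable_set0 _ _).
by congr Ig; apply/funext => x /=; rewrite mul0r expr0n.
Qed.

Lemma h1_0 : h1 ((fun=> 0) : R -> R) (fun=> 0).
Proof.
split; [exact: L2_0|exact: L2_0|].
apply: AC_dv; first by move=> x; exact: dv_cst.
by move=> x; exact: cvg_cst.
Qed.

Lemma Rint0 : Rint ((fun=> 0) : R -> R) = 0.
Proof. by rewrite /Rint Rintegral_cst// mul0r. Qed.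

Lemma weak_ODE_F phi : test_function phi ->
  Rint (fun x => dF u x * derive1 phi x)
  = - Rint (fun x => (a0 * sF u x - kap * (sF u x * sG u x)) * phi x).
Proof.
move=> tphi; have hphi := test_h1 tphi.
have hv : h2 (State phi (derive1 phi) (fun=> 0) (fun=> 0)) by split => //; exact: h1_0.
have := weak_Euler_Lagrange hv; rewrite /Bn /J1 /=.
have [hF hG] := hu; have [LF LdF _] := hF; have [Lphi _ _] := hphi.
under [X in _ + X + _ + _ = _]eq_Rint do rewrite mulr0.
under [X in _ + _ * X = _]eq_Rint do rewrite mulr0.
under [X in _ = _ * X]eq_Rint do rewrite mulr0 addr0.
have I1 := Ig3 hF hG hphi; have I2 := L2M LF Lphi.
rewrite Rint0 mulr0 !addr0 RintZ// => H.
have E : (fun x => (a0 * sF u x - kap * (sF u x * sG u x)) * phi x)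
  = fun x => a0 * (sF u x * phi x) - kap * (sF u x * sG u x * phi x).
  by apply/funext => x; ring.
rewrite E RintB; [|exact: IgZ|exact: IgZ]; rewrite !RintZ//.
move: H; set A := Rint _; set B := Rint _; set C := Rint _ => H.
have -> : A = kap / 2 * (2 * C) - a0 * B by rewrite -H addrK.
by field.
Qed.

Lemma weak_ODE_G phi : test_function phi ->
  Rint (fun x => dG u x * derive1 phi x)
  = - Rint (fun x => (b0 * sG u x - kap / 2 * sF u x ^+ 2) * phi x).
Proof.
move=> tphi; have hphi := test_h1 tphi.
have hv : h2 (State (fun=> 0) (fun=> 0) phi (derive1 phi)) by split => //; exact: h1_0.
have := weak_Euler_Lagrange hv; rewrite /Bn /J1 /=.
have [hF hG] := hu; have [LG LdG _] := hG; have [Lphi _ _] := hphi.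
under [X in X + _ + _ + _ = _]eq_Rint do rewrite mulr0.
under [X in _ + _ * X + _ = _]eq_Rint do rewrite mulr0.
under [X in _ = _ * X]eq_Rint do rewrite mulr0 mulr0 add0r.
have I1 := Ig3 hF hF hphi; have I2 := L2M LG Lphi.
rewrite Rint0 mulr0 !addr0 add0r => H.
have E : (fun x => (b0 * sG u x - kap / 2 * sF u x ^+ 2) * phi x)
  = fun x => b0 * (sG u x * phi x) - kap / 2 * (sF u x * sF u x * phi x).
  by apply/funext => x; ring.
rewrite E RintB; [|exact: IgZ|exact: IgZ]; rewrite !RintZ//.
move: H; set A := Rint _; set B := Rint _; set C := Rint _ => H.
have -> : A = kap / 2 * C - b0 * B by rewrite -H addrK.
by field.
Qed.

(** By du Bois-Reymond's lemma [p] differs a.e. by a constant from a primitive of [r]. This gives a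
    C^1 version P of [p]; integrals do not see the change, so P is the classical derivative of
    [F]. *)
Lemma weak_deriv_C1 F p r : h1 F p -> continuous r ->
  (forall phi, test_function phi ->
     Rint (fun x => p x * derive1 phi x) = - Rint (fun x => r x * phi x)) ->
  exists P, forall x, dv F x (P x) /\ dv P x (r x).
Proof.
move=> [LF Lp AF] cr H; have lr := continuous_loc1 cr; have lp := L2_loc1 Lp.
have AP := AC_primitive lr; have DP := dv_AC AP cr.
have cP : continuous (primitive r) by move=> x; exact: dv_continuous (DP x).
have lP := continuous_loc1 cP.
have [c Hc] : exists c, {ae mu, forall x, p x - primitive r x = c}.
  apply: ae_cst_test.
    by split; [exact: measurable_funB lp.1 lP.1|move=> x y; apply: IgB => //; [exact: lp.2|exact: lP.2]].
  move=> phi tphi; have tpsi := test_derive tphi.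
  under eq_Rint do rewrite mulrBl.
  rewrite RintB; [|exact: Ig_mul_test|exact: Ig_mul_test].
  by rewrite H// (AC_by_parts AP lP tphi) subrr.
pose P x := primitive r x + c.
have DP' x : dv P x (r x) by apply: dv_eq (dvD (DP x) (dv_cst c x)) _; rewrite addr0.
have cP' : continuous P by move=> x; exact: dv_continuous (DP' x).
have lP' := continuous_loc1 cP'.
exists P => x; split => //; apply: dv_AC => //; split => // y z yz.
rewrite AF.2// -!Rint_indic; apply: Rint_ae.
- by apply: measurable_funM; [exact: lp.1|exact: measurable_indic].
- by apply: measurable_funM; [exact: lP'.1|exact: measurable_indic].
- by apply: ae_imp Hc => t Ht; rewrite /P -Ht; congr (_ * _); ring.
Qed.

Lemma minimizer_ODE : exists P Q : R -> R, forall x,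
  [/\ dv (sF u) x (P x), dv P x (a0 * sF u x - kap * (sF u x * sG u x)),
      dv (sG u) x (Q x) & dv Q x (b0 * sG u x - kap / 2 * sF u x ^+ 2)].
Proof.
have [hF hG] := hu; have cF := h1_continuous hF; have cG := h1_continuous hG.
have cr1 : continuous (fun x => a0 * sF u x - kap * (sF u x * sG u x)).
  move=> x; apply: cvgB; first by apply: cvgMr; exact: cF.
  by apply: cvgMr; apply: cvgM; [exact: cF|exact: cG].
have cr2 : continuous (fun x => b0 * sG u x - kap / 2 * sF u x ^+ 2).
  move=> x; apply: cvgB; first by apply: cvgMr; exact: cG.
  by apply: cvgMr; apply: (cvgM (cF x) (cF x)).
have [P HP] := weak_deriv_C1 hF cr1 weak_ODE_F.
have [Q HQ] := weak_deriv_C1 hG cr2 weak_ODE_G.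
by exists P, Q => x; have [? ?] := HP x; have [? ?] := HQ x.
Qed.

End Euler_Lagrange.

(** * From the ordinary differential system to travelling waves *)

Section travelling_waves.
Variable R : realType.
Local Open Scope complex_scope.
Implicit Types (Phi Psi P Q : R -> R) (x t : R).

Lemma dv_ode_solution a0 b0 Phi Psi P Q :
  (forall x, [/\ dv Phi x (P x), dv P x (a0 * Phi x - Phi x * Psi x),
     dv Psi x (Q x) & dv Q x (b0 * Psi x - 2^-1 * Phi x ^+ 2)]) ->
  ode_solution a0 b0 Phi Psi.
Proof.
move=> H; have E1 : derive1 Phi = P by apply: derive1_funext => x; case: (H x).
have E2 : derive1 Psi = Q by apply: derive1_funext => x; case: (H x).
move=> x; rewrite !derive1nS !derive1n0 E1 E2; have [D1 D2 D3 D4] := H x.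
split; first by split; [exact: dv_derivable D1|exact: dv_derivable D2|exact: dv_derivable D3|exact: dv_derivable D4].
by rewrite (dv_derive1 D2) (dv_derive1 D4); split; ring.
Qed.

Lemma cdvP (z : R -> R[i]) x (a b : R) :
  dv (fun y => complex.Re (z y)) x a -> dv (fun y => complex.Im (z y)) x b ->
  cderivable z x /\ cderive z x = a +i* b.
Proof.
move=> Da Db; split; first by split; [exact: dv_derivable Da|exact: dv_derivable Db].
by rewrite /cderive (dv_derive1 Da) (dv_derive1 Db).
Qed.

Lemma expi_scaleE (th c : R) : expi th * c%:C = (cos th * c) +i* (sin th * c).
Proof. by rewrite /expi; apply/eqP; rewrite eq_complex /=; apply/andP; split; apply/eqP; ring. Qed.

Lemma dv_cos (k t : R) : dv (fun y => cos (k * y)) t (- k * sin (k * t)).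
Proof.
have H : dv (fun y => k * y) t k by apply: dv_eq (dvZ k (dv_id t)) _; rewrite mulr1.
by apply: dv_eq (dv_comp (is_derive_cos (k * t)) H) _; ring.
Qed.

Lemma dv_sin (k t : R) : dv (fun y => sin (k * y)) t (k * cos (k * t)).
Proof.
have H : dv (fun y => k * y) t k by apply: dv_eq (dvZ k (dv_id t)) _; rewrite mulr1.
by apply: dv_eq (dv_comp (is_derive_sin (k * t)) H) _; ring.
Qed.

Lemma cderive_wave k (F P r : R -> R) :
  (forall x, dv F x (P x)) -> (forall x, dv P x (r x)) ->
  let W x t := expi (k * t) * (F x)%:C in forall x t,
  [/\ cderivable (W x) t, cderivable (W ^~ t) x & cderivable (cderive (W ^~ t)) x] /\
  cderive (W x) t = (- k * sin (k * t) * F x) +i* (k * cos (k * t) * F x) /\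
  cderive (cderive (W ^~ t)) x = (cos (k * t) * r x) +i* (sin (k * t) * r x).
Proof.
move=> DF DP W x t.
have [A1 A2] : cderivable (W x) t /\ cderive (W x) t
    = (- k * sin (k * t) * F x) +i* (k * cos (k * t) * F x).
  apply: cdvP.
    under eq_fun do rewrite /W expi_scaleE /=.
    by apply: dv_eq (dvM (dv_cos k t) (dv_cst (F x) t)) _; ring.
  under eq_fun do rewrite /W expi_scaleE /=.
  by apply: dv_eq (dvM (dv_sin k t) (dv_cst (F x) t)) _; ring.
have B y : cderivable (W ^~ t) y /\ cderive (W ^~ t) y
    = (cos (k * t) * P y) +i* (sin (k * t) * P y).
  by apply: cdvP; under eq_fun do rewrite /W expi_scaleE /=; exact: dvZ.
have [C1 C2] : cderivable (cderive (W ^~ t)) x /\ cderive (cderive (W ^~ t)) x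
    = (cos (k * t) * r x) +i* (sin (k * t) * r x).
  by apply: cdvP; under eq_fun do rewrite (B _).2 /=; exact: dvZ.
by split; [split; [exact: A1|exact: (B x).1|exact: C1]|split; [exact: A2|exact: C2]].
Qed.

(** The phases match: conj(W) V carries e^(i sigma t) like W, and W^2 carries e^(2 i sigma t) like
    V. The time derivatives contribute - sigma and - 2 mu sigma, which turn alpha and beta into the
    coefficients of the system. *)
Lemma dv_nls_solution alpha beta sigma mu Phi Psi P Q :
  (forall x, [/\ dv Phi x (P x), dv P x ((alpha + sigma) * Phi x - Phi x * Psi x),
     dv Psi x (Q x) & dv Q x ((beta + 2 * mu * sigma) * Psi x - 2^-1 * Phi x ^+ 2)]) ->
  nls_solution alpha beta mu (fun x t => expi (sigma * t) * (Phi x)%:C)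
     (fun x t => expi (2 * sigma * t) * (Psi x)%:C).
Proof.
move=> H x t.
have DF y : dv Phi y (P y) by case: (H y).
have DP y : dv P y ((alpha + sigma) * Phi y - Phi y * Psi y) by case: (H y).
have DG y : dv Psi y (Q y) by case: (H y).
have DQ y : dv Q y ((beta + 2 * mu * sigma) * Psi y - 2^-1 * Phi y ^+ 2) by case: (H y).
have [HW [Wt Wxx]] := cderive_wave sigma DF DP x t.
have [HV [Vt Vxx]] := cderive_wave (2 * sigma) DG DQ x t.
split; first exact: HW.
split; first exact: HV.
rewrite Wt Wxx Vt Vxx !expi_scaleE.
(* The double-angle formulas reduce the equations to polynomial identities modulo C^2 + S^2 = 1. *)
have E1 : cos (2 * sigma * t) = cos (sigma * t) ^+ 2 - sin (sigma * t) ^+ 2.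
  rewrite (_ : 2 * sigma * t = sigma * t + sigma * t); last by ring.
  by rewrite cosD.
have E2 : sin (2 * sigma * t) = 2 * (sin (sigma * t) * cos (sigma * t)).
  rewrite (_ : 2 * sigma * t = sigma * t + sigma * t); last by ring.
  by rewrite sinD; ring.
have E3 := cos2Dsin2 (sigma * t).
have half : (2^-1 : R[i]) = (2^-1 : R)%:C.
  by rewrite fmorphV rmorph_nat.
rewrite E1 E2 half; move: (cos (sigma * t)) (sin (sigma * t)) E3 => C S E3.
split; apply/eqP; rewrite eq_complex /=; apply/andP; split; apply/eqP.
- transitivity (C * Phi x * Psi x * (C ^+ 2 + S ^+ 2 - 1)); first by ring.
  by rewrite E3 subrr mulr0.
- transitivity (S * Phi x * Psi x * (C ^+ 2 + S ^+ 2 - 1)); first by ring.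
  by rewrite E3 subrr mulr0.
- by field.
- by field.
Qed.
End travelling_waves.

(** * Vanishing at infinity, comparison with exponentials, decay of derivatives *)

Section exponential_decay.
Variable R : realType.
Local Notation mu := (@lebesgue_measure R).
Implicit Types (f g h F G p q u : R -> R) (x y t a b c d e B K : R).

Lemma int_tail f e : Ig setT f -> (forall x, 0 <= f x) -> 0 < e ->
  exists2 B : R, 0 < B & forall x, B <= `|x| -> \int[mu]_(t in `[x, x + 1]) f t <= e.
Proof.
move=> If f0 e0; have mf := Ig_meas If.
pose A n : set R := ~` `[- n%:R, n%:R]%classic.
have mA n : measurable (A n) by exact: measurableC.
have mfA n : measurable_fun setT (fun x => f x * \1_(A n) x).
  by apply: measurable_funM => //; exact: measurable_indic.
have bd n x : `|f x * \1_(A n) x| <= f x.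
  by rewrite indicE; case: (_ \in _); rewrite ?mulr1 ?mulr0 ?normr0// ger0_norm.
have cv x : f x * \1_(A n) x @[n --> \oo] --> (0 : R).
  apply/cvg_eps_N => r r0; exists (Num.truncn `|x|).+1 => n Nn.
  suff -> : \1_(A n) x = 0 :> R by rewrite mulr0 subrr normr0.
  rewrite indicE memNset// => HA; apply: HA; rewrite /= in_itv/= -ler_norml.
  apply: (@le_trans _ _ ((Num.truncn `|x|).+1)%:R); first by rewrite ltW// truncnS_gt.
  by rewrite ler_nat.
have := Rint_dominated mfA (measurable_cst _) cv If bd.
rewrite Rint0 => /cvg_eps_N /(_ e e0)[N /(_ N (leqnn N))].
(* The margin 2 keeps [x, x + 1] away from [- N, N] for negative x as well. *)
rewrite subr0 => H; exists (N%:R + 2); first by rewrite ltr_wpDl.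
move=> x Bx; rewrite -Rint_indic; apply/ltW; apply: le_lt_trans H.
apply: le_trans (ler_norm _); apply: le_Rint => [||t].
- by apply: Ig_indic => //; exact: IgT.
- by apply: Ig_indic => //; exact: IgT.
- apply: ler_wpM2l => //; rewrite !indicE ler_nat.
  have [/set_mem tx|//] := boolP (t \in `[x, x + 1]%classic).
  rewrite mem_set// /A /= => tN; move: tx tN; rewrite /= !in_itv/=.
  move=> /andP[t1 t2] /andP[t3 t4]; move: Bx; rewrite leNgt => /negP; apply.
  by rewrite ltr_norml; apply/andP; split; lra.
Qed.

(** The local sup bound involves integrals over [x, x + 1] only, and these are tails of convergent
    integrals. *)
Lemma h1_vanish F p e : h1 F p -> 0 < e ->
  exists2 B : R, 0 < B & forall x, B <= `|x| -> F x ^+ 2 <= e.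
Proof.
move=> hF e0; have [[_ IF] [_ Ip] _] := hF.
have e4 : 0 < e / 4 by rewrite divr_gt0.
have [B1 B10 H1] := int_tail IF (fun x => sqr_ge0 _) e4.
have [B2 B20 H2] := int_tail Ip (fun x => sqr_ge0 _) e4.
exists (Num.max B1 B2); first by rewrite lt_max B10.
move=> x; rewrite ge_max => /andP[/H1 h1x /H2 h2x].
by apply: (le_trans (h1_sup_local x hF)); lra.
Qed.

(* With [z = u' + d u], the function [z e^{-d x}] is nondecreasing; were [z]
   positive somewhere, [u] would grow like [e^{d x}].  So [z <= 0], that is
   [u e^{d x}] is nonincreasing. *)
Lemma exp_comparison d K B u u1 u2 : 0 < d ->
  (forall x, dv u x (u1 x)) -> (forall x, dv u1 x (u2 x)) ->
  (forall x, B <= x -> d ^+ 2 * u x <= u2 x) -> (forall x, B <= x -> u x <= K) ->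
  forall x, B <= x -> u x <= u B * expR (- d * (x - B)).
Proof.
move=> d0 D1 D2 H HK.
pose z x := u1 x + d * u x.
have Dz x : dv (fun y => z y * expR (- d * y)) x ((u2 x - d ^+ 2 * u x) * expR (- d * x)).
  apply: dv_eq (dvM (dvD (D2 x) (dvZ d (D1 x))) (dv_expR (- d) x)) _.
  by rewrite /z; ring.
have Du x : dv (fun y => u y * expR (d * y)) x (z x * expR (d * x)).
  by apply: dv_eq (dvM (D1 x) (dv_expR d x)) _; rewrite /z; ring.
have ee x : expR (d * x) * expR (- d * x) = 1 by rewrite -expRD mulNr subrr expR0.
have z0 x0 : B <= x0 -> z x0 <= 0.
  move=> Bx0; rewrite leNgt; apply/negP => zp.
  pose c := z x0 * expR (- d * x0).
  have c0 : 0 < c by rewrite mulr_gt0// expR_gt0.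
  have zc x : x0 <= x -> c * expR (d * x) <= z x.
    move=> xx; have : c <= z x * expR (- d * x).
      apply: (dv_le xx (fun y _ => Dz y)) => y /andP[x0y _].
      by rewrite mulr_ge0 ?expR_ge0// subr_ge0 H//; lra.
    move=> /(ler_wpM2r (expR_ge0 (d * x))).
    by rewrite -(mulrA (z x)) (mulrC (expR (- d * x))) ee mulr1.
  pose k := c / (2 * d).
  have k0 : 0 < k by rewrite divr_gt0// mulr_gt0.
  (* k e^(2 d x) is a primitive of c e^(2 d x), a lower bound for the derivative of u e^(d x) beyond
     x0; that w is nondecreasing there forces u to grow like k e^(d x). *)
  pose w x := u x * expR (d * x) - k * expR (2 * d * x).
  have Dw x : dv w x (z x * expR (d * x) - c * expR (2 * d * x)).
    apply: dv_eq (dvB (Du x) (dvZ k (dv_expR (2 * d) x))) _.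
    by rewrite /k; field; rewrite gt_eqF.
  have e2 x : expR (2 * d * x) = expR (d * x) * expR (d * x).
    by rewrite -expRD; congr expR; ring.
  have wx x : x0 <= x -> w x0 <= w x.
    move=> xx; apply: (dv_le xx (fun y _ => Dw y)) => y /andP[x0y _].
    by rewrite e2 mulrA -mulrBl mulr_ge0 ?expR_ge0// subr_ge0; exact: zc.
  pose m := `|K| + `|w x0|.
  have m0 : 0 <= m by rewrite addr_ge0.
  (* By e^y >= 1 + y this x gives k e^(d x) >= k + |K| + |w x0|, too large for the bound u <= K. *)
  pose x := `|x0| + (1 + m / k) / d.
  have xx0 : x0 <= x.
    rewrite /x; apply: (le_trans (ler_norm _)); rewrite lerDl divr_ge0 ?(ltW d0)//.
    by rewrite addr_ge0// divr_ge0// ltW.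
  have Ex : 1 + m / k <= expR (d * x).
    apply: (le_trans _ (expR_ge1Dx _)).
    have -> : d * x = d * `|x0| + (1 + m / k) by rewrite /x; field; rewrite !gt_eqF.
    have : 0 <= d * `|x0| by rewrite mulr_ge0// ltW.
    lra.
  have mk : 0 <= m / k by rewrite divr_ge0// ltW.
  have kE : k + m <= k * expR (d * x).
    apply: le_trans (ler_wpM2l (ltW k0) Ex).
    by rewrite mulrDr mulr1 mulrCA divff ?gt_eqF// mulr1.
  have E1 : 1 <= expR (d * x) by lra.
  have := wx x xx0; rewrite {2}/w e2.
  have := HK x (le_trans Bx0 xx0).
  have := ler_norm K; have := ler_norm (- w x0); rewrite normrN.
  move: kE E1; rewrite /m; move: (expR _) => E kE E1 h3 h4 h5 h6.
  have a1 : u x * E <= K * E by rewrite ler_wpM2r//; lra.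
  have a2 : K * E <= `|K| * E by rewrite ler_wpM2r//; lra.
  have a3 : (k + (`|K| + `|w x0|)) * E <= k * E * E by rewrite ler_wpM2r//; lra.
  have a4 : `|w x0| * 1 <= `|w x0| * E by rewrite ler_wpM2l.
  have a5 : 0 < k * E by rewrite mulr_gt0//; lra.
  move: h3 h6 a1 a2 a3 a4 a5; rewrite !mulrDl !mulrA; clear; lra.
move=> x Bx; have : - (u B * expR (d * B)) <= - (u x * expR (d * x)).
  apply: (dv_le Bx (fun y _ => dvN (Du y))) => y /andP[By _].
  by rewrite oppr_ge0 mulr_le0_ge0 ?expR_ge0 ?z0.
rewrite lerN2 => /(ler_wpM2r (expR_ge0 (- d * x))).
rewrite -mulrA ee mulr1 -mulrA -expRD => /le_trans; apply.
by rewrite le_eqVlt; apply/orP; left; apply/eqP; congr (_ * expR _); ring.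
Qed.

Definition expdec d f : Prop := exists C, forall x, `|f x| <= C * expR (- d * `|x|).

Lemma expR_le1 d x : 0 < d -> expR (- d * `|x|) <= 1.
Proof. by move=> d0; rewrite -[leRHS]expR0 ler_expR mulNr oppr_le0 mulr_ge0// ltW. Qed.

Lemma expdecD d f g : expdec d f -> expdec d g -> expdec d (fun x => f x + g x).
Proof.
move=> [C HC] [D HD]; exists (C + D) => x; rewrite mulrDl.
by apply: (le_trans (ler_normD _ _)); exact: lerD.
Qed.

Lemma expdecZ d c f : expdec d f -> expdec d (fun x => c * f x).
Proof. by move=> [C HC]; exists (`|c| * C) => x; rewrite normrM -mulrA ler_wpM2l. Qed.

Lemma expdecM d f g : 0 < d -> expdec d f -> expdec d g -> expdec d (fun x => f x * g x).
Proof.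
move=> d0 [C HC] [D HD]; exists (C * D) => x; rewrite normrM.
have E0 := expR_gt0 (- d * `|x|).
have D0 : 0 <= D by have := le_trans (normr_ge0 _) (HD x); rewrite pmulr_lge0.
rewrite -mulrA; apply: (le_trans (ler_pM (normr_ge0 _) (normr_ge0 _) (HC x) (HD x))).
rewrite -!mulrA ler_wpM2l//.
  by have := le_trans (normr_ge0 _) (HC x); rewrite pmulr_lge0.
rewrite mulrCA ler_wpM2l//; rewrite -[leRHS]mulr1 ler_wpM2l ?(ltW E0)//.
exact: expR_le1.
Qed.

Lemma expdec_opp d f : expdec d f -> expdec d (fun x => - f x).
Proof. by move=> [C HC]; exists C => x; rewrite normrN. Qed.

Lemma mvt f g a b : a <= b -> (forall x, dv f x (g x)) ->
  exists2 c : R, a <= c <= b & f b - f a = g c * (b - a).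
Proof.
move=> ab H; have [||c] := @MVT_segment R f g a b ab.
- by move=> x _; exact: H.
- by apply: derivable_within_continuous => x _; exact: dv_derivable (H x).
- by rewrite in_itv/= => cab E; exists c.
Qed.

Lemma expdec_near d C g x y : 0 < d -> (forall x, `|g x| <= C * expR (- d * `|x|)) ->
  `|x - y| <= 1 -> `|g y| <= C * expR d * expR (- d * `|x|).
Proof.
move=> d0 H xy; apply: (le_trans (H y)).
have C0 : 0 <= C.
  by have := le_trans (normr_ge0 _) (H 0); rewrite pmulr_lge0// expR_gt0.
rewrite -mulrA ler_wpM2l// -expRD ler_expR.
have : `|x| <= `|y| + 1.
  by rewrite -[x](subrK y) addrC; apply: (le_trans (ler_normD _ _)); rewrite lerD2l.
by move=> /(ler_wpM2l (ltW d0)); lra.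
Qed.

(** By the mean value theorem, where moving by at most 1 costs a factor e^d. The decaying Lipschitz
    constant serves for derivatives and for the diagonal of the Slobodeckij integral. *)
Lemma expdec_lipschitz d f g : 0 < d -> (forall x, dv f x (g x)) -> expdec d g ->
  exists C, forall x y, `|x - y| <= 1 -> `|f x - f y| <= C * expR (- d * `|x|) * `|x - y|.
Proof.
move=> d0 H [C HC]; exists (C * expR d) => x y xy.
have [z zx ->] : exists2 z : R, `|x - z| <= 1 & `|f x - f y| = `|g z| * `|x - y|.
  have [yx|/ltW yx] := leP y x.
    have [z /andP[z1 z2] ->] := mvt yx H; exists z; last by rewrite normrM.
    by move: xy; rewrite !ler_norml => /andP[? ?]; apply/andP; split; lra.
  have [z /andP[z1 z2] E] := mvt yx H; exists z; last by rewrite distrC E normrM distrC.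
  by move: xy; rewrite !ler_norml => /andP[? ?]; apply/andP; split; lra.
by rewrite ler_wpM2r//; exact: (expdec_near d0 HC zx).
Qed.

(** Decay of f and f'' gives decay of f': f (x + 1) - f x is f' at some z in [x, x + 1], and f' x -
    f' z is controlled by f''. *)
Lemma expdec_derivative d f g h : 0 < d -> (forall x, dv f x (g x)) ->
  (forall x, dv g x (h x)) -> expdec d f -> expdec d h -> expdec d g.
Proof.
move=> d0 Df Dg [C HC] /(expdec_lipschitz d0 Dg)[D HD].
exists (C * expR d + C + D) => x.
have x1 : x <= x + 1 by rewrite lerDl.
have [z /andP[z1 z2]] := mvt x1 Df; rewrite (addrC x) addrK mulr1 => E.
have xz : `|x - z| <= 1 by rewrite ler_norml; apply/andP; split; lra.
have -> : g x = f (1 + x) + (- f x + (g x - g z)) by rewrite -E; ring.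
apply: (le_trans (ler_normD _ _)); rewrite mulrDl mulrDl -addrA lerD//.
  apply: (expdec_near d0 HC); rewrite ler_norml; apply/andP; split; lra.
apply: (le_trans (ler_normD _ _)); rewrite normrN lerD//.
have DE : 0 <= D * expR (- d * `|x|).
  by have := HD x (x - 1); rewrite opprB addrCA subrr addr0 normr1 mulr1 => /(_ (lexx _)); exact: le_trans.
by apply: (le_trans (HD x z xz)); rewrite -[leRHS]mulr1 ler_wpM2l.
Qed.

End exponential_decay.

(** * Exponential decay of solutions and of all their derivatives *)

Section elliptic_system.
Variable R : realType.
Implicit Types (f h r : R -> R) (x y e : R).
Variables (a0 b0 kap : R) (F G P Q p q : R -> R).
Hypotheses (a0_gt0 : 0 < a0) (b0_gt0 : 0 < b0) (hF : h1 F p) (hG : h1 G q).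
Hypothesis ode : forall x,
  [/\ dv F x (P x), dv P x (a0 * F x - kap * (F x * G x)),
      dv G x (Q x) & dv Q x (b0 * G x - kap / 2 * F x ^+ 2)].

Let u x := F x ^+ 2 + G x ^+ 2.
Let u1 x := 2 * F x * P x + 2 * G x * Q x.
(** In the cubic term, 2 kap comes from the first equation and kap from the second. *)
Let u2 x := 2 * P x ^+ 2 + 2 * Q x ^+ 2 + 2 * a0 * F x ^+ 2 + 2 * b0 * G x ^+ 2
  - 3 * kap * G x * F x ^+ 2.

Let dvu x : dv u x (u1 x).
Proof. by have [D1 _ D2 _] := ode x; exact: dvD (dvX2 D1) (dvX2 D2). Qed.

Let dvu1 x : dv u1 x (u2 x).
Proof.
have [D1 D2 D3 D4] := ode x.
apply: dv_eq (dvD (dvM (dvZ 2 D1) D2) (dvM (dvZ 2 D3) D4)) _.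
by rewrite /u2; field.
Qed.

Let d := Num.sqrt (Num.min a0 b0).

Let d_gt0 : 0 < d.
Proof. by rewrite sqrtr_gt0 lt_min a0_gt0. Qed.

(** Far out |3 kap G| <= a0, which is what the choice of e ensures, so the cubic term consumes at
    most half of 2 a0 F^2. *)
Let u_subsolution : exists2 B : R, 0 < B & forall x, B <= `|x| -> d ^+ 2 * u x <= u2 x.
Proof.
pose e := a0 / (3 * (`|kap| + 1)).
have k1 : 0 < 3 * (`|kap| + 1) by rewrite mulr_gt0// ltr_wpDl.
have e0 : 0 < e by rewrite divr_gt0.
have [B B0 HB] := h1_vanish hG (exprn_gt0 2 e0).
exists B => // x /HB /(norm_le_sqr (ltW e0)) Ge.
have kG : 3 * kap * G x <= a0.
  apply: (le_trans (ler_norm _)); rewrite !normrM ger0_norm//.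
  apply: (@le_trans _ _ (3 * (`|kap| + 1) * e)).
    rewrite ler_pM ?mulr_ge0// ler_wpM2l//; lra.
  by rewrite /e mulrC divfK// gt_eqF.
have d2 : d ^+ 2 = Num.min a0 b0 by rewrite sqr_sqrtr// ltW// lt_min a0_gt0.
have m1 : Num.min a0 b0 <= a0 by rewrite ge_min lexx.
have m2 : Num.min a0 b0 <= b0 by rewrite ge_min lexx orbT.
have s1 := ler_wpM2r (sqr_ge0 (F x)) m1; have s2 := ler_wpM2r (sqr_ge0 (G x)) m2.
have s3 := ler_wpM2r (sqr_ge0 (F x)) kG.
have s4 := sqr_ge0 (P x); have s5 := sqr_ge0 (Q x).
have s6 : 0 <= b0 * G x ^+ 2 by rewrite mulr_ge0 ?sqr_ge0// ltW.
by rewrite d2 /u2 /u mulrDr; lra.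
Qed.

Let u_bounded : exists2 K : R, 0 <= K & forall x, u x <= K.
Proof.
pose S := Rint (fun t => F t ^+ 2) + Rint (fun t => p t ^+ 2).
pose T := Rint (fun t => G t ^+ 2) + Rint (fun t => q t ^+ 2).
have HK x : u x <= 2 * S + 2 * T by apply: lerD; exact: h1_sup.
by exists (2 * S + 2 * T) => //; apply: le_trans (HK 0); rewrite addr_ge0// sqr_ge0.
Qed.

Let u_decay : expdec d u.
Proof.
have [B B0 HB] := u_subsolution; have [K K0 HK] := u_bounded.
have u0 x : 0 <= u x by rewrite addr_ge0// sqr_ge0.
exists (K * expR (d * B)) => x; rewrite ger0_norm// -mulrA -expRD.
have Hr y : B <= y -> u y <= u B * expR (- d * (y - B)).
  apply: (exp_comparison d_gt0 dvu dvu1) => [z Bz|z _]; last exact: HK.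
  by apply: HB; rewrite ger0_norm//; lra.
have dn y : dv (fun x => - x) y (-1 : R) by exact: dvN (dv_id y).
have Hl y : B <= y -> u (- y) <= u (- B) * expR (- d * (y - B)).
  have E1 z : dv (fun x => u (- x)) z (- u1 (- z)).
    by apply: dv_eq (dv_comp (dvu (- z)) (dn z)) _; ring.
  have E2 z : dv (fun x => - u1 (- x)) z (u2 (- z)).
    by apply: dv_eq (dvN (dv_comp (dvu1 (- z)) (dn z))) _; ring.
  apply: (exp_comparison d_gt0 E1 E2) => [z Bz|z _]; last exact: HK.
  by apply: HB; rewrite normrN ger0_norm//; lra.
have bound y z : u y <= u z * expR (- d * (`|x| - B)) -> u y <= K * expR (d * B + - d * `|x|).
  move=> /le_trans; apply; rewrite (_ : - d * (`|x| - B) = d * B + - d * `|x|); last by ring.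
  by rewrite ler_wpM2r ?expR_ge0.
have [xB|xB] := leP B `|x|.
  have [x0|/ltW x0] := leP 0 x.
    by apply: (bound _ B); rewrite ger0_norm//; apply: Hr; rewrite -(ger0_norm x0).
  apply: (bound _ (- B)); rewrite ler0_norm// -{1}[x]opprK; apply: Hl.
  by rewrite -(ler0_norm x0).
(* For |x| < B the factor e^(d B) in the constant outweighs e^(- d |x|), and boundedness is
   enough. *)
apply: (le_trans (HK x)); rewrite ler_peMr// -[leLHS]expR0 ler_expR mulNr subr_ge0.
by rewrite ler_wpM2l// ltW.
Qed.

Let sqrt_decay f : (forall x, f x ^+ 2 <= u x) -> expdec (d / 2) f.
Proof.
move=> fu; have [C HC] := u_decay; exists (Num.sqrt C) => x.
apply: norm_le_sqr; first by rewrite mulr_ge0 ?expR_ge0 ?sqrtr_ge0.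
have C0 : 0 <= C by have := le_trans (normr_ge0 _) (HC 0); rewrite pmulr_lge0// expR_gt0.
apply: (le_trans (fu x)); apply: (le_trans (ler_norm _)); apply: (le_trans (HC x)).
rewrite exprMn sqr_sqrtr// -expRM_natl ler_wpM2l// ler_expR le_eqVlt.
by apply/orP; left; apply/eqP; field.
Qed.

(* Closed under differentiation because of the equations, so it contains all
   derivatives of [F] and [G]. *)
Inductive ode_algebra : (R -> R) -> Prop :=
| ode_algebraF : ode_algebra F
| ode_algebraG : ode_algebra G
| ode_algebraP : ode_algebra P
| ode_algebraQ : ode_algebra Q
| ode_algebraZ c f : ode_algebra f -> ode_algebra (fun x => c * f x)
| ode_algebraD f h : ode_algebra f -> ode_algebra h -> ode_algebra (fun x => f x + h x)
| ode_algebraM f h : ode_algebra f -> ode_algebra h -> ode_algebra (fun x => f x * h x).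

(** F^2 <= u and G^2 <= u halve the rate d of u. For P and Q, [expdec_derivative] applies, since the
    equations express the second derivatives of F and G by decaying terms. *)
Lemma ode_algebra_expdec f : ode_algebra f -> expdec (d / 2) f.
Proof.
have d2 : 0 < d / 2 by rewrite divr_gt0.
have HF : expdec (d / 2) F by apply: sqrt_decay => x; rewrite lerDl sqr_ge0.
have HG : expdec (d / 2) G by apply: sqrt_decay => x; rewrite lerDr sqr_ge0.
have D1 x : dv F x (P x) by case: (ode x).
have D2 x : dv P x (a0 * F x - kap * (F x * G x)) by case: (ode x).
have D3 x : dv G x (Q x) by case: (ode x).
have D4 x : dv Q x (b0 * G x - kap / 2 * F x ^+ 2) by case: (ode x).
elim=> [//|//|||c f0 _|f0 h0 _ ? _|f0 h0 _ ? _]; last first.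
- exact: expdecM.
- exact: expdecD.
- exact: expdecZ.
- apply: (expdec_derivative d2 D3 D4 HG).
  apply: expdecD; first exact: expdecZ.
  by apply: expdec_opp; apply: expdecZ; exact: (expdecM d2 HF HF).
- apply: (expdec_derivative d2 D1 D2 HF).
  apply: expdecD; first exact: expdecZ.
  by apply: expdec_opp; apply: expdecZ; exact: expdecM.
Qed.

Lemma ode_algebra_derive f : ode_algebra f ->
  exists2 f', ode_algebra f' & forall x, dv f x (f' x).
Proof.
elim=> [|||||f0 h0 _ [f1 Hf Df] _ [h1' Hh Dh]|f0 h0 Hf0 [f1 Hf Df] Hh0 [h1' Hh Dh]].
- by exists P; [exact: ode_algebraP|move=> x; case: (ode x)].
- by exists Q; [exact: ode_algebraQ|move=> x; case: (ode x)].
- exists (fun x => a0 * F x + - kap * (F x * G x)).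
    apply: ode_algebraD; first by apply: ode_algebraZ; exact: ode_algebraF.
    by apply/ode_algebraZ/ode_algebraM; [exact: ode_algebraF|exact: ode_algebraG].
  by move=> x; case: (ode x) => _ D _ _; apply: dv_eq D _; ring.
- exists (fun x => b0 * G x + - (kap / 2) * (F x * F x)).
    apply: ode_algebraD; first by apply: ode_algebraZ; exact: ode_algebraG.
    by apply/ode_algebraZ/ode_algebraM; exact: ode_algebraF.
  by move=> x; case: (ode x) => _ _ _ D; apply: dv_eq D _; ring.
- move=> c f0 _ [f1 Hf Df]; exists (fun x => c * f1 x); first exact: ode_algebraZ.
  by move=> x; exact: dvZ.
- by exists (fun x => f1 x + h1' x); [exact: ode_algebraD|move=> x; exact: dvD].
- exists (fun x => f1 x * h0 x + f0 x * h1' x); last by move=> x; exact: dvM.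
  by apply: ode_algebraD; exact: ode_algebraM.
Qed.

Lemma ode_algebra_derive1n n f : ode_algebra f ->
  ode_algebra (derive1n n f) /\ forall x, dv (derive1n n f) x (derive1n n.+1 f x).
Proof.
have H h : ode_algebra h -> (forall x, derivable h x 1) /\ ode_algebra (derive1 h).
  move=> /ode_algebra_derive[h' Hh' Dh].
  split; first by move=> y; exact: dv_derivable (Dh y).
  by rewrite (derive1_funext Dh).
move=> Hf; have Hn := smooth_closed H n Hf; split => // x.
by rewrite derive1nS; apply: derivable_dv; exact: (H _ Hn).1.
Qed.

Lemma ode_algebra_decay : exists2 d' : R, 0 < d' &
  forall n f, ode_algebra f -> expdec d' (derive1n n f).
Proof.
exists (d / 2); first by rewrite divr_gt0.
by move=> n f /(ode_algebra_derive1n n)[Hn _]; exact: ode_algebra_expdec.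
Qed.

End elliptic_system.

(** * Integrability of exponential and power weights *)

Section integrable_weights.
Variable R : realType.
Local Notation mu := (@lebesgue_measure R).
Implicit Types (f g h : R -> R) (x y t a b c d s theta C : R).

Let S n : set R := `[n.+1%:R^-1, n.+1%:R]%classic.

Let Sn_bounds n : 0 < (n.+1%:R^-1 : R) /\ (n.+1%:R^-1 : R) <= 1 <= (n.+1%:R : R).
Proof. by rewrite invr_gt0 ltr0n invf_le1 ?ltr0n// ler1n. Qed.

(** Evenness reduces to ]0, +oo[, exhausted by the [S n], which stay away from 0, where a weight may
    be singular. Monotone convergence turns the common bound into integrability. *)
Lemma Ig_even f C : measurable_fun setT f -> (forall x, 0 <= f x) ->
  (forall x, f (- x) = f x) ->
  (forall n, Ig (S n) f /\ \int[mu]_(t in S n) f t <= C) -> Ig setT f.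
Proof.
move=> mf f0 fN H.
have mE : measurable_fun setT (EFin \o f) by exact/measurable_EFinP.
have mED (D : set R) : measurable_fun D (EFin \o f) by exact: measurable_funTS.
have UE : `]0%R, +oo[%classic = \bigcup_n S n.
  apply/seteqP; split => x /=; rewrite in_itv/= ?andbT.
    move=> x0; exists (Num.truncn (x + x^-1)) => //=; rewrite /S /= in_itv/=.
    have T : x + x^-1 <= (Num.truncn (x + x^-1)).+1%:R by rewrite ltW// truncnS_gt.
    have xV : 0 < x^-1 by rewrite invr_gt0.
    apply/andP; split; last by move: T; lra.
    by rewrite -[leRHS]invrK lef_pV2 ?posrE ?ltr0n//; move: T; lra.
  case=> n _; rewrite /S /= in_itv/= => /andP[+ _]; apply: lt_le_trans.
  by have [] := Sn_bounds n.
have ndS : nondecreasing_seq S.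
  move=> m n mn; apply/subsetPset => x; rewrite /S /= !in_itv/= => /andP[h1 h2].
  apply/andP; split; last by rewrite (le_trans h2)// ler_nat.
  by apply: le_trans h1; rewrite lef_pV2 ?posrE ?ltr0n// ler_nat.
have mS n : measurable (S n) by exact: measurable_itv.
have Hpos : (\int[mu]_(x in `[0%R, +oo[) (f x)%:E <= C%:E)%E.
  rewrite -integral_itv_obnd_cbnd; last exact: mED.
  rewrite UE.
  have cv := ge0_nondecreasing_set_cvg_integral (mu := mu) ndS mS (fun n => mED (S n))
    (fun n x (_ : S n x) => f0 x : (0 <= (f x)%:E)%E).
  rewrite -(cvg_lim _ cv)//; apply: lime_le; first exact: cvgP cv.
  apply: nearW => n; have [In Cn] := H n.
  have fin : (\int[mu]_(x in S n) (EFin \o f) x)%E \is a fin_num.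
    by apply: integrable_fin_num; [exact: measurable_itv|exact: In].
  by rewrite -(fineK fin) lee_fin.
have Hneg : (\int[mu]_(x in `]-oo, 0%R[) (f x)%:E <= C%:E)%E.
  rewrite integral_itv_bndo_bndc; last exact: mED.
  apply: le_trans Hpos.
  rewrite (ge0_integration_by_substitution0 mE)//=.
  by rewrite le_eqVlt; apply/orP; left; apply/eqP; apply: eq_integral => x _ /=; rewrite fN.
apply/integrableP; split => //.
under eq_integral do rewrite /= ger0_norm//.
rewrite -(setUv `[0%R, +oo[%classic) ge0_integral_setU//=; last first.
- exact/disj_setPCl.
- by move=> x _; rewrite lee_fin.
- by rewrite setUv; exact: mED.
- exact: measurableC.
rewrite setCitvr; apply: (@le_lt_trans _ _ (C%:E + C%:E)%E); first exact: leeD.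
by rewrite -EFinD ltry.
Qed.

Lemma Ig_exp_decay c : 0 < c -> Ig setT (fun x => expR (- c * `|x|)).
Proof.
move=> c0; apply: (@Ig_even _ c^-1).
- apply: (measurableT_comp (@measurable_expR R)).
  by apply: measurable_funM => //; exact: measurable_cst.
- by move=> x; exact: expR_ge0.
- by move=> x; rewrite normrN.
move=> n; have [a0 /andP[a1 b1]] := Sn_bounds n.
move: a0 a1 b1; rewrite /S; set a := _^-1; set b := _%:R => a0 a1 b1.
have [I E] : Ig `[a, b]%classic (fun x => expR (- c * x)) /\
    \int[mu]_(t in `[a, b]) expR (- c * t)
      = - c^-1 * expR (- c * b) - (- c^-1 * expR (- c * a)).
  apply: (FTC2_itv (f := fun x => - c^-1 * expR (- c * x))); first lra.
    move=> x _; apply: dv_eq (dvZ (- c^-1) (dv_expR (- c) x)) _.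
    by field; rewrite gt_eqF.
  by move=> x _; exact: dv_continuous (dv_expR (- c) x).
have EQ x : x \in `[a, b]%classic -> expR (- c * `|x|) = expR (- c * x).
  move=> /set_mem /=; rewrite in_itv/= => /andP[ax _]; rewrite ger0_norm//; lra.
split.
  by apply: eq_integrable I => // x xab /=; rewrite EQ.
have -> : \int[mu]_(t in `[a, b]) expR (- c * `|t|) = \int[mu]_(t in `[a, b]) expR (- c * t)
  by exact: eq_Rintegral.
rewrite E.
have cV : 0 < c^-1 by rewrite invr_gt0.
have h1 : 0 <= c^-1 * expR (- c * b) by rewrite mulr_ge0 ?expR_ge0// ltW.
have h2 : c^-1 * expR (- c * a) <= c^-1 * 1.
  rewrite ler_wpM2l ?(ltW cV)// -[leRHS]expR0 ler_expR mulNr oppr_le0 mulr_ge0// ltW//.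
by move: h1 h2; rewrite !mulNr mulr1; lra.
Qed.

Lemma int_powR s a b : s != 0 -> 0 < a -> a <= b ->
  Ig `[a, b]%classic (fun x => x `^ (s - 1)) /\
  \int[mu]_(t in `[a, b]) (t `^ (s - 1)) = s^-1 * (b `^ s) - s^-1 * (a `^ s).
Proof.
move=> s0 a0 ab; apply: (FTC2_itv (f := fun x => s^-1 * x `^ s)) => // x /andP[ax _].
  have x0 : 0 < x by exact: lt_le_trans ax.
  have D : dv (fun x => x `^ s) x (s * x `^ (s - 1)) by exact: is_derive1_powR.
  by apply: dv_eq (dvZ s^-1 D) _; rewrite mulrA mulVf// mul1r.
have x0 : 0 < x by exact: lt_le_trans ax.
have D : dv (fun x => x `^ (s - 1)) x ((s - 1) * x `^ (s - 1 - 1)) by exact: is_derive1_powR.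
exact: dv_continuous D.
Qed.

(* [min(t^2, 1) / |t|^(1 + 2 theta)] *)
Definition slobodeckij_weight theta t : R :=
  if `|t| <= 1 then `|t| `^ (2 - 2 * theta - 1) else `|t| `^ (- (2 * theta) - 1).

Lemma slobodeckij_weight_ge0 theta t : 0 <= slobodeckij_weight theta t.
Proof. by rewrite /slobodeckij_weight; case: ifP => _; exact: powR_ge0. Qed.

Lemma measurable_slobodeckij_weight theta : measurable_fun setT (slobodeckij_weight theta).
Proof.
have mn : measurable_fun setT (fun x : R => `|x|) by exact: measurableT_comp.
apply: measurable_fun_ifT.
- by apply: measurable_fun_ler => //; exact: measurable_cst.
- exact: (measurableT_comp (@measurable_powR R (2 - 2 * theta - 1)) mn).
- exact: (measurableT_comp (@measurable_powR R (- (2 * theta) - 1)) mn).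
Qed.

(** The exponent 1 - 2 theta exceeds -1 near 0 because theta < 1, and - 1 - 2 theta is below -1 at
    infinity because theta > 0; the two inverses bound the two pieces. *)
Lemma Ig_slobodeckij_weight theta : 0 < theta < 1 -> Ig setT (slobodeckij_weight theta).
Proof.
move=> /andP[t0 t1].
have s1 : 0 < 2 - 2 * theta by lra.
have s2 : 0 < 2 * theta by lra.
apply: (@Ig_even _ ((2 - 2 * theta)^-1 + (2 * theta)^-1)).
- exact: measurable_slobodeckij_weight.
- exact: slobodeckij_weight_ge0.
- by move=> x; rewrite /slobodeckij_weight normrN.
move=> n; have [a0 /andP[a1 b1]] := Sn_bounds n.
move: a0 a1 b1; rewrite /S; set a := _^-1; set b := _%:R => a0 a1 b1.
have [I1 E1] := int_powR (lt0r_neq0 s1) a0 a1.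
have s2N : - (2 * theta) != 0 by rewrite oppr_eq0 gt_eqF.
have [I2 E2] := int_powR s2N ltr01 b1.
have EQ1 x : x \in `[a, 1]%classic -> slobodeckij_weight theta x = x `^ (2 - 2 * theta - 1).
  move=> /set_mem /=; rewrite in_itv/= => /andP[ax x1].
  by rewrite /slobodeckij_weight ger0_norm ?x1//; lra.
have EQ2 x : x \in `[1, b]%classic -> slobodeckij_weight theta x = x `^ (- (2 * theta) - 1).
  move=> /set_mem /=; rewrite in_itv/= => /andP[ax x1].
  rewrite /slobodeckij_weight ger0_norm; last by lra.
  have [x1'|//] := leP x 1.
  have -> : x = 1 by apply/eqP; rewrite eq_le x1' ax.
  by rewrite !powR1.
have J1 : Ig `[a, 1]%classic (slobodeckij_weight theta).
  by apply: eq_integrable I1 => // x xab /=; rewrite EQ1.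
have J2 : Ig `[1, b]%classic (slobodeckij_weight theta).
  by apply: eq_integrable I2 => // x xab /=; rewrite EQ2.
have mw := measurable_slobodeckij_weight theta.
have J : Ig `[a, b]%classic (slobodeckij_weight theta).
  have K1 := Ig_indic (measurable_itv `[a, 1]) J1.
  have K2 := Ig_indic (measurable_itv `[1, b]) J2.
  apply: Ig_le (IgT (measurable_itv `[a, b]) (IgD measurableT K1 K2)) => //.
    exact: measurable_funTS.
  move=> x /=; rewrite in_itv/= => /andP[h1 h2].
  have w0 := slobodeckij_weight_ge0 theta x.
  rewrite ger0_norm// !indicE; have [h|/ltW h] := leP x 1.
    by rewrite (@mem_set _ `[a, 1]%classic x) /= ?in_itv/= ?h1// mulr1 lerDl mulr_ge0.
  by rewrite (@mem_set _ `[1, b]%classic x) /= ?in_itv/= ?h ?h2// mulr1 lerDr mulr_ge0.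
split => //.
rewrite (int_Chasles a1 b1 J).
have -> : \int[mu]_(t in `[a, 1]) slobodeckij_weight theta t
  = \int[mu]_(t in `[a, 1]) (t `^ (2 - 2 * theta - 1)) by exact: eq_Rintegral.
have -> : \int[mu]_(t in `[1, b]) slobodeckij_weight theta t
  = \int[mu]_(t in `[1, b]) (t `^ (- (2 * theta) - 1)) by exact: eq_Rintegral.
rewrite E1 E2 !powR1.
have i1 : 0 <= (2 - 2 * theta)^-1 * a `^ (2 - 2 * theta).
  by rewrite mulr_ge0 ?powR_ge0// invr_ge0 ltW.
have i2 : 0 <= (2 * theta)^-1 * b `^ (- (2 * theta)).
  by rewrite mulr_ge0 ?powR_ge0// invr_ge0 ltW.
by move: i1 i2; rewrite invrN !mulNr !mulr1; lra.
Qed.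

End integrable_weights.

(** * Finiteness of the Slobodeckij seminorm *)

Section slobodeckij_seminorm.
Variable R : realType.
Local Notation mu := (@lebesgue_measure R).
Implicit Types (f g h : R -> R) (x y t c d theta C : R).

Let gker theta h (z : R * R) : R := (h z.1 - h z.2) ^+ 2 / `|z.1 - z.2| `^ (1 + 2 * theta).

Let gker_ge0 theta h z : 0 <= gker theta h z.
Proof. by rewrite divr_ge0 ?sqr_ge0 ?powR_ge0. Qed.

Let measurable_diff : measurable_fun setT (fun z : R * R => z.1 - z.2).
Proof. by apply: measurable_funB; [exact: measurable_fst|exact: measurable_snd]. Qed.

Let measurable_gker theta h : measurable_fun setT h ->
  measurable_fun setT (EFin \o gker theta h).
Proof.
move=> mh; apply/measurable_EFinP.
have m1 : measurable_fun setT (fun z : R * R => h z.1 - h z.2).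
  apply: measurable_funB; first exact: (measurableT_comp mh measurable_fst).
  exact: (measurableT_comp mh measurable_snd).
apply: measurable_funM; first exact: measurable_funX.
have mn : measurable_fun setT (fun z : R * R => `|z.1 - z.2|).
  exact: measurableT_comp.
under eq_fun do rewrite -powRN.
exact: (measurableT_comp (@measurable_powR R (- (1 + 2 * theta))) mn).
Qed.

Let gagliardoE theta h :
  gagliardo theta h = (\int[mu]_x \int[mu]_y (gker theta h (x, y))%:E)%E.
Proof. by []. Qed.

Lemma gagliardo_ae theta f g : measurable_fun setT f -> measurable_fun setT g ->
  {ae mu, forall x, f x = g x} -> gagliardo theta f = gagliardo theta g.
Proof.
move=> mf mg fg; rewrite !gagliardoE.
have mF h (mh : measurable_fun setT h) := @measurable_fun_fubini_tonelli_F _ _ _ _ _ mu _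
  (measurable_gker theta mh) (gker_ge0 theta h : forall z, (0 <= (gker theta h z)%:E)%E).
apply: (@ae_eq_integral _ _ _ mu setT _ _ measurableT (mF _ mf) (mF _ mg)).
apply: ae_imp (fg) => x fgx _.
have mx h (mh : measurable_fun setT h) := measurableT_comp (measurable_gker theta mh) (pair1_measurable x).
apply: (@ae_eq_integral _ _ _ mu setT _ _ measurableT (mx _ mf) (mx _ mg)).
by apply: ae_imp fg => y fgy _; rewrite /= /gker /= fgx fgy.
Qed.

(** The first majorant factors by translation invariance of the inner integral; the second is its
    mirror image, by Tonelli's theorem and evenness of [rho]. *)
Lemma gagliardo_dominated theta h E rho C : measurable_fun setT h ->
  Ig setT E -> Ig setT rho -> (forall x, 0 <= E x) -> (forall x, 0 <= rho x) ->
  (forall x, rho (- x) = rho x) -> 0 <= C ->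
  (forall x y, (h x - h y) ^+ 2 / `|x - y| `^ (1 + 2 * theta)
    <= C * (E x * rho (x - y)) + C * (E y * rho (x - y))) ->
  (gagliardo theta h < +oo)%E.
Proof.
move=> mh IE Irho E0 rho0 rhoN C0 H.
have mE := Ig_meas IE; have mrho := Ig_meas Irho.
pose k (z : R * R) := C * (E z.1 * rho (z.1 - z.2)).
pose k' (z : R * R) := C * (E z.2 * rho (z.1 - z.2)).
have k0 z : (0 <= (k z)%:E)%E by rewrite lee_fin !mulr_ge0.
have k'0 z : (0 <= (k' z)%:E)%E by rewrite lee_fin !mulr_ge0.
have mrho2 : measurable_fun setT (fun z : R * R => rho (z.1 - z.2)).
  exact: (measurableT_comp mrho measurable_diff).
have mk : measurable_fun setT (EFin \o k).
  apply/measurable_EFinP; apply: measurable_funM; first exact: measurable_cst.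
  by apply: measurable_funM => //; exact: (measurableT_comp mE measurable_fst).
have mk' : measurable_fun setT (EFin \o k').
  apply/measurable_EFinP; apply: measurable_funM; first exact: measurable_cst.
  by apply: measurable_funM => //; exact: (measurableT_comp mE measurable_snd).
have mg := measurable_gker theta mh.
have inner x : (\int[mu]_y (k (x, y))%:E = (C * Rint rho * E x)%:E)%E.
  have Ik : Ig setT (fun y => (C * E x) * rho (y + - x)) by apply: IgZ => //; exact: Ig_shift.
  rewrite (_ : (fun y => (k (x, y))%:E) = EFin \o (fun y => (C * E x) * rho (y + - x))); last first.
    by apply/funext => y /=; rewrite /k /= -rhoN opprB mulrA.
  rewrite EFin_Rint// RintZ; last exact: Ig_shift.
  by rewrite Rint_shift//; congr (_%:E); ring.
have outer : (\int[mu]_x \int[mu]_y (k (x, y))%:E < +oo)%E.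
  under eq_integral do rewrite inner.
  by rewrite EFin_Rint ?ltry//; exact: IgZ.
have outer' : (\int[mu]_x \int[mu]_y (k' (x, y))%:E < +oo)%E.
  rewrite (@fubini_tonelli _ _ _ _ _ mu mu _ mk' k'0).
  apply: le_lt_trans outer; rewrite le_eqVlt; apply/orP; left; apply/eqP.
  apply: eq_integral => y _; apply: eq_integral => x _.
  by rewrite /= /k /k' /= -(rhoN (x - y)) opprB.
have mF := @measurable_fun_fubini_tonelli_F _ _ _ _ _ mu _ mk k0.
have mF' := @measurable_fun_fubini_tonelli_F _ _ _ _ _ mu _ mk' k'0.
have mx (p : R * R -> \bar R) (mp : measurable_fun setT p) x := measurableT_comp mp (pair1_measurable x).
rewrite gagliardoE; apply: (@le_lt_trans _ _
  (\int[mu]_x \int[mu]_y (k (x, y))%:E + \int[mu]_x \int[mu]_y (k' (x, y))%:E)%E); last first.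
  by rewrite lte_add_pinfty.
rewrite -ge0_integralD//; last 2 first.
- by move=> x _; exact: integral_ge0.
- by move=> x _; exact: integral_ge0.
apply: ge0_le_integral => //.
- by move=> x _; apply: integral_ge0 => y _; rewrite lee_fin.
- exact: (@measurable_fun_fubini_tonelli_F _ _ _ _ _ mu _ mg (gker_ge0 theta h : forall z, (0 <= (gker theta h z)%:E)%E)).
- exact: emeasurable_funD.
move=> x _; rewrite -ge0_integralD//; last 2 first.
- exact: (mx _ mk x).
- exact: (mx _ mk' x).
apply: ge0_le_integral => //.
- by move=> y _; rewrite lee_fin.
- exact: (mx _ mg x).
- by apply: emeasurable_funD; [exact: (mx _ mk x)|exact: (mx _ mk' x)].
- by move=> y _; rewrite -EFinD lee_fin; exact: H.
Qed.

Lemma expdec_L2 d h : 0 < d -> measurable_fun setT h -> expdec d h -> L2 h.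
Proof.
move=> d0 mh [C HC]; split => //.
have d2 : 0 < 2 * d by lra.
apply: (@Ig_le _ _ _ (fun x => C ^+ 2 * expR (- (2 * d) * `|x|))) => //.
- exact: measurable_funX.
- move=> x _; rewrite ger0_norm ?sqr_ge0// -[leLHS]real_normK ?num_real//.
  rewrite (_ : expR _ = expR (- d * `|x|) ^+ 2).
    by rewrite -exprMn ler_sqr ?nnegrE// (le_trans _ (HC x)).
  by rewrite -expRM_natl; congr expR; ring.
- by apply: IgZ => //; exact: Ig_exp_decay.
Qed.

(** For |x - y| <= 1 the decaying Lipschitz bound contributes D^2; beyond, (h x - h y)^2 <= 2 (h
    x)^2 + 2 (h y)^2 contributes 2 C^2. The constant D^2 + 2 C^2 covers both. *)
Lemma expdec_gagliardo theta d h h' : 0 < theta < 1 -> 0 < d ->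
  (forall x, dv h x (h' x)) -> expdec d h -> expdec d h' ->
  (gagliardo theta h < +oo)%E.
Proof.
move=> th d0 Dh [C HC] /(expdec_lipschitz d0 Dh)[D HD].
have mh : measurable_fun setT h.
  by apply: continuous_meas => x; exact: dv_continuous (Dh x).
pose E x := expR (- (2 * d) * `|x|).
have EE x : E x = expR (- d * `|x|) ^+ 2 by rewrite -expRM_natl; congr expR; ring.
have E0 x : 0 <= E x by exact: expR_ge0.
have w0 := slobodeckij_weight_ge0 theta.
have wN t : slobodeckij_weight theta (- t) = slobodeckij_weight theta t.
  by rewrite /slobodeckij_weight normrN.
apply: (@gagliardo_dominated _ _ E (slobodeckij_weight theta) (D ^+ 2 + 2 * C ^+ 2)) => //.
- by apply: Ig_exp_decay; lra.
- exact: Ig_slobodeckij_weight.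
- by apply: addr_ge0; [exact: sqr_ge0|rewrite mulr_ge0// sqr_ge0].
move=> x y.
have D2 := sqr_ge0 D; have C2 := sqr_ge0 C.
have Wx : 0 <= E x * slobodeckij_weight theta (x - y) by rewrite mulr_ge0.
have Wy : 0 <= E y * slobodeckij_weight theta (x - y) by rewrite mulr_ge0.
have DC : 0 <= D ^+ 2 + 2 * C ^+ 2 by rewrite addr_ge0// mulr_ge0.
have [xy|xy] := eqVneq x y.
  by rewrite {1 2}xy subrr expr0n mul0r addr_ge0// mulr_ge0.
have t0 : 0 < `|x - y| by rewrite normr_gt0 subr_eq0.
have tn : `|x - y| != 0 by rewrite gt_eqF.
have [t1|t1] := leP `|x - y| 1.
  have H1 : (h x - h y) ^+ 2 <= D ^+ 2 * E x * `|x - y| ^+ 2.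
    rewrite EE -!exprMn -[leLHS]real_normK ?num_real// ler_sqr ?nnegrE//; first exact: HD.
    exact: le_trans (HD x y t1).
  have H2 : (h x - h y) ^+ 2 / `|x - y| `^ (1 + 2 * theta)
      <= D ^+ 2 * (E x * slobodeckij_weight theta (x - y)).
    rewrite ler_pdivrMr ?powR_gt0//; apply: (le_trans H1).
    rewrite /slobodeckij_weight t1 -!mulrA -powRD ?tn ?implybT//.
    rewrite (_ : 2 - 2 * theta - 1 + (1 + 2 * theta) = 2%:R); last by ring.
    by rewrite powR_mulrn// ltW.
  apply: (le_trans H2).
  have a1 : 0 <= C ^+ 2 * (E x * slobodeckij_weight theta (x - y)) by rewrite mulr_ge0.
  have a2 : 0 <= (D ^+ 2 + 2 * C ^+ 2) * (E y * slobodeckij_weight theta (x - y)).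
    by rewrite mulr_ge0.
  by rewrite [X in _ <= X + _]mulrDl -!(mulrA 2); move: a1 a2; clear; lra.
have HC2 z : h z ^+ 2 <= C ^+ 2 * E z.
  rewrite EE -exprMn -[leLHS]real_normK ?num_real// ler_sqr ?nnegrE//.
  exact: le_trans (HC z).
have H1 : (h x - h y) ^+ 2 <= 2 * (C ^+ 2 * E x) + 2 * (C ^+ 2 * E y).
  have := HC2 x; have := HC2 y; have := sqr_ge0 (h x + h y).
  rewrite sqrrB sqrrD; move: (h x) (h y) => a b; lra.
have E1 : slobodeckij_weight theta (x - y) = (`|x - y| `^ (1 + 2 * theta))^-1.
  rewrite /slobodeckij_weight leNgt t1 /= -powRN; congr powR; ring.
have v0 : 0 <= (`|x - y| `^ (1 + 2 * theta))^-1 by rewrite invr_ge0 powR_ge0.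
apply: (le_trans (ler_wpM2r v0 H1)); rewrite -E1.
move: Wx Wy => /(mulr_ge0 D2) b1 /(mulr_ge0 D2) b2.
move: b1 b2; rewrite !mulrDl !mulrA; clear; lra.
Qed.

End slobodeckij_seminorm.

(** * Smooth functions with decaying derivatives belong to every H^s *)

Section regularity.
Variable R : realType.
Local Notation mu := (@lebesgue_measure R).
Implicit Types (f g h F : R -> R) (x y s d : R).

Lemma is_weak_deriv_smooth k F : (forall n x, dv (derive1n n F) x (derive1n n.+1 F x)) ->
  is_weak_deriv k F (derive1n k F).
Proof.
move=> HF; have cF n : continuous (derive1n n F).
  by move=> x; exact: dv_continuous (HF n x).
split; [| |move=> phi tphi].
- by apply/locally_integrableP/continuous_loc1; exact: (cF 0%N).
- by apply/locally_integrableP/continuous_loc1; exact: cF.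
(* Derivatives are moved from [phi] to [F] one at a time, each with a factor -1; the number of those
   left is then generalized for the induction. *)
suff H j : Rint (fun x => F x * derive1n (j + (k - j)) phi x) = 
    (-1) ^+ j * Rint (fun x => derive1n j F x * derive1n (k - j) phi x).
  by have := H k; rewrite subnn addn0.
move: (k - j)%N => {k} k; elim: j k => [|j IH] k; first by rewrite expr0 mul1r.
rewrite addSnnS IH derive1nS exprSr -mulrA; congr (_ * _).
have AF : AC (derive1n j F) (derive1n j.+1 F) by apply: AC_dv.
by rewrite (AC_by_parts AF (continuous_loc1 (cF j)) (test_derive1n k tphi)) mulN1r.
Qed.

Lemma expdec_Hinfty f F d : 0 < d -> measurable_fun setT f ->
  {ae mu, forall x, F x = f x} ->
  (forall n x, dv (derive1n n F) x (derive1n n.+1 F x)) ->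
  (forall n, expdec d (derive1n n F)) -> Hinfty f.
Proof.
move=> d0 mf Ff HF eF s s0.
have mF n : measurable_fun setT (derive1n n F).
  by apply: continuous_meas => x; exact: dv_continuous (HF n x).
have LF n : L2 (derive1n n F) by exact: expdec_L2 d0 (mF n) (eF n).
have Lf : L2 f by exact: L2_ae mf Ff (LF 0%N).
have wf k : is_weak_deriv k f (derive1n k F).
  apply: (is_weak_deriv_ae (is_weak_deriv_smooth k HF) (L2_loc1 Lf) (L2_loc1 (LF k))) => //.
  exact: aeW.
split; first exact/L2P.
- by move=> k _; exact: has_weak_derivP (wf k) (LF k).
move=> theta theta0; have [W WE] := weak_derivE (wf (Num.truncn s)).
have mW := (weak_deriv_loc1 W).2.1.
rewrite (gagliardo_ae _ mW (mF _) WE).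
apply: (expdec_gagliardo _ d0 (HF (Num.truncn s)) (eF _) (eF _)).
by rewrite theta0 /theta ltrBlDl -[X in _ + X]/(1%:R) -natrD addn1 truncnS_gt.
Qed.

End regularity.

Local Open Scope complex_scope.

Theorem theorem1p1 (R : realType) (alpha beta sigma mu : R) (mu_gt0 : 0 < mu)
    (alpha0_gt0 : 0 < alpha + sigma) (beta0_gt0 : 0 < beta + 2 * mu * sigma)
    (lambda : R) (lambda_gt0 : 0 < lambda) :
  let alpha0 := alpha + sigma in
  let beta0 := beta + 2 * mu * sigma in
  let M := Mmin alpha0 beta0 lambda in
  let S := Smin alpha0 beta0 lambda in
  (* (i) *)
  ((0 < M)%E /\ (M < +oo)%E) /\
  (* (ii) *)
  ((forall f g : nat -> R -> R,
      (forall n, H1 (f n) /\ H1 (g n)) ->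
      constr (f n) (g n) @[n --> \oo] --> lambda%:E ->
      energy alpha0 beta0 (f n) (g n) @[n --> \oo] --> M ->
      exists (nk : nat -> nat) (y : nat -> R) (phi psi : R -> R),
        [/\ forall k l, (k < l)%N -> (nk k < nk l)%N,
            S (phi, psi),
            H1norm (fun x => f (nk k) (x + y k) - phi x) @[k --> \oo] --> 0%E &
            H1norm (fun x => g (nk k) (x + y k) - psi x) @[k --> \oo] --> 0%E])
   /\ S !=set0) /\
  (* (iii) *)
  (forall phi psi : R -> R, S (phi, psi) ->
     exists c : R, c != 0 /\
     exists phi' psi' : R -> R,
       [/\ continuous_rep phi phi', continuous_rep psi psi' &
           let Phi := fun x => c * phi' x in
           let Psi := fun x => c * psi' x in
           ode_solution alpha0 beta0 Phi Psi /\
           nls_solution alpha beta mu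
             (fun x t => expi (sigma * t) * (Phi x)%:C)
             (fun x t => expi (2 * sigma * t) * (Psi x)%:C)]) /\
  (* (iv) *)
  (forall phi psi : R -> R, S (phi, psi) ->
     [/\ Hinfty phi, Hinfty psi &
         exists phi' psi' : R -> R,
           [/\ continuous_rep phi phi', continuous_rep psi psi' &
               exists delta C : R, [/\ 0 < delta, 0 < C &
                 forall x, `|phi' x| + `|psi' x| <= C * expR (- delta * `|x|)]]]).
Proof.
move=> alpha0 beta0 M S.
have euler (phi psi : R -> R) : S (phi, psi) -> exists u P Q,
    [/\ represents u phi psi, h2 u &
    let kap := 2 * Mval alpha0 beta0 lambda / (3 * lambda) in forall x,
    [/\ dv (sF u) x (P x), dv P x (alpha0 * sF u x - kap * (sF u x * sG u x)),
      dv (sG u) x (Q x) & dv Q x (beta0 * sG u x - kap / 2 * sF u x ^+ 2)]].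
  move=> /(Smin_represents alpha0_gt0 beta0_gt0 lambda_gt0)[u [ur hu Ju Eu]].
  have [P [Q H]] := minimizer_ODE alpha0_gt0 beta0_gt0 lambda_gt0
    (Mval_gt0 alpha0_gt0 beta0_gt0 lambda_gt0) (Mval_le alpha0_gt0 beta0_gt0 lambda_gt0) hu Ju Eu.
  by exists u, P, Q.
have creps (u : state R) (phi psi : R -> R) : represents u phi psi ->
    continuous_rep phi (sF u) /\ continuous_rep psi (sG u).
  by move=> [[hF _ HF] [hG _ HG]]; split; split => //; [exact: h1_continuous hF|exact: h1_continuous hG].
split; first by have /andP[] := Mmin_bounds alpha0_gt0 beta0_gt0 lambda_gt0.
split; first split.
- exact: (minimizing_sequences alpha0_gt0 beta0_gt0 lambda_gt0).
- exact: (Smin_nonempty alpha0_gt0 beta0_gt0 lambda_gt0).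
split=> phi psi /euler[u [P [Q [ur hu /= ode]]]]; have [rF rG] := creps u phi psi ur.
- set kap := 2 * _ / _ in ode; exists kap.
  split; first by rewrite gt_eqF// !divr_gt0 ?mulr_gt0// Mval_gt0.
  exists (sF u), (sG u); split; [exact: rF|exact: rG|].
  (* Scaling by kap leaves the linear terms alone and absorbs the coefficient of the quadratic ones:
     kap (kap F G) = Phi Psi. *)
  pose Phi x := kap * sF u x; pose Psi x := kap * sG u x.
  have ode' x : [/\ dv Phi x (kap * P x), dv (fun x => kap * P x) x (alpha0 * Phi x - Phi x * Psi x),
     dv Psi x (kap * Q x) & dv (fun x => kap * Q x) x (beta0 * Psi x - 2^-1 * Phi x ^+ 2)].
    have [D1 D2 D3 D4] := ode x; split; [exact: dvZ| |exact: dvZ|].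
      by apply: dv_eq (dvZ kap D2) _; rewrite /Phi /Psi; ring.
    by apply: dv_eq (dvZ kap D4) _; rewrite /Phi /Psi; field.
  by split; [exact: dv_ode_solution ode'|exact: dv_nls_solution ode'].
have [hF hG] := hu; have [[_ mphi Fphi] [_ mpsi Gpsi]] := ur.
have [d d0 dec] := ode_algebra_decay alpha0_gt0 beta0_gt0 hF hG ode.
have aF := ode_algebraF (sF u) (sG u) P Q; have aG := ode_algebraG (sF u) (sG u) P Q.
split.
- by apply: (expdec_Hinfty d0 mphi Fphi) => n; [exact: (ode_algebra_derive1n ode n aF).2|exact: dec].
- by apply: (expdec_Hinfty d0 mpsi Gpsi) => n; [exact: (ode_algebra_derive1n ode n aG).2|exact: dec].
exists (sF u), (sG u); split; [exact: rF|exact: rG|].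
have [C HC] := dec 0%N _ aF; have [D HD] := dec 0%N _ aG.
(* The added 1 makes the constant positive even if both bounds are 0. *)
exists d, (`|C| + `|D| + 1); split; [exact: d0|by rewrite ltr_wpDl|move=> x].
have := HC x; have := HD x; rewrite !derive1n0 => hD hC.
have E0 := expR_ge0 (- d * `|x|).
have h1 := ler_wpM2r E0 (ler_norm C); have h2 := ler_wpM2r E0 (ler_norm D).
by rewrite !mulrDl mul1r; move: h1 h2 hC hD E0; clear; lra.
Qed.
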